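(* Let $N,M\ge 1$, $\mu>0$, $\lambda_1,\dots,\lambda_N>0$ and $\mathbf{P_C}=(p^c_{ij})\in[0,1]^{N\times M}$, and consider the correlated multi-sensor M/M/1/1 status update system with these parameters (described in the context). Put $\lambda_C=\sum_{i=1}^N\lambda_i$, $\lambda^*_j=\sum_{i=1}^N p^c_{ij}\lambda_i$ and $\tilde p_j=\lambda^*_j/\lambda_C$, and let $Y$ be a random variable distributed as the time between two consecutive service completions (departures) of the server. Then for every $j\in\{1,\dots,M\}$ with $\tilde p_j>0$ the average Age of Information of process $j$ is $$\Delta_j=\frac{\lambda_C}{\lambda_C+\mu}\left(\frac{\mu\,\mathbb{E}[Y^2]}{2}+\frac{\mu\,\mathbb{E}[Y]^2(1-\tilde p_j)}{\tilde p_j}+\mathbb{E}[Y]\right).$$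
   Context: System: there are $N$ sensors, $M$ information processes and one server. Sensor $i$ generates packets according to a Poisson process of rate $\lambda_i$; the Poisson processes of different sensors are independent. Each packet generated by sensor $i$ contains information about process $j$ with probability $p^c_{ij}$, independently across packets and independently of generation and service times; such a packet is called informative for process $j$, otherwise it is uninformative for $j$. All packets go to a common server with no buffer: a packet arriving (at its generation instant) when the server is idle enters service immediately, and a packet arriving when the server is busy is dropped. Service times are i.i.d. exponential with rate $\mu$, independent of everything else. At the end of its service a packet is delivered to the monitor. Inter-departure times: if $t'_k$ is the service completion time of the $k$-th served packet, then $Y_k=t'_k-t'_{k-1}$; these all have the same distribution, and $Y$ denotes a random variable with this distribution. Age of Information: $\Delta_j(t)=t-T_j(t)$, where $T_j(t)$ is the generation time of the most recently generated packet informative for process $j$ that has been delivered to the monitor by time $t$ (before the first such delivery any fixed finite initial value is used). The average Age of Information is the long-run time average $\Delta_j=\lim_{T\to\infty}\frac1T\int_0^T\Delta_j(t)\,dt$ (almost surely). *)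

(* Defs.v *)
From HB Require Import structures.
From mathcomp Require Import all_boot all_order all_algebra.
From mathcomp Require Import all_classical all_reals all_analysis.

Set Implicit Arguments.
Unset Strict Implicit.
Unset Printing Implicit Defensive.

Import Order.TTheory GRing.Theory Num.Theory.
Import numFieldNormedType.Exports.

Local Open Scope classical_set_scope.
Local Open Scope ring_scope.

Section Probability.
Context d (Omega : measurableType d) (R : realType) (P : probability Omega R).

Definition mutually_independent (I : eqType) (F : I -> set_system Omega) :=
  forall (s : seq I) (A : I -> set Omega), uniq s ->
    (forall i, i \in s -> F i (A i)) ->
    P (\bigcap_(i in [set` s]) A i) = (\prod_(i <- s) P (A i))%E.

(* The equality is only required on measurable sets: both sides are total
   functions on [set R], with meaningless values elsewhere. *)
Definition exponentially_distributed (rate : R) (X : Omega -> R) :=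
  forall A : set R, measurable A -> P (X @^-1` A) = exponential_prob rate A.

Definition gap (g : nat -> Omega -> R) (n : nat) (w : Omega) : R :=
  if n is m.+1 then g m.+1 w - g m w else g 0%N w.

(* [g n] is the (n+1)-st point on the positive half-line. *)
Definition poisson_process (rate : R) (g : nat -> Omega -> R) :=
  (forall n, exponentially_distributed rate (gap g n)) /\
  mutually_independent
    (fun n => preimage_set_system [set: Omega] (gap g n) measurable).

Section System.
Variables N M : nat.

(* [gen i n] is the generation time of the n-th packet of sensor i,
   [info i n j] the event that this packet is informative for process j, and
   [serv k] the service time of the k-th packet that enters service. *)
Variables (gen : 'I_N -> nat -> Omega -> R)
  (info : 'I_N -> nat -> 'I_M -> set Omega) (serv : nat -> Omega -> R).

(* The independent sources of randomness: the point process of each sensor, the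
   contents of each packet (the set of all j it is informative for, so nothing
   is assumed about dependence between processes), and each service time. *)
Definition source_events (x : 'I_N + ('I_N * nat) + nat) : set_system Omega :=
  match x with
  | inl (inl i) =>
      <<s \bigcup_n preimage_set_system [set: Omega] (gen i n) measurable >>
  | inl (inr (i, n)) => <<s range (info i n) >>
  | inr k => preimage_set_system [set: Omega] (serv k) measurable
  end.

Record status_update_system (lambda : 'I_N -> R) (p : 'I_N -> 'I_M -> R)
    (mu : R) : Prop := {
  generation_poisson : forall i, poisson_process (lambda i) (gen i);
  measurable_info : forall i n j, measurable (info i n j);
  info_prob : forall i n j, P (info i n j) = (p i j)%:E;
  service_exponential : forall k, exponentially_distributed mu (serv k);
  sources_independent : mutually_independent source_events }.

End System.
End Probability.

(* The server along one sample path: [g i n] are generation times, [s k] service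
   times, and [c i n] says that packet (i, n) is informative for the process
   under consideration.  The server is idle at time 0.  Simultaneous arrivals,
   and arrivals at the instant of a departure, have probability zero and are
   therefore not treated separately. *)
Section SamplePath.
Context (R : realType) (N : nat).
Variables (g : 'I_N -> nat -> R) (s : nat -> R) (c : 'I_N -> nat -> Prop).

Definition next_generation (t : R) : R :=
  inf [set u | t < u /\ exists i n, u = g i n].

Fixpoint departure (k : nat) : R :=
  next_generation (if k is k'.+1 then departure k' else 0) + s k.

Definition service_start (k : nat) : R :=
  next_generation (if k is k'.+1 then departure k' else 0).

Definition inter_departure (k : nat) : R := departure k.+1 - departure k.

(* There is no buffer, so the k-th served packet is the one generated at the
   instant [service_start k]. *)
Definition delivered_informative (t : R) : set R :=
  [set u | exists i n k,
    [/\ u = g i n, u = service_start k, departure k <= t & c i n]].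

Definition last_generation (init t : R) : R :=
  if pselect (delivered_informative t !=set0) then sup (delivered_informative t)
  else init.

Definition age (init t : R) : R := t - last_generation init t.

End SamplePath.

(* A process [Delta w t] has long-run time average [a] almost surely. *)
Definition has_time_average d (Omega : measurableType d) (R : realType)
    (P : probability Omega R) (Delta : Omega -> R -> R) (a : \bar R) :=
  {ae P, forall w,
    ((T^-1)%:E * \int[lebesgue_measure]_(t in `[0%R, T]) (Delta w t)%:E)%E
      @[T --> +oo] --> a}.

Definition total_rate (R : realType) N (lambda : 'I_N -> R) : R :=
  \sum_(i < N) lambda i.

Definition informative_rate (R : realType) N M (lambda : 'I_N -> R)
    (p : 'I_N -> 'I_M -> R) (j : 'I_M) : R :=
  \sum_(i < N) p i j * lambda i.

Definition informative_fraction (R : realType) N M (lambda : 'I_N -> R)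
    (p : 'I_N -> 'I_M -> R) (j : 'I_M) : R :=
  informative_rate lambda p j / total_rate lambda.

(* Main.v *)
(* A service cycle consists of an idle period [E], ending with the generation of
   the packet that is served, and its service time [s].  By the strong Markov
   property of the superposed marked Poisson processes at departure times, every
   idle period is exponential of rate [lambda_C] and independent of the past, and
   the served packet is informative with probability [kappa = pj], independently
   of [E] and of the past.  The age [b k] of process [j] just after the [k]-th
   departure therefore satisfies [b (k+1) = s k + (1 - 1_{B k}) (b k + E k)], where
   [B k] says that the packet is informative, and over a cycle of length
   [y = E + s] the age integrates to [b y + y^2 / 2].  Laws of large numbers for
   square-integrable martingale differences give the almost sure averages of [b],
   [b E], [b s] and [y^2] over the cycles, and a renewal-reward argument turns
   the average per cycle into a time average. *)
Require Import Defs.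
From HB Require Import structures.
From mathcomp Require Import all_boot all_order all_algebra.
From mathcomp Require Import all_classical all_reals all_analysis.
From mathcomp Require Import measurable_realfun.
From mathcomp Require Import ring lra.
Import Order.TTheory GRing.Theory Num.Theory.
Import numFieldNormedType.Exports.
Local Open Scope classical_set_scope.
Local Open Scope ring_scope.

(** * Sigma-algebras generated by observations *)

(** The strong Markov property is needed at departure times, which depend on all sources and on the
    service times. In place of a filtration in continuous time, the past is a system of generating
    events, and [memoryless] joins independence and the exponential law in one product formula,
    which survives the change of cycle. Independence of the sources is recorded one source at a
    time, given everything about the others, so that each renewal concerns a single process.

    [history] contains all service times from the start, to make departure times measurable; a
    service time is thus not independent of it. Service times are treated with a smaller filtration,
    past cycles and past services, to which the residual age is still adapted.

    The laws of large numbers are proved along the squares [(n + 1)^2], where second moments of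
    order [n] suffice, and extended to all [n] by monotonicity. This requires nonnegative summands,
    whence the compensated averages, and square-integrable ones: for squares of exponential
    variables this means fourth moments. *)

Section SigmaAlgebra.
Context {d} {Omega : measurableType d}.
Implicit Types (G : set_system Omega).

Lemma sigma_setT G : <<s G >> setT.
Proof. exact: (@measurableT _ (g_sigma_algebraType G)). Qed.

Lemma sigma_setI G A B : <<s G >> A -> <<s G >> B -> <<s G >> (A `&` B).
Proof. exact: (@measurableI _ (g_sigma_algebraType G)). Qed.

Lemma sigma_bigcap G (F : nat -> set Omega) :
  (forall n, <<s G >> (F n)) -> <<s G >> (\bigcap_n F n).
Proof. by move=> GF; apply: (@bigcapT_measurable _ (g_sigma_algebraType G)). Qed.

Lemma sigma_fin_bigcap G (I : finType) (D : set I) (F : I -> set Omega) :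
  (forall i, D i -> <<s G >> (F i)) -> <<s G >> (\bigcap_(i in D) F i).
Proof.
move=> GF; apply: (@fin_bigcap_measurable _ (g_sigma_algebraType G)) => //.
Qed.

Lemma bigcap_seq_cons (T : Type) (I : eqType) (a : I) (s : seq I) (A : I -> set T) :
  \bigcap_(i in [set` a :: s]) A i = A a `&` \bigcap_(i in [set` s]) A i.
Proof.
apply/seteqP; split => w H.
  by split => [|i si]; apply: H; rewrite /= in_cons ?eqxx// (_ : i \in s) ?orbT.
by move=> i /=; rewrite in_cons => /predU1P[->|si]; [exact: H.1|exact: H.2].
Qed.

Lemma sigma_seq_bigcap G (I : eqType) (s : seq I) (F : I -> set Omega) :
  (forall i, i \in s -> <<s G >> (F i)) -> <<s G >> (\bigcap_(i in [set` s]) F i).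
Proof.
elim: s => [|a s IH] GF; first by rewrite set_nil bigcap_set0; exact: sigma_setT.
rewrite bigcap_seq_cons; apply: sigma_setI; first by apply: GF; rewrite mem_head.
by apply: IH => i si; apply: GF; rewrite in_cons si orbT.
Qed.

Lemma sigma_sub G (G' : set_system Omega) :
  G `<=` <<s G' >> -> <<s G >> `<=` <<s G' >>.
Proof. by apply: smallest_sub; exact: smallest_sigma_algebra. Qed.

(* The trace of a sigma-algebra on [C]: only the generators have to be checked. *)
Lemma sigma_trace G (G' : set_system Omega) (C : set Omega) :
  (forall A, G A -> exists2 B, <<s G' >> B & A `&` C = B `&` C) ->
  forall A, <<s G >> A -> exists2 B, <<s G' >> B & A `&` C = B `&` C.
Proof.
move=> GG'; pose S : set_system Omega :=
  [set A | exists2 B, <<s G' >> B & A `&` C = B `&` C].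
suff : <<s G >> `<=` S by [].
apply: smallest_sub => //; split.
- by exists set0 => //; exact: sigma_algebra0.
- move=> A [B G'B AB]; exists (~` B); first exact: (@sigma_algebraC Omega).
  rewrite setTD; apply/seteqP; split => w [nA Cw]; split => // Bw; apply: nA.
    by have [] : (A `&` C) w by rewrite AB.
  by have [] : (B `&` C) w by rewrite -AB.
- move=> F /(_ _)/cid2-/all_sig[B HB].
  exists (\bigcup_n B n).
    by apply: sigma_algebra_bigcup => n; have [] := HB n.
  rewrite !setI_bigcupl; apply: eq_bigcupr => n _; by have [] := HB n.
Qed.

Lemma sigma_measurable G : G `<=` measurable -> <<s G >> `<=` measurable.
Proof. by apply: smallest_sub; exact: sigma_algebra_measurable. Qed.

End SigmaAlgebra.

Section MeasurableFor.
Context {d} {Omega : measurableType d} {R : realType}.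
Implicit Types (G : set_system Omega) (X Y : Omega -> R).

Definition measurable_for G X :=
  forall B : set R, measurable B -> <<s G >> (X @^-1` B).

Lemma measurable_forP G X :
  measurable_for G X <->
  measurable_fun (setT : set (g_sigma_algebraType G)) X.
Proof.
split=> [mX _ B mB|mX B mB]; first by rewrite setTI; exact: mX.
by have := mX measurableT B mB; rewrite setTI.
Qed.

Lemma measurable_for_sub G (G' : set_system Omega) X :
  G `<=` <<s G' >> -> measurable_for G X -> measurable_for G' X.
Proof. by move=> GG' mX B mB; apply: (sigma_sub _ _ GG'); exact: mX. Qed.

Lemma measurable_for_cst G (r : R) : measurable_for G (fun=> r).
Proof. by apply/measurable_forP; exact: measurable_cst. Qed.

Lemma measurable_forD G X Y : measurable_for G X -> measurable_for G Y ->
  measurable_for G (fun w => X w + Y w).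
Proof. by move=> /measurable_forP mX /measurable_forP mY; apply/measurable_forP; exact: measurable_funD. Qed.

Lemma measurable_forB G X Y : measurable_for G X -> measurable_for G Y ->
  measurable_for G (fun w => X w - Y w).
Proof. by move=> /measurable_forP mX /measurable_forP mY; apply/measurable_forP; exact: measurable_funB. Qed.

Lemma measurable_forM G X Y : measurable_for G X -> measurable_for G Y ->
  measurable_for G (fun w => X w * Y w).
Proof. by move=> /measurable_forP mX /measurable_forP mY; apply/measurable_forP; exact: measurable_funM. Qed.

Lemma measurable_for_comp G X (f : R -> R) :
  measurable_fun setT f -> measurable_for G X ->
  measurable_for G (fun w => f (X w)).
Proof.
move=> mf mX B mB; rewrite (_ : _ @^-1` _ = X @^-1` (f @^-1` B))//; apply: mX.
by have := mf measurableT B mB; rewrite setTI.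
Qed.

Lemma measurable_for_lt G X Y : measurable_for G X -> measurable_for G Y ->
  <<s G >> [set w | X w < Y w].
Proof.
move=> mX mY.
rewrite (_ : [set w | _] = (fun w => Y w - X w) @^-1` `]0, +oo[).
  by apply: measurable_forB => //; exact: measurable_itv.
by apply/seteqP; split => w /=; rewrite in_itv/= andbT subr_gt0.
Qed.

Lemma measurable_for_le G X Y : measurable_for G X -> measurable_for G Y ->
  <<s G >> [set w | X w <= Y w].
Proof.
move=> mX mY.
rewrite (_ : [set w | _] = ~` [set w | Y w < X w]).
  by apply: (@sigma_algebraC Omega); exact: measurable_for_lt.
by apply/seteqP; split => w /=; rewrite leNgt => /negP.
Qed.

Lemma measurable_for_indic G (A : set Omega) : <<s G >> A ->
  measurable_for G (\1_A : Omega -> R).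
Proof. by move=> GA; apply/measurable_forP; exact: measurable_indic. Qed.

Lemma measurable_for_measurable G X : G `<=` measurable ->
  measurable_for G X -> measurable_fun setT X.
Proof. by move=> Gm mX _ B mB; rewrite setTI; apply: (sigma_measurable _ Gm); exact: mX. Qed.

Lemma preimage_measurable X (B : set R) : measurable_fun setT X -> measurable B ->
  measurable (X @^-1` B).
Proof. by move=> mX mB; rewrite -[_ @^-1` _]setTI; exact: mX. Qed.

Lemma measurable_forT X : measurable_fun setT X -> measurable_for measurable X.
Proof. by move=> mX B mB; apply: sub_sigma_algebra; exact: preimage_measurable. Qed.

Lemma tail_preimage X (x : R) : [set w | x < X w] = X @^-1` `]x, +oo[.
Proof. by apply/seteqP; split => w /=; rewrite in_itv/= andbT. Qed.

Lemma measurable_lt_fun X Y : measurable_fun setT X ->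
  measurable_fun setT Y -> measurable [set w | X w < Y w].
Proof.
move=> mX mY; rewrite (_ : [set w | _] = (Y \- X) @^-1` `]0, +oo[).
  by apply: preimage_measurable; [exact: measurable_funB|exact: measurable_itv].
by apply/seteqP; split => w /=; rewrite in_itv/= andbT subr_gt0.
Qed.

Lemma measurable_tail X (x : R) : measurable_fun setT X -> measurable [set w | x < X w].
Proof. by move=> mX; apply: measurable_lt_fun => //; exact: measurable_cst. Qed.

End MeasurableFor.

Section Probability.
Context {d} {Omega : measurableType d} {R : realType} (P : probability Omega R).
Implicit Types (G : set_system Omega) (A B K H : set Omega).

Lemma prob_fin_num A : measurable A -> P A \is a fin_num.
Proof. by move=> mA; exact: fin_num_measure. Qed.

Lemma prob_bigcup (F : nat -> set Omega) : (forall n, measurable (F n)) ->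
  trivIset setT F -> P (\bigcup_n F n) = (\sum_(n <oo) P (F n))%E.
Proof.
move=> mF tF; rewrite measure_bigcup//.
by apply: eq_eseriesl => i; rewrite in_setT.
Qed.

Lemma prob_setD A B : measurable A -> measurable B ->
  P (A `\` B) = (P A - P (A `&` B))%E.
Proof.
move=> mA mB; apply: measureD => //.
by apply: (le_lt_trans (probability_le1 P mA)); rewrite ltry.
Qed.

(** Dynkin's argument: the events [A] satisfying the product formula form a lambda-system, so a
    generating family stable under intersection is enough. That [r] is real keeps the subtraction
    for complements finite. *)
Lemma indep_sigma G B (r : R) : G `<=` measurable -> setI_closed G ->
  measurable B -> P B = r%:E ->
  (forall A, G A -> P (A `&` B) = (P A * r%:E)%E) ->
  forall A, <<s G >> A -> P (A `&` B) = (P A * r%:E)%E.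
Proof.
move=> Gm GI mB PB GB.
suff : <<s G >> `<=` [set A | measurable A /\ P (A `&` B) = (P A * r%:E)%E].
  by move=> sG A /sG[].
apply: lambda_system_subset => //; last by move=> A GA; split; [exact: Gm|exact: GB].
apply/dynkin_lambda_system; split.
- by split => //; rewrite setTI PB probability_setT mul1e.
- move=> A [mA PA]; split; first exact: measurableC.
  rewrite setIC -setDE prob_setD// (setIC B) PA PB probability_setC// muleBl ?mul1e//.
- move=> F tF mF; split; first by apply: bigcupT_measurable => n; have [] := mF n.
  have mF' n : measurable (F n) by have [] := mF n.
  rewrite setI_bigcupl [LHS]prob_bigcup; last 2 first.
  + by move=> n; exact: measurableI.
  + exact: trivIset_setIr.
  rewrite prob_bigcup//.
  rewrite muleC -nneseriesZl; last by [].
  by apply: eq_eseriesr => n _; rewrite muleC; have [] := mF n.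
Qed.

Lemma prob_partition (I : countType) (C : I -> set Omega) A B (r : R) :
  trivIset setT C -> \bigcup_i C i = setT -> (forall i, measurable (C i)) ->
  measurable A -> measurable B ->
  (forall i, P (A `&` C i) = (P (B `&` C i) * r%:E)%E) ->
  P A = (P B * r%:E)%E.
Proof.
move=> tC CT mC mA mB AB.
pose D n := if @unpickle I n is Some i then (if pickle i == n then C i else set0) else set0.
have DT : \bigcup_n D n = setT.
  apply/seteqP; split => // w _; have : (\bigcup_i C i) w by rewrite CT.
  by move=> [i _ Cw]; exists (pickle i) => //; rewrite /D pickleK eqxx.
have tD : trivIset setT D.
  move=> m n _ _ [w []]; rewrite /D.
  case: (unpickle m) => // i; case: (eqVneq _ m) => // <-{m} Ci.
  case: (unpickle n) => // j; case: (eqVneq _ n) => // <-{n} Cj.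
  by congr pickle; apply: tC => //; exists w.
have mD n : measurable (D n).
  by rewrite /D; case: unpickle => // i; case: ifP.
have key E : measurable E -> P E = (\sum_(n <oo) P (E `&` D n))%E.
  move=> mE; rewrite -[in LHS](setIT E) -DT setI_bigcupr prob_bigcup//.
    by move=> i; exact: measurableI.
  exact: trivIset_setIl.
rewrite key// [in RHS]key// muleC -nneseriesZl; last by [].
apply: eq_eseriesr => n _; rewrite /D; case: unpickle => [i|]; last by rewrite !setI0 measure0 mule0.
by case: ifP => _; rewrite ?setI0 ?measure0 ?mule0// AB muleC.
Qed.

End Probability.

(** * Marked Poisson processes *)

Section Memoryless.
Context {d} {Omega : measurableType d} {R : realType} (P : probability Omega R).
Implicit Types (G : set_system Omega) (H K : set Omega) (X tau : Omega -> R).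

(* [X] is exponential and [K] has probability [kappa], independently of each
   other and of [G]. *)
Definition memoryless G (lambda : R) X K (kappa : R) :=
  forall H x, 0 <= x -> <<s G >> H ->
    P (H `&` [set w | x < X w] `&` K) = (P H * (kappa * expR (- lambda * x))%:E)%E.

(* [tau] is rounded up to multiples of [1/(q+1)], for which the statement is a
   countable sum; [q] then tends to infinity. *)
Lemma memoryless_shift G (Gm : G `<=` measurable) (lambda : R) X K (kappa : R)
    (lambda_ge0 : 0 <= lambda) (kappa_ge0 : 0 <= kappa)
    (mX : measurable_fun setT X) (mK : measurable K)
    (ml1 : memoryless G lambda X setT 1) (ml : memoryless G lambda X K kappa)
    H tau (x : R) :
  <<s G >> H -> measurable_for G tau -> (forall w, H w -> 0 <= tau w) -> 0 <= x ->
  P (H `&` [set w | tau w + x < X w] `&` K) =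
  (P (H `&` [set w | (tau w < X w)%R]) * (kappa * expR (- lambda * x))%:E)%E.
Proof.
move=> GH mtau tau0 x0.
have mtau' := measurable_for_measurable _ _ Gm mtau.
have mH : measurable H := sigma_measurable _ Gm _ GH.
have mlt (Z : Omega -> R) : measurable_fun setT Z -> measurable [set w | Z w < X w].
  by move=> mZ; exact: measurable_lt_fun.
have mA (Z : Omega -> R) L : measurable_fun setT Z -> measurable L ->
    measurable (H `&` [set w | Z w < X w] `&` L).
  by move=> mZ mL; do 2 apply: measurableI => //; exact: mlt.
(* [tq q] is the first grid point strictly above [tau], constant on each cell [C q j]. On [H], where
   [tau] is nonnegative, it satisfies [tau < tq q <= tau + 1/(q+1)]. *)
pose tq (q : nat) w : R := (Num.trunc (q.+1%:R * tau w)).+1%:R / q.+1%:R.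
pose C (q j : nat) := [set w | j%:R <= q.+1%:R * tau w] `&`
  [set w | q.+1%:R * tau w < j.+1%:R].
have GC q j : <<s G >> (C q j).
  have mq : measurable_for G (fun w => q.+1%:R * tau w).
    by apply: measurable_forM => //; exact: measurable_for_cst.
  by apply: sigma_setI; [apply: measurable_for_le|apply: measurable_for_lt] => //;
    exact: measurable_for_cst.
have CT q w : H w -> C q (Num.trunc (q.+1%:R * tau w)) w.
  by move=> /tau0 t0; apply/andP; apply: Num.Theory.truncn_itv; rewrite mulr_ge0.
have Ceq q j w : H w -> C q j w -> tq q w = j.+1%:R / q.+1%:R.
  by move=> Hw [Cw1 Cw2]; rewrite /tq (@Num.Theory.truncn_def _ _ j) ?Cw1.
have tC q : trivIset setT (fun j => H `&` C q j).
  move=> i j _ _ [w [[Hw Ci] [_ Cj]]].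
  have := Ceq _ _ _ Hw Ci; rewrite (Ceq _ _ _ Hw Cj) => /(congr1 ( *%R^~ q.+1%:R)).
  by rewrite !divfK ?pnatr_eq0// => /eqP; rewrite eqr_nat eqSS => /eqP.
have dec L r q y : measurable L -> memoryless G lambda X L r -> 0 <= y ->
    P (H `&` [set w | tq q w + y < X w] `&` L) =
    (\sum_(j <oo) P (H `&` C q j) * (r * expR (- lambda * (j.+1%:R / q.+1%:R + y)))%:E)%E.
  move=> mL mlL y0.
  have E : H `&` [set w | tq q w + y < X w] `&` L =
    \bigcup_j (H `&` C q j `&` [set w | j.+1%:R / q.+1%:R + y < X w] `&` L).
    apply/seteqP; split=> w.
      move=> [[Hw /= ltX] Kw]; exists (Num.trunc (q.+1%:R * tau w)) => //.
      by have Cw := CT q _ Hw; rewrite /= -(Ceq _ _ _ Hw Cw).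
    by move=> [j _ [[[Hw Cw] /=]]]; rewrite -(Ceq _ _ _ Hw Cw).
  rewrite E prob_bigcup; last 2 first.
  - move=> j; apply: measurableI => //; apply: measurableI; last exact/mlt/measurable_cst.
    by apply: (sigma_measurable _ Gm); exact: sigma_setI.
  - by apply: trivIset_setIr; apply: trivIset_setIr; exact: tC.
  apply: eq_eseriesr => j _; apply: mlL; last exact: sigma_setI.
  by rewrite addr_ge0// divr_ge0.
(* On the grid both probabilities are series over the same cells, and corresponding terms differ
   exactly by the factor [kappa * expR (- lambda * x)]. *)
have scale q : P (H `&` [set w | tq q w + x < X w] `&` K) =
    (P (H `&` [set w | (tq q w + 0 < X w)%R] `&` setT) * (kappa * expR (- lambda * x))%:E)%E.
  rewrite (dec _ kappa)// (dec _ 1)// muleC -nneseriesZl; last first.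
    by move=> j _; rewrite mule_ge0// lee_fin mulr_ge0// expR_ge0.
  apply: eq_eseriesr => j _; rewrite muleCA; congr (_ * _)%E.
  rewrite -EFinM; congr EFin; rewrite addr0 mulrDr expRD; ring.
pose a L (y : R) := P (H `&` [set w | tau w + y < X w] `&` L).
have mtc y : measurable_fun setT (fun w => tau w + y).
  by apply: measurable_funD => //; exact: measurable_cst.
have tq1 q w : H w -> tau w < tq q w.
  move=> Hw; have [_ /=] := CT q _ Hw.
  by rewrite /tq ltr_pdivlMr ?ltr0n// mulrC.
have tq2 q w : H w -> tq q w <= tau w + q.+1%:R^-1.
  move=> Hw; have [/= + _] := CT q _ Hw.
  move=> le1; rewrite /tq ler_pdivrMr ?ltr0n// mulrDl mulVf ?pnatr_eq0//.
  by rewrite -[leLHS]natr1 lerD2r (mulrC (tau w)).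
have mtq q : measurable_fun setT (tq q).
  apply: measurable_funM; last exact: measurable_cst.
  rewrite (_ : (fun w => _) = (fun r : R => (Num.trunc r).+1%:R) \o (fun w => q.+1%:R * tau w))//.
  apply: measurableT_comp; last by apply: measurable_funM => //; exact: measurable_cst.
  by apply: nondecreasing_measurable => // r s rs; rewrite ler_nat ltnS Num.Theory.le_truncn.
have le1 L q y : measurable L -> (a L (q.+1%:R^-1 + y)%R <= P (H `&` [set w | (tq q w + y < X w)%R] `&` L))%E.
  move=> mL; apply: le_measure; rewrite ?inE; [exact: mA|apply: mA => //|].
    by apply: measurable_funD => //; exact: measurable_cst.
  move=> w [[Hw /= lt] Kw]; split => //; split => //=.
  by apply: le_lt_trans lt; rewrite addrA lerD2r tq2.
have le2 L q y : measurable L -> (P (H `&` [set w | (tq q w + y < X w)%R] `&` L) <= a L y)%E.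
  move=> mL; apply: le_measure; rewrite ?inE; [apply: mA => //|exact: mA|].
    by apply: measurable_funD => //; exact: measurable_cst.
  move=> w [[Hw /= lt] Kw]; split => //; split => //=.
  by apply: le_lt_trans lt; rewrite lerD2r ltW// tq1.
(* Continuity from below: as the inequality is strict, the events with margin [1/(q+1)] increase to
   the event without margin. *)
have a_cvg L y : measurable L -> a L (q.+1%:R^-1 + y) @[q --> \oo] --> a L y.
  move=> mL.
  have -> : a L y = P (\bigcup_q (H `&` [set w | tau w + (q.+1%:R^-1 + y) < X w] `&` L)).
    congr (P _); apply/seteqP; split=> w.
      move=> [[Hw /= lt] Kw].
      have d0 : 0 < X w - (tau w + y) by rewrite subr_gt0.
      have [q _ Hq] := near_infty_natSinv_lt (PosNum d0).
      exists q => //; split => //; split => //=.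
      by have := Hq q (leqnn q); rewrite /= => Hq'; rewrite addrCA -ltrBrDr.
    move=> [q _ [[Hw /= lt] Kw]]; split => //; split => //=.
    by apply: lt_trans lt; rewrite ltrD2l ltrDr invr_gt0.
  apply: nondecreasing_cvg_mu.
  - by move=> q; exact: mA.
  - by apply: bigcupT_measurable => q; exact: mA.
  - move=> m n mn; apply/subsetPset => w [[Hw /= lt] Kw]; split => //; split => //=.
    by apply: le_lt_trans lt; rewrite lerD2l lerD2r lef_pV2 ?posrE// ler_nat.
have e0 : (0 <= (kappa * expR (- lambda * x))%:E)%E.
  by rewrite lee_fin mulr_ge0// expR_ge0.
have a0E : P (H `&` [set w | tau w < X w]) = a setT 0.
  by rewrite /a setIT; congr (P (_ `&` _)); apply/seteqP; split => w /=; rewrite addr0.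
rewrite a0E -/(a K x).
apply/eqP; rewrite eq_le; apply/andP; split.
- apply: (cvge_to_le (a_cvg K x mK)); apply: nearW => q.
  by apply: (le_trans (le1 K q x mK)); rewrite scale; apply: lee_wpmul2r => //; exact: le2.
- have : (a setT (q.+1%:R^-1 + 0)%R * (kappa * expR (- lambda * x))%:E)%E @[q --> \oo] -->
    (a setT 0%R * (kappa * expR (- lambda * x))%:E)%E.
    by apply: cvgeZr => //; exact: a_cvg.
  move=> /cvge_to_le; apply; apply: nearW => q.
  by apply: le_trans (le2 K q x mK); rewrite scale; apply: lee_wpmul2r => //; exact: le1.
Qed.

Definition source_sets (h : nat -> Omega -> R) (c : nat -> set Omega) : set_system Omega :=
  [set A | exists n, (exists2 B, measurable B & A = h n @^-1` B) \/ A = c n].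

Definition past_sets (h : nat -> Omega -> R) (c : nat -> set Omega) m : set_system Omega :=
  [set A | exists2 n, (n < m)%N & (exists2 B, measurable B & A = h n @^-1` B) \/ A = c n].

Lemma past_sets0 h c : past_sets h c 0 = set0.
Proof. by apply/seteqP; split => // A []. Qed.

Lemma past_setsS h c m n : (m <= n)%N -> past_sets h c m `<=` past_sets h c n.
Proof. by move=> mn A [i im HA]; exists i => //; exact: leq_trans mn. Qed.

Lemma sub_sigmaU G G' m n h c : G `<=` <<s G' >> -> (m <= n)%N ->
  <<s G `|` past_sets h c m >> `<=` <<s G' `|` past_sets h c n >>.
Proof.
move=> GG' mn; apply: sigma_sub => A [/GG'|/(past_setsS _ _ _ _ mn) pA].
  by apply: sub_sigma_algebra2 => B; left.
by apply: sub_sigma_algebra; right.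
Qed.

Lemma past_measurable_for G h c m n : (n < m)%N ->
  measurable_for (G `|` past_sets h c m) (h n).
Proof.
by move=> nm B mB; apply: sub_sigma_algebra; right; exists n => //; left; exists B.
Qed.

Lemma past_mark G h c m n : (n < m)%N -> <<s G `|` past_sets h c m >> (c n).
Proof. by move=> nm; apply: sub_sigma_algebra; right; exists n => //; right. Qed.

Lemma past_gap G h c m n : (n < m)%N ->
  measurable_for (G `|` past_sets h c m) (gap h n).
Proof.
case: n => [|n] nm; first exact: past_measurable_for.
by apply: measurable_forB; apply: past_measurable_for => //; exact: ltnW.
Qed.

Lemma measurable_gap (h : nat -> Omega -> R) n :
  (forall n, measurable_fun setT (h n)) -> measurable_fun setT (gap h n).
Proof.
case: n => [|n] mh; first exact: mh.
by rewrite (_ : gap h n.+1 = h n.+1 \- h n)//; exact: measurable_funB.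
Qed.

Lemma past_measurable G h c m : G `<=` measurable ->
  (forall n, measurable_fun setT (h n)) -> (forall n, measurable (c n)) ->
  G `|` past_sets h c m `<=` measurable.
Proof.
move=> Gm mh mc B [/Gm//|[n _ [[D mD ->]|->]//]].
by exact: preimage_measurable.
Qed.

(* A Poisson process of rate [lambda] with points [h n], the marks [c n] being
   independent of probability [kappa], and everything independent of [G]. *)
Definition marked_poisson G (lambda kappa : R) h c := forall m,
  memoryless (G `|` past_sets h c m) lambda (gap h m) setT 1 /\
  memoryless (G `|` past_sets h c m) lambda (gap h m) (c m) kappa.

Section StrongMarkov.
Variables (I : countType) (G G' : set_system Omega) (lambda : R).
Variables (h h' : nat -> Omega -> R) (c c' : nat -> set Omega).
Variables (C : I -> set Omega) (m : I -> nat) (theta : I -> Omega -> R).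
Hypotheses (Gm : G `<=` measurable) (G'm : G' `<=` measurable).
Hypotheses (mh : forall n, measurable_fun setT (h n)) (mc : forall n, measurable (c n)).
Hypotheses (mh' : forall n, measurable_fun setT (h' n)) (mc' : forall n, measurable (c' n)).
Hypotheses (lambda_ge0 : 0 <= lambda).
Hypotheses (tC : trivIset setT C) (CT : \bigcup_i C i = setT).
Hypothesis theta_past : forall i, measurable_for (G `|` past_sets h c (m i)) (theta i).
(* [G'] is the past of a random time which on [C i] falls between the points
   [m i - 1] and [m i] of the process, and equals [theta i] plus the former. *)
Hypothesis stopped : forall i H, <<s G' >> H -> exists A,
  [/\ <<s G `|` past_sets h c (m i) >> A, (forall w, A w -> 0 <= theta i w) &
      H `&` C i = A `&` [set w | theta i w < gap h (m i) w]].
Hypothesis shifted : forall i n w, C i w ->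
  h' n w = h (m i + n)%N w - (h (m i) w - gap h (m i) w) - theta i w.
Hypothesis shifted_mark : forall i n w, C i w -> c' n w <-> c (m i + n)%N w.

Let mC i : measurable (C i).
Proof.
have [A [GA _ ]] := stopped i setT (sigma_setT _).
have mpast := past_measurable _ _ _ (m i) Gm mh mc.
rewrite setTI => ->; apply: measurableI; first exact: (sigma_measurable _ mpast _ GA).
apply: measurable_lt_fun; last exact: measurable_gap.
exact: measurable_for_measurable mpast (theta_past i).
Qed.

(** The formula is checked on each cell [C i]. For [n = 0] the new gap is what remains of the gap
    [m i] of [h] after [theta i], and [memoryless_shift] applies. For later [n] the new gap is an
    intact gap of [h], and on [C i] the new past is the trace of a past of [h]. *)
Let stopped_memoryless n K (L : I -> set Omega) (kappa : R) : 0 <= kappa ->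
  measurable K -> (forall i, measurable (L i)) ->
  (forall i, K `&` C i = L i `&` C i) ->
  (forall i, memoryless (G `|` past_sets h c (m i + n)) lambda (gap h (m i + n)) setT 1) ->
  (forall i, memoryless (G `|` past_sets h c (m i + n)) lambda (gap h (m i + n)) (L i) kappa) ->
  memoryless (G' `|` past_sets h' c' n) lambda (gap h' n) K kappa.
Proof.
move=> kappa0 mK mL KL ml1 mlL H x x0 GH.
have mH : measurable H := sigma_measurable _ (past_measurable _ _ _ n G'm mh' mc') _ GH.
have mgt : measurable [set w | x < gap h' n w].
  by apply: measurable_tail; exact: measurable_gap.
apply: (prob_partition P _ _ _ _ _ tC CT mC) => //; first by do 2 apply: measurableI => //.
move=> i; have mpast := past_measurable _ _ _ (m i) Gm mh mc.
case: n => [|n] in ml1 mlL GH mgt *.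
  rewrite past_sets0 setU0 in GH.
  have [A [GA A0 AE]] := stopped i H GH.
  rewrite AE -(memoryless_shift _ mpast _ _ _ _ lambda_ge0 kappa0 _ (mL i))//; last 3 first.
  - exact: measurable_gap.
  - by have := ml1 i; rewrite addn0.
  - by have := mlL i; rewrite addn0.
  congr (P _); rewrite -setIA KL.
  have gapE w : C i w -> gap h' 0 w = gap h (m i) w - theta i w.
    by move=> Cw; rewrite /gap/= (shifted i)// addn0 -/(gap h (m i) w); ring.
  apply/seteqP; split => w /=.
    move=> [[Hw xw] [Lw Cw]]; have [Aw _] : (A `&` [set w | theta i w < gap h (m i) w]) w by rewrite -AE.
    by split => //; split => //; move: xw; rewrite -/(gap h' 0 w) gapE// ltrBrDl.
  move=> [[Aw tw] Lw].
  have lt : theta i w < gap h (m i) w by apply: le_lt_trans tw; rewrite lerDl.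
  have [Hw Cw] : (H `&` C i) w by rewrite AE.
  by rewrite -/(gap h' 0 w) gapE// ltrBrDl.
(* [H] need not be an event of the past of [h], but on [C i] every generator of the new past
   coincides with such an event. *)
have [] := @sigma_trace _ _ (G' `|` past_sets h' c' n.+1)
   (G `|` past_sets h c (m i + n.+1)) (C i) _ H GH.
  move=> A [G'A|[l ln HA]].
    have [A' [GA' _ A'E]] := stopped i A (@sub_sigma_algebra _ setT G' A G'A).
    exists (A `&` C i); last by rewrite -setIA setIid.
    rewrite A'E; apply: sigma_setI.
      by apply: (sub_sigmaU _ _ _ _ _ _ _ (leq_addr n.+1 (m i)) A' GA') => B; exact: sub_sigma_algebra.
    apply: measurable_for_lt; last by apply: past_gap; rewrite addnS ltnS leq_addr.
    apply: measurable_for_sub (theta_past i) => B [GB|pB]; apply: sub_sigma_algebra; first by left.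
    by right; apply: past_setsS pB; exact: leq_addr.
  pose X w := h (m i + l)%N w - (h (m i) w - gap h (m i) w) - theta i w.
  have mX : measurable_for (G `|` past_sets h c (m i + n.+1)) X.
    have mi : (m i < m i + n.+1)%N by rewrite addnS ltnS leq_addr.
    apply: measurable_forB; last first.
      apply: measurable_for_sub (theta_past i) => B [GB|pB]; apply: sub_sigma_algebra; first by left.
      by right; apply: past_setsS pB; exact: leq_addr.
    apply: measurable_forB; first by apply: past_measurable_for; rewrite ltn_add2l.
    by apply: measurable_forB; [exact: past_measurable_for|exact: past_gap].
  case: HA => [[D mD ->]|->].
    exists (X @^-1` D); first exact: mX.
    by apply/seteqP; split => w [/= Dw Cw]; split => //; move: Dw; rewrite (shifted i).
  exists (c (m i + l)%N); first by apply: past_mark; rewrite ltn_add2l.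
  by apply/seteqP; split => w [/= Dw Cw]; split => //; apply/(shifted_mark i).
move=> B GB HB.
(* [B] agrees with [H] only on [C i], so the cell itself must belong to the past of [h]. It does: it
   is determined by the past before [m i] and the gap [m i], which precedes [m i + n.+1]. *)
have GBC : <<s G `|` past_sets h c (m i + n.+1) >> (B `&` C i).
  have [A [GA _ ]] := stopped i setT (sigma_setT _).
  rewrite setTI => ->; apply: sigma_setI => //; apply: sigma_setI.
    by apply: (sub_sigmaU _ _ _ _ _ _ _ (leq_addr n.+1 (m i)) A GA) => D; exact: sub_sigma_algebra.
  apply: measurable_for_lt; last by apply: past_gap; rewrite addnS ltnS leq_addr.
  apply: measurable_for_sub (theta_past i) => D [GD|pD]; apply: sub_sigma_algebra; first by left.
  by right; apply: past_setsS pD; exact: leq_addr.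
rewrite HB -(mlL i _ x x0 GBC) -HB; congr (P _).
have gapE w : C i w -> gap h' n.+1 w = gap h (m i + n.+1) w.
  by move=> Cw; rewrite /gap addnS/= !(shifted i)// addnS; ring.
rewrite -setIA KL; apply/seteqP; split => w /=.
  by move=> [[Hw xw] [Lw Cw]]; rewrite -gapE.
by move=> [[[Hw Cw] xw] Lw]; rewrite -/(gap h' n.+1 w) gapE.
Qed.

Lemma strong_markov (kappa : R) : 0 <= kappa ->
  marked_poisson G lambda kappa h c -> marked_poisson G' lambda kappa h' c'.
Proof.
move=> kappa0 mp n; split.
  by apply: (stopped_memoryless n setT (fun=> setT)) => // i; have [] := mp (m i + n)%N.
apply: (stopped_memoryless n (c' n) (fun i => c (m i + n)%N)) => // i.
- by apply/seteqP; split => w [cw Cw]; split => //; apply/(shifted_mark i n w Cw).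
- by have [] := mp (m i + n)%N.
- by have [] := mp (m i + n)%N.
Qed.

End StrongMarkov.

End Memoryless.

(** * Point processes seen from a later time *)

Section Shift.
Context {R : realType}.
Implicit Types (h : nat -> R) (t u : R).

(** With the strict inequality, a point located at [t] already counts as past. *)
Definition count_points h t : nat :=
  if pselect (exists n, t < h n) is left e then ex_minn e else 0%N.

(* The points of [h] after time [t], seen from [t]. *)
Definition shift_points h t n : R := h (count_points h t + n)%N - t.

Definition point_process h :=
  [/\ 0 < h 0%N, (forall n, h n < h n.+1) & forall t, exists n, t < h n].

Lemma point_process_lt h m n : point_process h -> (m < n)%N -> h m < h n.
Proof.
move=> [_ hS _]; elim: n => // n IH; rewrite ltnS leq_eqVlt => /predU1P[->|/IH lt]; first exact: hS.
exact: lt_trans lt (hS n).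
Qed.

Lemma point_process_le h m n : point_process h -> (m <= n)%N -> h m <= h n.
Proof.
by move=> ph; rewrite leq_eqVlt => /predU1P[->//|/(point_process_lt _ _ _ ph)/ltW].
Qed.

Lemma count_points_gt h t : point_process h -> t < h (count_points h t).
Proof.
move=> [_ _ /(_ t) ht]; rewrite /count_points; case: pselect => // e.
by case: ex_minnP.
Qed.

Lemma count_points_le h t n : (n < count_points h t)%N -> h n <= t.
Proof.
rewrite /count_points; case: pselect => // e; case: ex_minnP => m _ Hm nm.
by rewrite leNgt; apply/negP => /Hm; rewrite leqNgt nm.
Qed.

Lemma count_pointsE h t n : point_process h ->
  (forall l, (l < n)%N -> h l <= t) -> t < h n -> count_points h t = n.
Proof.
move=> ph le lt; case: (ltngtP (count_points h t) n) => //.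
  by move=> /le; rewrite leNgt count_points_gt.
by move=> /count_points_le; rewrite leNgt lt.
Qed.

Lemma shift_point_process h t : point_process h -> point_process (shift_points h t).
Proof.
move=> ph; split.
- by rewrite /shift_points addn0 subr_gt0 count_points_gt.
- by move=> n; rewrite ltrD2r addnS; have [_ + _] := ph; apply.
- move=> u; have [_ _ /(_ (u + t))[n un]] := ph; exists n.
  rewrite ltrBrDr; apply: lt_le_trans un _.
  by apply: point_process_le => //; exact: leq_addl.
Qed.

Lemma shift_points0 h : point_process h -> shift_points h 0 = h.
Proof.
move=> ph; apply/funext => n; rewrite /shift_points subr0 (@count_pointsE _ _ 0%N)//.
by have [] := ph.
Qed.

Lemma count_points_shift h t u : point_process h -> 0 <= u ->
  count_points h (t + u) = (count_points h t + count_points (shift_points h t) u)%N.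
Proof.
move=> ph u0; apply: count_pointsE => // [l|].
  have [lt _|lt] := ltnP l (count_points h t).
    by apply: (le_trans (count_points_le _ _ _ lt)); rewrite lerDl.
  rewrite -{1}(subnKC lt) ltn_add2l => /count_points_le.
  by rewrite /shift_points subnKC// lerBlDl.
rewrite -ltrBrDl; exact: (count_points_gt (shift_points h t) u (shift_point_process _ _ ph)).
Qed.

(** Shifts compose, so restarting the shifted sources at the end of a cycle is the same as shifting
    the original sources to the departure time. *)
Lemma shift_shift h t u : point_process h -> 0 <= u ->
  shift_points (shift_points h t) u = shift_points h (t + u).
Proof.
move=> ph u0; apply/funext => n.
by rewrite {1}/shift_points /shift_points count_points_shift// addnA opprD addrA.
Qed.

End Shift.

Section ShiftMeasurable.
Context {d} {Omega : measurableType d} {R : realType}.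
Variables (G : set_system Omega) (h : nat -> Omega -> R) (c : nat -> set Omega)
  (tau : Omega -> R).
Hypotheses (ph : forall w, point_process (h^~ w))
  (mh : forall n, measurable_for G (h n)) (mc : forall n, <<s G >> (c n))
  (mtau : measurable_for G tau).

Lemma count_points_measurable_for n :
  <<s G >> [set w | count_points (h^~ w) (tau w) = n].
Proof.
rewrite (_ : [set w | _] = (\bigcap_l [set w | (l < n)%N -> h l w <= tau w]) `&`
                           [set w | tau w < h n w]).
  apply: sigma_setI; last exact: measurable_for_lt.
  apply: sigma_bigcap => l; case: ltnP => _.
    rewrite (_ : [set w | _] = [set w | h l w <= tau w]); first exact: measurable_for_le.
    by apply/seteqP; split => w /=; [exact|].
  by rewrite (_ : [set w | _] = setT); [exact: sigma_setT|apply/seteqP; split].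
apply/seteqP; split => w /=.
  by move=> <-; split; [move=> l _; exact: (count_points_le (h^~ w))|exact: (count_points_gt (h^~ w))].
by move=> [le lt]; apply: count_pointsE => // l; exact: le.
Qed.

Lemma shift_points_measurable_for n :
  measurable_for G (fun w => shift_points (h^~ w) (tau w) n).
Proof.
move=> B mB; rewrite (_ : _ @^-1` _ =
  \bigcup_m ([set w | count_points (h^~ w) (tau w) = m] `&`
             (fun w => h (m + n)%N w - tau w) @^-1` B)).
  apply: sigma_algebra_bigcup => m; apply: sigma_setI.
    exact: count_points_measurable_for.
  exact: measurable_forB.
apply/seteqP; split => w /=; first by exists (count_points (h^~ w) (tau w)).
by move=> [m _ [/= <-]].
Qed.

Lemma shift_mark_measurable_for n :
  <<s G >> [set w | c (count_points (h^~ w) (tau w) + n)%N w].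
Proof.
rewrite (_ : [set w | _] =
  \bigcup_m ([set w | count_points (h^~ w) (tau w) = m] `&` c (m + n)%N)).
  apply: sigma_algebra_bigcup => m; apply: sigma_setI => //.
  exact: count_points_measurable_for.
apply/seteqP; split => w /=; first by exists (count_points (h^~ w) (tau w)).
by move=> [m _ [/= <-]].
Qed.

End ShiftMeasurable.

Section Sources.
Context {R : realType} {N : nat} (i0 : 'I_N).
Implicit Types (g : 'I_N -> nat -> R).

Definition arrival_path g := (forall i, point_process (g i)) /\
  forall i j m n, g i m = g j n -> i = j.

Definition first_source g : 'I_N := [arg min_(i < i0) g i 0%N]%O.

Definition waiting_time g : R := g (first_source g) 0%N.

Lemma first_source_le g i : waiting_time g <= g i 0%N.
Proof. by rewrite /waiting_time /first_source; case: arg_minP => // j _; apply. Qed.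

Lemma first_source_lt g i : arrival_path g -> i != first_source g ->
  g (first_source g) 0%N < g i 0%N.
Proof.
move=> [_ inj] ni; rewrite lt_neqAle first_source_le andbT.
by apply: contraNN ni => /eqP/inj ->.
Qed.

Lemma first_sourceE g i : (forall j, j != i -> g i 0%N < g j 0%N) ->
  first_source g = i.
Proof.
move=> lt; apply/eqP/negPn/negP => /lt; apply/negP; rewrite -leNgt.
exact: first_source_le.
Qed.

Lemma waiting_time_gt0 g : arrival_path g -> 0 < waiting_time g.
Proof. by move=> [/(_ (first_source g))[]]. Qed.

Lemma shift_arrival_path g t : arrival_path g ->
  arrival_path (fun i => shift_points (g i) t).
Proof.
move=> [pg inj]; split=> [i|i j m n]; first exact: shift_point_process.
by move=> /(addIr (- t))/inj.
Qed.

End Sources.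

(** * Superposition of independent sources *)

Section Superposition.
Context {d} {Omega : measurableType d} {R : realType} (P : probability Omega R).
Context {N : nat} (i0 : 'I_N).
Variables (lambda p : 'I_N -> R).
Hypotheses (lambda_gt0 : forall i, 0 < lambda i) (p_ge0 : forall i, 0 <= p i).
Implicit Types (F : set_system Omega) (g : 'I_N -> nat -> Omega -> R)
  (c : 'I_N -> nat -> set Omega) (t s : Omega -> R).

(* Everything known at some time, except about the source [k]. *)
Definition others F g c k : set_system Omega :=
  F `|` [set A | exists2 j, j != k & source_sets (g j) (c j) A].

(** Joint independence of the sources given [F], in a form that concerns one source at a time: a
    random time determined partly by the other sources is admissible for source [k], because these
    are included in its past. *)
Definition fresh_sources F g c :=
  forall k, marked_poisson P (others F g c k) (lambda k) (p k) (g k) (c k).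

Definition wait g w : R := waiting_time i0 (fun i n => g i n w).

Definition next_mark c g : set Omega :=
  [set w | c (first_source i0 (fun i n => g i n w)) 0%N w].

Definition shift_times g t : 'I_N -> nat -> Omega -> R :=
  fun i n w => shift_points (g i ^~ w) (t w) n.

Definition shift_marks g c t : 'I_N -> nat -> set Omega :=
  fun i n => [set w | c i (count_points (g i ^~ w) (t w) + n)%N w].

Definition extended_history F g c : set_system Omega :=
  F `|` [set A | (exists2 B, measurable B & A = wait g @^-1` B) \/ A = next_mark c g].

Section Step.
Variables (F : set_system Omega) (g : 'I_N -> nat -> Omega -> R)
  (c : 'I_N -> nat -> set Omega) (s : Omega -> R).
Hypotheses (Fm : F `<=` measurable)
  (pg : forall w, arrival_path (fun i n => g i n w))
  (mg : forall i n, measurable_fun setT (g i n)) (mc : forall i n, measurable (c i n))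
  (ms : measurable_for F s) (s_ge0 : forall w, 0 <= s w).

Let D w := wait g w + s w.
Let first w := first_source i0 (fun i n => g i n w).

Let ph k w : point_process (g k ^~ w). Proof. by have [+ _] := pg w; apply. Qed.

Let mms : measurable_fun setT s.
Proof. exact: measurable_for_measurable Fm ms. Qed.

Lemma othersm k : others F g c k `<=` measurable.
Proof.
move=> A [/Fm//|[j _ [n [[B mB ->]|->]//]]].
by exact: preimage_measurable.
Qed.

Lemma first_measurable i : measurable [set w | first w = i].
Proof.
rewrite (_ : [set w | _] =
    \bigcap_(j in [set j | j != i]) [set w | g i 0%N w < g j 0%N w]).
  apply: fin_bigcap_measurable; first exact: finite_finset.
  by move=> j _; exact: measurable_lt_fun.
apply/seteqP; split => w /=.
  by move=> <- j /= ji; exact: (first_source_lt i0 (fun i n => g i n w) j (pg w)).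
by move=> lt; apply: first_sourceE => j ji; exact: lt.
Qed.

Lemma wait_measurable : measurable_fun setT (wait g).
Proof.
move=> _ B mB; rewrite setTI (_ : _ @^-1` _ =
  \bigcup_(i in [set: 'I_N]) ([set w | first w = i] `&` g i 0%N @^-1` B)).
  apply: fin_bigcup_measurable => // i _; apply: measurableI.
    exact: first_measurable.
  by exact: preimage_measurable.
apply/seteqP; split => w /=; first by exists (first w).
by move=> [i _ [/= <-]].
Qed.

Lemma next_mark_measurable : measurable (next_mark c g).
Proof.
rewrite (_ : next_mark c g =
  \bigcup_(i in [set: 'I_N]) ([set w | first w = i] `&` c i 0%N)).
  apply: fin_bigcup_measurable => // i _; apply: measurableI => //.
  exact: first_measurable.
apply/seteqP; split => w /=; first by exists (first w).
by move=> [i _ [/= <-]].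
Qed.

Lemma extended_historym : extended_history F g c `<=` measurable.
Proof.
move=> A [/Fm//|[[B mB ->]|->]]; last exact: next_mark_measurable.
by apply: preimage_measurable => //; exact: wait_measurable.
Qed.

Lemma shift_times_measurable t i n : measurable_fun setT t ->
  measurable_fun setT (shift_times g t i n).
Proof.
move=> mt; apply: (@measurable_for_measurable _ _ _ measurable) => //.
by apply: shift_points_measurable_for => // [m|]; exact: measurable_forT.
Qed.

Lemma shift_marks_measurable t i n : measurable_fun setT t ->
  measurable (shift_marks g c t i n).
Proof.
move=> mt; apply: (@sigma_measurable _ _ measurable) => //.
apply: shift_mark_measurable_for => // [m|m|]; [exact: measurable_forT| |exact: measurable_forT].
exact: sub_sigma_algebra.
Qed.

Let previous k m w := if m is m'.+1 then g k m' w else 0.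

Let gap_previous k m w : gap (g k) m w = g k m w - previous k m w.
Proof. by case: m => //=; rewrite subr0. Qed.

(** [strong_markov] is applied to each source [k] at the end [D] of the cycle. The cell [C (i, m)]
    says that source [i] is served and that source [k] has [m] points up to [D]. There [D] is
    [g i 0 + s], known from the other sources if [i] differs from [k], and from the first [m] points
    of [k] if [i = k] and [m] is positive. *)
Lemma fresh_sources_step : fresh_sources F g c ->
  fresh_sources (extended_history F g c) (shift_times g D) (shift_marks g c D).
Proof.
move=> fresh k.
have mD : measurable_fun setT D by apply: measurable_funD => //; exact: wait_measurable.
pose C (im : 'I_N * nat) :=
  [set w | first w = im.1 /\ count_points (g k ^~ w) (D w) = im.2].
(* If source [k] is served, it has a point before [D], so this cell is empty. The general formula
   for [theta] would involve the point [g k 0], which is not yet past there; the value 0 keeps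
   [theta] measurable. *)
pose bad (im : 'I_N * nat) := (im.1 == k) && (im.2 == 0%N).
pose theta (im : 'I_N * nat) w : R := if bad im then 0 else
  g im.1 0%N w + s w - previous k im.2 w.
have badC im : bad im -> C im = set0.
  case: im => i m /andP[/= /eqP-> /eqP->]; apply/seteqP; split => // w [/= fw cw].
  have := count_points_gt _ (D w) (ph k w); rewrite cw ltNge /D /wait /waiting_time.
  by rewrite -/(first w) fw lerDl s_ge0.
pose G im := others F g c k `|` past_sets (g k) (c k) im.
have Fsub im : F `<=` <<s G im >>.
  by move=> A FA; apply: sub_sigma_algebra; left; left.
have mtime im j n : j != k -> measurable_for (G im) (g j n).
  move=> jk B mB; apply: sub_sigma_algebra; left; right; exists j => //.
  by exists n; left; exists B.
have mmark im j n : j != k -> <<s G im >> (c j n).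
  by move=> jk; apply: sub_sigma_algebra; left; right; exists j => //; exists n; right.
have mfirst im : ~~ bad im -> measurable_for (G im.2) (g im.1 0%N).
  rewrite /bad; case: im => i m /=; case: (eqVneq i k) => [->|ik _]; last exact: mtime.
  by rewrite /= -lt0n => m0; exact: past_measurable_for.
have mprev m : measurable_for (G m) (previous k m).
  by case: m => [|m]; [exact: measurable_for_cst|exact: past_measurable_for].
have msG im : measurable_for (G im) s by exact: measurable_for_sub ms.
have mtheta im : measurable_for (G im.2) (theta im).
  rewrite /theta; case: (bad im) (mfirst im) => [_|mf]; first exact: measurable_for_cst.
  by apply: measurable_forB => //; apply: measurable_forD => //; exact: mf.
apply: (@strong_markov _ _ _ P _ (others F g c k) _ _ (g k) _ (c k) _ C (fun im => im.2) theta)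
  => //.
- exact: othersm.
- move=> A [/extended_historym//|[j _ [n [[B mB ->]|->]]]].
    by apply: preimage_measurable => //; exact: shift_times_measurable.
  exact: shift_marks_measurable.
- by move=> n; exact: shift_times_measurable.
- by move=> n; exact: shift_marks_measurable.
- exact: ltW.
- by move=> [i m] [i' m'] _ _ [w [[/= <- <-] [/= <- <-]]].
- apply/seteqP; split => // w _.
  by exists (first w, count_points (g k ^~ w) (D w)).
- move=> im H GH; have [bim|nbim] := boolP (bad im).
    exists set0; split => //; first exact: sigma_algebra0.
    by rewrite badC// setI0 set0I.
  have CD w : C im w -> D w = g im.1 0%N w + s w.
    by move=> [fw _]; rewrite /D /wait /waiting_time -/(first w) fw.
  have [B GB HB] : exists2 B, <<s G im.2 >> B & H `&` C im = B `&` C im.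
    apply: (sigma_trace _ _ _ _ _ GH) => A [[FA|[[B mB ->]|->]]|[j jk [n [[B mB ->]|->]]]].
    + by exists A => //; exact: Fsub.
    + exists (g im.1 0%N @^-1` B); first exact: mfirst.
      by apply/seteqP; split => w [/= Bw Cw]; split => //=; have [fw _] := Cw; move: Bw;
        rewrite /wait /waiting_time -/(first w) fw.
    + exists (c im.1 0%N).
        move: nbim; rewrite /bad; case: im {CD} => i m /=.
        case: (eqVneq i k) => [->|ik _]; last exact: mmark.
        by rewrite /= -lt0n => m0; exact: past_mark.
      by apply/seteqP; split => w [/= Bw Cw]; split => //=; have [fw _] := Cw; move: Bw;
        rewrite /next_mark/= -/(first w) fw.
    + exists ((fun w => shift_points (g j ^~ w) (g im.1 0%N w + s w) n) @^-1` B).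
        apply: shift_points_measurable_for mB => //; first by move=> m; exact: mtime.
        by apply: measurable_forD => //; exact: mfirst.
      by apply/seteqP; split => w [/= Bw Cw]; split => //=; move: Bw;
        rewrite /shift_times CD.
    + exists [set w | c j (count_points (g j ^~ w) (g im.1 0%N w + s w) + n)%N w].
        apply: shift_mark_measurable_for => //; first by move=> m; exact: mtime.
          by move=> m; exact: mmark.
        by apply: measurable_forD => //; exact: mfirst.
      by apply/seteqP; split => w [/= Bw Cw]; split => //=; move: Bw;
        rewrite /shift_marks/= CD.
  (* The cell is split into what the past knows and [theta < gap], which says that point [m] of
     source [k] comes after [D]. [A1] says that source [im.1] is first, except for the comparison
     with source [k] when [m = 0]: this one follows from [theta < gap]. [A2] says that the preceding
     point of [k] is not after [D], whence [0 <= theta]. *)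
  pose A1 := \bigcap_(j in [set j | j != im.1 /\ (j != k \/ (0 < im.2)%N)])
    [set w | g im.1 0%N w < g j 0%N w].
  pose A2 := if im.2 is m.+1 then [set w | g k m w <= g im.1 0%N w + s w] else setT.
  have mfs := mfirst _ nbim.
  have GA1 : <<s G im.2 >> A1.
    apply: sigma_fin_bigcap => j [_ jk]; apply: measurable_for_lt => //.
    case: jk => [jk|m0]; first exact: mtime.
    by have [->|jk] := eqVneq j k; [exact: past_measurable_for|exact: mtime].
  have GA2 : <<s G im.2 >> A2.
    rewrite /A2; case: im {CD} nbim mfs {B GB HB A1 GA1 A2} => i [|m] nbim mfs; first exact: sigma_setT.
    apply: measurable_for_le; first exact: past_measurable_for.
    exact: measurable_forD.
  have A2_ge0 w : A2 w -> 0 <= theta im w.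
    rewrite /theta (negbTE nbim) subr_ge0 /A2 /previous; case: (im.2) => [_|m//].
    by rewrite addr_ge0//; have [] := ph im.1 w => /ltW.
  have CA : C im = A1 `&` A2 `&` [set w | theta im w < gap (g k) im.2 w].
    have thE w : (theta im w < gap (g k) im.2 w) = (g im.1 0%N w + s w < g k im.2 w).
      by rewrite /theta (negbTE nbim) gap_previous ltrD2r.
    apply/seteqP; split => w.
      move=> Cw; have [fw cw] := Cw; split; last first.
        by rewrite /= thE -CD// -cw; exact: (count_points_gt (g k ^~ w)).
      split.
        by move=> j [ji _]; rewrite /= -fw; apply: (first_source_lt i0 (fun i n => g i n w) j (pg w));
            rewrite -/(first w) fw.
      rewrite /A2; case E : (im.2) => [//|m] /=; rewrite -CD//.
      by apply: (count_points_le (g k ^~ w)); rewrite cw E.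
    move=> [[A1w A2w] /=]; rewrite thE => ltw.
    have fw : first w = im.1.
      apply: first_sourceE => j ji.
      have [jk|] := boolP ((j != k) || (0 < im.2)%N); first by apply: A1w; split => //; exact/orP.
      rewrite negb_or negbK -leqNgt leqn0 => /andP[/eqP jk /eqP m0].
      rewrite jk; move: ltw; rewrite m0; apply: le_lt_trans.
      by rewrite lerDl.
    have DE : D w = g im.1 0%N w + s w by rewrite /D /wait /waiting_time -/(first w) fw.
    split => //; apply: count_pointsE => //; last by rewrite DE.
    move=> l; rewrite DE; move: A2w; rewrite /A2; case: (im.2) => // m /= le lm.
    by apply: le_trans le; exact: (point_process_le (g k ^~ w)).
  exists (B `&` (A1 `&` A2)); split.
  + by apply: sigma_setI => //; exact: sigma_setI.
  + by move=> w [_ [_ A2w]]; exact: A2_ge0.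
  + by rewrite HB CA setIA.
- move=> im n w Cw; have [bim|nbim] := boolP (bad im).
    by have : set0 w by rewrite -(badC _ bim).
  have [fw cw] := Cw.
  rewrite /shift_times /shift_points cw /theta (negbTE nbim) gap_previous.
  rewrite /D /wait /waiting_time -/(first w) fw; ring.
- by move=> im n w [_ cw]; rewrite /shift_marks/= cw.
Qed.

End Step.

End Superposition.

(** * Analytic comparison for a race of exponential clocks *)

Section ExponentialLimits.
Context {R : realType}.
Implicit Types (x y a b : R).

Let cvg_expR_div a y : a * expR (y / n.+1%:R) @[n --> \oo] --> a.
Proof.
have : a * expR (y * n.+1%:R^-1) @[n --> \oo] --> a * expR (y * 0).
  apply: cvgMr; apply: (@cvg_comp _ _ _ (fun n => y * n.+1%:R^-1) expR _ (nbhs (y * 0))).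
    by apply: cvgMr; exact: cvg_harmonic.
  exact: continuous_expR.
by rewrite mulr0 expR0 mulr1.
Qed.

Lemma le_expR_div a b y : (forall n, b <= a * expR (y / n.+1%:R)) -> b <= a.
Proof.
move=> Hb; rewrite -(cvg_lim _ (cvg_expR_div a y))//.
apply: limr_ge; first by apply/cvg_ex; exists a; exact: cvg_expR_div.
by apply: nearW => n; exact: Hb.
Qed.

Lemma ge_expR_div a b y : (forall n, a * expR (- (y / n.+1%:R)) <= b) -> a <= b.
Proof.
move=> Hb; rewrite -(cvg_lim _ (cvg_expR_div a (- y)))//.
apply: limr_le; first by apply/cvg_ex; exists a; exact: cvg_expR_div.
by apply: nearW => n; rewrite mulNr; exact: Hb.
Qed.

Lemma le_add_expRN a b c x : 0 < c ->
  (forall y, 0 <= y -> b <= a + x * expR (- c * y)) -> b <= a.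
Proof.
move=> c0 Hb.
have cv : a + x * expR (- (c * n%:R)) @[n --> \oo] --> a + x * 0.
  apply: cvgD; first exact: cvg_cst.
  apply: cvgMr; apply: (@cvg_comp _ _ _ (fun n => c * n%:R) (fun r => expR (- r)) _ (pinfty_nbhs R)).
    apply: (@cvg_comp _ _ _ (fun n => n%:R) (fun r => c * r) _ (pinfty_nbhs R)).
      exact: cvgr_idn.
    exact: gt0_cvgMry.
  exact: cvgr_expR.
rewrite mulr0 addr0 in cv.
rewrite -(cvg_lim _ cv)//; apply: limr_ge; first by apply/cvg_ex; exists a.
by apply: nearW => n; rewrite -mulNr; exact: Hb.
Qed.

Lemma expR_diff_bounds x : 0 <= x -> x * expR (- x) <= 1 - expR (- x) <= x.
Proof.
move=> x0; have h1 := expR_ge1Dx (- x); have h2 := expR_ge1Dx x.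
apply/andP; split; last by lra.
have -> : 1 - expR (- x) = (expR x - 1) * expR (- x).
  by rewrite mulrBl -expRD subrr expR0 mul1r.
by rewrite ler_wpM2r ?expR_ge0//; lra.
Qed.

Lemma telescope_le (F psi : R -> R) x h a n :
  (forall k, F (x + h *+ k) - F (x + h *+ k.+1) <=
             a * (psi (x + h *+ k) - psi (x + h *+ k.+1))) ->
  F x - F (x + h *+ n) <= a * (psi x - psi (x + h *+ n)).
Proof.
move=> H; elim: n => [|n IH]; first by rewrite mulr0n addr0 !subrr mulr0.
have := H n; lra.
Qed.

(* [F] is compared with the claimed [psi] increment by increment: on steps of
   length [y/n] the ratio of the increments is within [expR (+- Lambda y/n)] of 1. *)
Lemma exponential_race (F : R -> R) (A lambda Lambda : R) :
  0 < lambda <= Lambda -> 0 <= A ->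
  (forall x, 0 <= x -> 0 <= F x <= A * expR (- lambda * x)) ->
  (forall x h, 0 <= x -> 0 <= h ->
     A * expR (- Lambda * x) * (1 - expR (- lambda * h)) * expR (- (Lambda - lambda) * h)
       <= F x - F (x + h) <= A * expR (- Lambda * x) * (1 - expR (- lambda * h))) ->
  forall x, 0 <= x -> F x = A * (lambda / Lambda) * expR (- Lambda * x).
Proof.
move=> /andP[l0 lL] A0 Fb Fd x x0; have L0 : 0 < Lambda by lra.
pose psi y := A * (lambda / Lambda) * expR (- Lambda * y).
have AL : 0 <= A * (lambda / Lambda) by rewrite mulr_ge0// divr_ge0// ltW.
have psi0 y : 0 <= psi y by rewrite mulr_ge0// expR_ge0.
have psiD y h : psi y - psi (y + h) = A * (lambda / Lambda) * expR (- Lambda * y) * (1 - expR (- (Lambda * h))).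
  by rewrite /psi mulrDr expRD !mulNr; ring.
have up y h : 0 <= y -> 0 <= h -> F y - F (y + h) <= expR (Lambda * h) * (psi y - psi (y + h)).
  move=> y0 h0; have /andP[_ Fup] := Fd y h y0 h0; apply: (le_trans Fup).
  have lh0 : 0 <= lambda * h by rewrite mulr_ge0// ltW.
  have Lh0 : 0 <= Lambda * h by rewrite mulr_ge0// ltW.
  have /andP[_ b1] := expR_diff_bounds _ lh0; have /andP[b2 _] := expR_diff_bounds _ Lh0.
  have key : 1 - expR (- (lambda * h)) <=
      expR (Lambda * h) * (lambda / Lambda) * (1 - expR (- (Lambda * h))).
    apply: (le_trans b1).
    have -> : lambda * h = expR (Lambda * h) * (lambda / Lambda) * (Lambda * h * expR (- (Lambda * h))).
      transitivity (lambda * h * (expR (Lambda * h) * expR (- (Lambda * h)))).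
        by rewrite -expRD subrr expR0 mulr1.
      by field; rewrite gt_eqF.
    by apply: ler_wpM2l => //; rewrite mulr_ge0 ?expR_ge0// divr_ge0// ltW.
  rewrite psiD (mulNr lambda h).
  have -> : expR (Lambda * h) * (A * (lambda / Lambda) * expR (- Lambda * y) * (1 - expR (- (Lambda * h)))) =
    A * expR (- Lambda * y) * (expR (Lambda * h) * (lambda / Lambda) * (1 - expR (- (Lambda * h)))) by ring.
  by apply: ler_wpM2l => //; rewrite mulr_ge0// expR_ge0.
have dn y h : 0 <= y -> 0 <= h -> expR (- (Lambda * h)) * (psi y - psi (y + h)) <= F y - F (y + h).
  move=> y0 h0; have /andP[Fdn _] := Fd y h y0 h0; apply: le_trans Fdn.
  have lh0 : 0 <= lambda * h by rewrite mulr_ge0// ltW.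
  have Lh0 : 0 <= Lambda * h by rewrite mulr_ge0// ltW.
  have /andP[b1 _] := expR_diff_bounds _ lh0; have /andP[_ b2] := expR_diff_bounds _ Lh0.
  have key : expR (- (Lambda * h)) * (lambda / Lambda) * (1 - expR (- (Lambda * h))) <=
      (1 - expR (- (lambda * h))) * expR (- (Lambda - lambda) * h).
    have HE : expR (- (Lambda * h)) = expR (- (lambda * h)) * expR (- (Lambda - lambda) * h).
      by rewrite -expRD; congr expR; ring.
    have -> : expR (- (Lambda * h)) * (lambda / Lambda) * (1 - expR (- (Lambda * h))) =
        lambda / Lambda * (1 - expR (- (Lambda * h))) * expR (- (lambda * h)) * expR (- (Lambda - lambda) * h).
      rewrite {1}HE; ring.
    apply: ler_wpM2r; first exact: expR_ge0.
    apply: le_trans b1; apply: ler_wpM2r; first exact: expR_ge0.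
    have -> : lambda * h = (lambda / Lambda) * (Lambda * h) by field; rewrite gt_eqF.
    by apply: ler_wpM2l; first by rewrite divr_ge0// ltW.
  rewrite psiD (mulNr lambda h).
  have -> : expR (- (Lambda * h)) * (A * (lambda / Lambda) * expR (- Lambda * y) * (1 - expR (- (Lambda * h)))) =
    A * expR (- Lambda * y) * (expR (- (Lambda * h)) * (lambda / Lambda) * (1 - expR (- (Lambda * h)))) by ring.
  by rewrite -[leRHS]mulrA; apply: ler_wpM2l => //; rewrite mulr_ge0// expR_ge0.
have step_ge0 y n k : 0 <= y -> 0 <= x + (y / n.+1%:R) *+ k.
  by move=> y0; rewrite addr_ge0// mulrn_wge0// divr_ge0.
have last y n : x + (y / n.+1%:R) *+ n.+1 = x + y.
  by rewrite -[_ *+ n.+1]mulr_natr divfK// pnatr_eq0.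
have shift y n k : x + (y / n.+1%:R) *+ k.+1 = x + (y / n.+1%:R) *+ k + y / n.+1%:R.
  by rewrite mulrSr addrA.
(* For fixed [y], the increments are summed over [n+1] steps from [x] to [x + y]. Letting [n] grow
   removes the factor [expR (+- Lambda * y / (n+1))]; letting [y] grow then removes the terms at
   [x + y], which decay exponentially. *)
apply/eqP; rewrite eq_le; apply/andP; split.
- apply: (@le_add_expRN _ _ lambda (A * expR (- lambda * x)) l0) => y y0.
  have -> : A * expR (- lambda * x) * expR (- lambda * y) = A * expR (- lambda * (x + y)).
    by rewrite mulrDr expRD mulrA.
  rewrite -/(psi x); apply: (@le_trans _ _ (psi x + F (x + y))); last first.
    by rewrite lerD2l; have /andP[] := Fb (x + y) (addr_ge0 x0 y0).
  rewrite -lerBlDr; apply: (@le_expR_div _ _ (Lambda * y)) => // n.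
  have := @telescope_le F psi x (y / n.+1%:R) (expR (Lambda * (y / n.+1%:R))) n.+1.
  rewrite last => /(_ _)/le_trans; apply.
    by move=> k; rewrite shift; apply: up; [exact: step_ge0|rewrite divr_ge0].
  rewrite mulrA mulrC; apply: ler_wpM2r; first exact: expR_ge0.
  by rewrite gerBl.
- apply: (@le_add_expRN _ _ Lambda (psi x) L0) => y y0.
  have -> : psi x * expR (- Lambda * y) = psi (x + y).
    by rewrite /psi (mulrDr (- Lambda)) expRD; ring.
  rewrite -/(psi x) -lerBlDr; apply: (@ge_expR_div _ _ (Lambda * y)) => n.
  have := @telescope_le (fun z => expR (- (Lambda * (y / n.+1%:R))) * psi z) F x (y / n.+1%:R) 1 n.+1.
  rewrite last mul1r -mulrBr => tl.
  apply: (@le_trans _ _ (F x - F (x + y))); last first.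
    by rewrite gerBl; have /andP[] := Fb (x + y) (addr_ge0 x0 y0).
  rewrite mulrC -mulrA; apply: tl => k.
  by rewrite shift mul1r -mulrBr; apply: dn; [exact: step_ge0|rewrite divr_ge0].
Qed.

End ExponentialLimits.

Section FiniteProbability.
Context {d} {Omega : measurableType d} {R : realType} (P : probability Omega R).
Implicit Types (A B : set Omega).

Definition pr A : R := fine (P A).

Lemma prE A : measurable A -> P A = (pr A)%:E.
Proof. by move=> mA; rewrite fineK//; exact: prob_fin_num. Qed.

Lemma pr_ge0 A : 0 <= pr A.
Proof. by rewrite fine_ge0. Qed.

Lemma le_pr A B : measurable A -> measurable B -> A `<=` B -> pr A <= pr B.
Proof.
by move=> mA mB AB; rewrite -lee_fin -!prE//; apply: le_measure; rewrite ?inE.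
Qed.

Lemma pr_setD A B : measurable A -> measurable B -> B `<=` A ->
  pr (A `\` B) = pr A - pr B.
Proof.
move=> mA mB BA; apply: EFin_inj; rewrite EFinB -!prE//; last exact: measurableD.
by rewrite prob_setD// setIidr.
Qed.

Lemma pr_fin_partition (I : finType) (C : I -> set Omega) A :
  trivIset setT C -> \bigcup_i C i = setT -> (forall i, measurable (C i)) ->
  measurable A -> P A = (\sum_i P (A `&` C i))%E.
Proof.
move=> tC CT mC mA; rewrite -[in LHS](setIT A) -CT setI_bigcupr.
rewrite measure_fin_bigcup//; last 3 first.
- exact: finite_finset.
- exact: trivIset_setIl.
- by move=> i _; exact: measurableI.
rewrite (_ : setT = [set` index_enum I]); last first.
  by apply/seteqP; split => i //= _; exact: mem_index_enum.
by rewrite -fsbig_seq ?index_enum_uniq.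
Qed.

End FiniteProbability.

Section NextArrival.
Context {d} {Omega : measurableType d} {R : realType} (P : probability Omega R).
Context {N : nat} (i0 : 'I_N).
Variables (lambda p : 'I_N -> R).
Hypotheses (lambda_gt0 : forall i, 0 < lambda i) (p_ge0 : forall i, 0 <= p i).
Variables (F : set_system Omega) (g : 'I_N -> nat -> Omega -> R)
  (c : 'I_N -> nat -> set Omega).
Hypotheses (Fm : F `<=` measurable)
  (pg : forall w, arrival_path (fun i n => g i n w))
  (mg : forall i n, measurable_fun setT (g i n)) (mc : forall i n, measurable (c i n))
  (fresh : fresh_sources P lambda p F g c).

Let first w := first_source i0 (fun i n => g i n w).

Let mothers k := othersm F g c Fm mg mc k.

Let mfirst i : measurable [set w | first w = i].
Proof. by apply: first_measurable. Qed.

Let mlt (x : R) k : measurable [set w | x < g k 0%N w].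
Proof. by apply: measurable_lt_fun => //; exact: measurable_cst. Qed.

Let sub_others k : F `<=` <<s others F g c k >>.
Proof. by move=> A FA; apply: sub_sigma_algebra; left. Qed.

Let others_lt x k j : j != k -> <<s others F g c k >> [set w | x < g j 0%N w].
Proof.
move=> jk; apply: measurable_for_lt; first exact: measurable_for_cst.
by move=> B mB; apply: sub_sigma_algebra; right; exists j => //; exists 0%N; left; exists B.
Qed.

Let head_tail k A x : 0 <= x -> <<s others F g c k >> A ->
  P (A `&` [set w | x < g k 0%N w]) = (P A * (expR (- lambda k * x))%:E)%E.
Proof.
move=> x0 GA; have [/(_ A x x0)] := fresh k 0%N.
by rewrite past_sets0 setU0 setIT mul1r => ->.
Qed.

Let head_mark k A x : 0 <= x -> <<s others F g c k >> A ->
  P (A `&` [set w | x < g k 0%N w] `&` c k 0%N) =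
  (P A * (p k * expR (- lambda k * x))%:E)%E.
Proof.
move=> x0 GA; have [_ /(_ A x x0)] := fresh k 0%N.
by rewrite past_sets0 setU0 => ->.
Qed.

(** Sources are removed one by one: the head [k] is independent of [others k], which contains both
    [A] and the events of the remaining sources. *)
Let peel (r : seq 'I_N) A x : 0 <= x -> uniq r ->
  (forall k, k \in r -> <<s others F g c k >> A) -> measurable A ->
  P (A `&` \bigcap_(j in [set` r]) [set w | x < g j 0%N w]) =
  (P A * (expR (- (\sum_(j <- r) lambda j) * x))%:E)%E.
Proof.
move=> x0; elim: r => [|k r IH] /= => [_ _ mA|/andP[kr ur] GA mA].
  by rewrite set_nil bigcap_set0 setIT big_nil oppr0 mul0r expR0 mule1.
rewrite bigcap_seq_cons setICA setIC head_tail//; last first.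
  apply: sigma_setI; first by apply: GA; rewrite mem_head.
  apply: sigma_seq_bigcap => j jr; apply: others_lt.
  by apply: contraNneq kr => <-.
rewrite IH//; last by move=> j jr; apply: GA; rewrite in_cons jr orbT.
rewrite big_cons -muleA; congr (_ * _)%E; rewrite -EFinM -expRD; congr (expR _)%:E.
ring.
Qed.

Let Lambda := \sum_i lambda i.

Lemma wait_gtE x : [set w | x < wait i0 g w] =
  \bigcap_(j in [set` index_enum 'I_N]) [set w | x < g j 0%N w].
Proof.
apply/seteqP; split => w /=.
  by move=> lt j _; apply: (lt_le_trans lt); exact: (first_source_le i0 (fun i n => g i n w)).
by move=> lt; apply: lt; exact: mem_index_enum.
Qed.

Lemma wait_memoryless : memoryless P F Lambda (wait i0 g) setT 1.
Proof.
move=> A x x0 FA; rewrite setIT mul1r wait_gtE peel//.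
- exact: index_enum_uniq.
- by move=> k _; exact: (sigma_sub _ _ (sub_others k)).
- exact: (sigma_measurable _ Fm).
Qed.

Section Race.
Variables (i : 'I_N) (H : set Omega).
Hypothesis FH : <<s F >> H.

Let I := [seq j <- index_enum 'I_N | j != i].

Let LambdaI : \sum_(j <- I) lambda j = Lambda - lambda i.
Proof. by rewrite /Lambda (bigD1 i)//= /I big_filter addrC addrK. Qed.

Let mH : measurable H. Proof. exact: (sigma_measurable _ Fm). Qed.

Let U := H `&` [set w | first w = i] `&` c i 0%N.

Let mU x : measurable (U `&` [set w | x < g i 0%N w]).
Proof. by rewrite /U; do ?apply: measurableI => //. Qed.

Let W x h := (H `&` c i 0%N `&` [set w | x < g i 0%N w]) `\`
             (H `&` c i 0%N `&` [set w | x + h < g i 0%N w]).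

Let mHc x : measurable (H `&` c i 0%N `&` [set w | x < g i 0%N w]).
Proof. by do ?apply: measurableI => //. Qed.

Let prHc x : 0 <= x -> pr P (H `&` c i 0%N `&` [set w | x < g i 0%N w]) =
  pr P H * (p i * expR (- lambda i * x)).
Proof.
move=> x0; apply: EFin_inj; rewrite EFinM -!prE// setIAC head_mark//.
exact: (sigma_sub _ _ (sub_others i)).
Qed.

Let mcap x : measurable (\bigcap_(j in [set` I]) [set w | x < g j 0%N w]).
Proof.
by apply: fin_bigcap_measurable.
Qed.

Let prW x h y : 0 <= x -> 0 <= h -> 0 <= y ->
  pr P (W x h `&` \bigcap_(j in [set` I]) [set w | y < g j 0%N w]) =
  pr P H * p i * expR (- lambda i * x) * (1 - expR (- lambda i * h)) *
    expR (- (Lambda - lambda i) * y).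
Proof.
move=> x0 h0 y0.
have mW : measurable (W x h) by apply: measurableD; exact: mHc.
have -> : pr P H * p i * expR (- lambda i * x) * (1 - expR (- lambda i * h)) = pr P (W x h).
  rewrite pr_setD//; last first.
    by move=> w [Hcw /= lt]; split => //=; apply: le_lt_trans lt; rewrite lerDl.
  rewrite !prHc ?addr_ge0// (mulrDr (- lambda i)) expRD; ring.
apply: EFin_inj; rewrite EFinM -!prE//; last exact: measurableI.
rewrite peel// ?LambdaI// ?filter_uniq ?index_enum_uniq// => k.
rewrite mem_filter => /andP[ki _].
have GH : <<s others F g c k >> H by exact: (sigma_sub _ _ (sub_others k)).
have Gc : <<s others F g c k >> (c i 0%N).
  by apply: sub_sigma_algebra; right; exists i; [rewrite eq_sym|exists 0%N; right].
apply: (@measurableD _ (g_sigma_algebraType (others F g c k))).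
  by apply: sigma_setI; [exact: sigma_setI|apply: others_lt; rewrite eq_sym].
by apply: sigma_setI; [exact: sigma_setI|apply: others_lt; rewrite eq_sym].
Qed.

(** Consider the event that source [i] is first, with its point in []x, x + h]]. It contains the
    event that the others stay silent up to [x + h], and is contained in the one where they stay
    silent up to [x]. Both have product probabilities, and these bounds are the hypothesis of
    [exponential_race]; no joint density is needed. *)
Lemma next_mark_first x : 0 <= x ->
  pr P (U `&` [set w | x < g i 0%N w]) =
  pr P H * p i * (lambda i / Lambda) * expR (- Lambda * x).
Proof.
have lL : lambda i <= Lambda.
  by rewrite /Lambda (bigD1 i)//= lerDl sumr_ge0// => j _; exact: ltW.
move: x; apply: exponential_race; first by rewrite lambda_gt0.
- by rewrite mulr_ge0// pr_ge0.
- move=> x x0; rewrite pr_ge0/= -mulrA -prHc//; apply: le_pr; [exact: mU|exact: mHc|].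
  by move=> w [[[Hw _] cw] lt].
- move=> x h x0 h0.
  have -> : pr P (U `&` [set w | x < g i 0%N w]) - pr P (U `&` [set w | x + h < g i 0%N w]) =
    pr P ((U `&` [set w | x < g i 0%N w]) `\` (U `&` [set w | x + h < g i 0%N w])).
    rewrite pr_setD//; move=> w [Uw /= lt]; split => //=.
    by apply: le_lt_trans lt; rewrite lerDl.
  have mW : measurable (W x h) by apply: measurableD; exact: mHc.
  apply/andP; split.
    have -> : pr P H * p i * expR (- Lambda * x) * (1 - expR (- lambda i * h)) * expR (- (Lambda - lambda i) * h) =
       pr P H * p i * expR (- lambda i * x) * (1 - expR (- lambda i * h)) * expR (- (Lambda - lambda i) * (x + h)).
      have -> : - Lambda * x = - lambda i * x + - (Lambda - lambda i) * x by ring.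
      by rewrite (mulrDr (- (Lambda - lambda i))) !expRD; ring.
    rewrite -prW// ?addr_ge0//; apply: le_pr; first exact: measurableI.
      exact: measurableD.
    move=> w [[[[Hw cw] /= ltx] nlt] ltj].
    have leh : g i 0%N w <= x + h.
      by rewrite leNgt; apply/negP => lt; apply: nlt.
    have fw : first w = i.
      apply: first_sourceE => j ji; apply: (le_lt_trans leh); apply: ltj => /=.
      by rewrite mem_filter ji mem_index_enum.
    by split => // -[_ /=]; rewrite ltNge leh.
  have -> : pr P H * p i * expR (- Lambda * x) * (1 - expR (- lambda i * h)) =
     pr P H * p i * expR (- lambda i * x) * (1 - expR (- lambda i * h)) * expR (- (Lambda - lambda i) * x).
    have -> : - Lambda * x = - lambda i * x + - (Lambda - lambda i) * x by ring.
    by rewrite !expRD; ring.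
  rewrite -prW//; apply: le_pr; [exact: measurableD|exact: measurableI|].
  move=> w [[[[Hw fw] cw] /= ltx] nlt]; split.
    by split => // -[_ /= lt]; apply: nlt.
  move=> j; rewrite /= mem_filter => /andP[ji _]; apply: (lt_trans ltx).
  by rewrite -fw; apply: (first_source_lt i0 (fun i n => g i n w) j (pg w)); rewrite -/(first w) fw.
Qed.

End Race.

Lemma next_mark_memoryless : memoryless P F Lambda (wait i0 g) (next_mark i0 c g)
  (\sum_i p i * lambda i / Lambda).
Proof.
move=> H x x0 FH.
have mH : measurable H by exact: (sigma_measurable _ Fm).
have mw : measurable [set w | x < wait i0 g w].
  apply: measurable_tail.
  by apply: wait_measurable.
have mn : measurable (next_mark i0 c g).
  by apply: next_mark_measurable.
rewrite (pr_fin_partition P _ (fun i => [set w | first w = i]))//; last 3 first.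
- by move=> i j _ _ [w [/= <- <-]].
- by apply/seteqP; split => // w _; exists (first w).
- by do ?apply: measurableI => //.
transitivity (\sum_i (pr P H * p i * (lambda i / Lambda) * expR (- Lambda * x))%:E)%E.
  apply: eq_bigr => i _; rewrite -next_mark_first// -prE; last first.
    by do ?apply: measurableI => //.
  congr (P _); apply/seteqP; split => w /=.
    by move=> [[[Hw lt] cw] fw]; move: lt cw; rewrite /wait/waiting_time /next_mark/= -/(first w) fw.
  move=> [[[Hw fw] cw] lt]; split => //; split; first split => //=.
    by rewrite /wait /waiting_time -/(first w) fw.
  by rewrite /next_mark/= -/(first w) fw.
rewrite sumEFin prE// -EFinM; congr EFin; rewrite mulrA mulr_sumr mulr_suml.
by apply: eq_bigr => i _; rewrite !mulrA.
Qed.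

End NextArrival.

(** * Successive service cycles *)

Section NextGeneration.
Context {R : realType} {N : nat} (i0 : 'I_N).
Implicit Types (g : 'I_N -> nat -> R).

(** The infimum is a minimum: every source has a first point after [t], and there are finitely many
    sources. *)
Lemma next_generationE g t : arrival_path g ->
  next_generation g t = t + waiting_time i0 (fun i => shift_points (g i) t).
Proof.
move=> ag; have [pg inj] := ag.
set gs := fun i => shift_points (g i) t.
set u := t + _.
have Hu : u = g (first_source i0 gs) (count_points (g (first_source i0 gs)) t).
  by rewrite /u /waiting_time /gs /shift_points addn0 addrC subrK.
have Su : [set v | t < v /\ exists i n, v = g i n] u.
  split; last by do 2 eexists; exact: Hu.
  by rewrite Hu; exact: count_points_gt.
have lb : lbound [set v | t < v /\ exists i n, v = g i n] u.
  move=> v [tv [i [n vE]]]; rewrite vE in tv *.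
  rewrite /u -lerBrDl; apply: (le_trans (first_source_le i0 gs i)).
  rewrite /gs /shift_points addn0 lerD2r; apply: point_process_le => //.
  by rewrite leqNgt; apply/negP => /count_points_le; rewrite leNgt tv.
rewrite /next_generation; apply/eqP; rewrite eq_le; apply/andP; split.
  by apply: ge_inf => //; exists u.
by apply: lb_le_inf => //; exists u.
Qed.

End NextGeneration.

Section Departures.
Context {d} {Omega : measurableType d} {R : realType} (P : probability Omega R).
Context {N : nat} (i0 : 'I_N).
Variables (lambda p : 'I_N -> R).
Hypotheses (lambda_gt0 : forall i, 0 < lambda i) (p_ge0 : forall i, 0 <= p i).
Variables (g : 'I_N -> nat -> Omega -> R) (c : 'I_N -> nat -> set Omega)
  (s : nat -> Omega -> R).
Hypotheses (pg : forall w, arrival_path (fun i n => g i n w))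
  (mg : forall i n, measurable_fun setT (g i n)) (mc : forall i n, measurable (c i n))
  (ms : forall k, measurable_fun setT (s k)) (s_ge0 : forall k w, 0 <= s k w).

Definition services : set_system Omega :=
  [set A | exists k, exists2 B, measurable B & A = s k @^-1` B].

(** The starting time of cycle [k]. The value 0 for [k = 0] reflects that the server is idle at time
    0, so that the first cycle also begins with an idle period. *)
Definition last_departure k w : R :=
  if k is k'.+1 then departure (fun i n => g i n w) (fun k => s k w) k' else 0.

Definition cycle_times k := shift_times g (last_departure k).
Definition cycle_marks k := shift_marks g c (last_departure k).
Definition idle k : Omega -> R := wait i0 (cycle_times k).
Definition mark k : set Omega := next_mark i0 (cycle_marks k) (cycle_times k).

(** All service times, future ones included, are known from the beginning. The end of cycle [k] is
    then determined by [history k], the idle period and nothing else, and the sources stay fresh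
    because they are independent of [services] altogether. *)
Fixpoint history k : set_system Omega :=
  if k is k'.+1 then extended_history i0 (history k') (cycle_times k') (cycle_marks k')
  else services.

Lemma last_departureS k w :
  last_departure k.+1 w = last_departure k w + (idle k w + s k w).
Proof.
rewrite /= addrA; case: k => [|k] /=; rewrite (next_generationE i0)//.
Qed.

Lemma cycle_path k w : arrival_path (fun i n => cycle_times k i n w).
Proof. exact: (shift_arrival_path (fun i n => g i n w)). Qed.

Lemma idle_gt0 k w : 0 < idle k w.
Proof. by apply: waiting_time_gt0; exact: cycle_path. Qed.

Lemma cycle_timesS k :
  shift_times (cycle_times k) (fun w => idle k w + s k w) = cycle_times k.+1.
Proof.
apply/funext => i; apply/funext => n; apply/funext => w.
rewrite /cycle_times /shift_times last_departureS -(shift_shift (g i ^~ w))//.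
  by have [+ _] := pg w; apply.
by rewrite addr_ge0// ltW// idle_gt0.
Qed.

Lemma cycle_marksS k :
  shift_marks (cycle_times k) (cycle_marks k) (fun w => idle k w + s k w) = cycle_marks k.+1.
Proof.
apply/funext => i; apply/funext => n; apply/seteqP.
suff E w : (shift_marks (cycle_times k) (cycle_marks k) (fun w => idle k w + s k w) i n) w =
   cycle_marks k.+1 i n w by split => w; rewrite E.
rewrite /cycle_marks /shift_marks /= -/(last_departure k.+1 w) last_departureS.
rewrite (count_points_shift (g i ^~ w)) ?addnA//; first by have [+ _] := pg w; apply.
by rewrite addr_ge0// ltW// idle_gt0.
Qed.

Lemma cycle_times0 : cycle_times 0 = g.
Proof.
apply/funext => i; apply/funext => n; apply/funext => w.
rewrite /cycle_times /shift_times /= shift_points0//.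
by have [+ _] := pg w; apply.
Qed.

Lemma cycle_marks0 : cycle_marks 0 = c.
Proof.
apply/funext => i; apply/funext => n; apply/seteqP.
suff E w : (cycle_marks 0 i n) w = c i n w by split => w; rewrite E.
rewrite /cycle_marks /shift_marks /= (@count_pointsE _ _ _ 0%N)//.
  by have [+ _] := pg w; apply.
by have [/(_ i)[]] := pg w.
Qed.

Lemma servicesm : services `<=` measurable.
Proof. by move=> A [k [B mB ->]]; exact: preimage_measurable. Qed.

Lemma services_history k : services `<=` <<s history k >>.
Proof.
elim: k => [|k IH] A sA /=; first exact: sub_sigma_algebra.
by apply: (sigma_sub _ _ _ _ (IH _ sA)) => B HB; apply: sub_sigma_algebra; left.
Qed.

Lemma service_history j k : measurable_for (history j) (s k).
Proof. by move=> B mB; apply: services_history; exists k, B. Qed.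

Lemma cycle_regular k :
  [/\ history k `<=` measurable,
      forall i n, measurable_fun setT (cycle_times k i n) &
      forall i n, measurable (cycle_marks k i n)].
Proof.
elim: k => [|k [IH1 IH2 IH3]].
  by rewrite cycle_times0 cycle_marks0; split => //; exact: servicesm.
have mw : measurable_fun setT (idle k).
  by apply: wait_measurable => // w; exact: cycle_path.
have mD : measurable_fun setT (fun w => idle k w + s k w) by exact: measurable_funD.
split.
- by apply: extended_historym => // w; exact: cycle_path.
- move=> i n; rewrite -cycle_timesS; apply: shift_times_measurable => // w.
  exact: cycle_path.
- move=> i n; rewrite -cycle_marksS; apply: shift_marks_measurable => // w.
  exact: cycle_path.
Qed.

Lemma idle_measurable k : measurable_fun setT (idle k).
Proof.
have [_ H _] := cycle_regular k.
by apply: wait_measurable => // w; exact: cycle_path.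
Qed.

Lemma mark_measurable k : measurable (mark k).
Proof.
have [_ H1 H2] := cycle_regular k.
by apply: next_mark_measurable => // w; exact: cycle_path.
Qed.

Hypothesis fresh0 : fresh_sources P lambda p services g c.

Lemma cycle_fresh k :
  fresh_sources P lambda p (history k) (cycle_times k) (cycle_marks k).
Proof.
elim: k => [|k IH]; first by rewrite cycle_times0 cycle_marks0.
have [Hm mt mm] := cycle_regular k.
rewrite -cycle_timesS -cycle_marksS; apply: fresh_sources_step => //.
- by move=> w; exact: cycle_path.
- exact: service_history.
Qed.

Lemma idle_memoryless k :
  memoryless P (history k) (\sum_i lambda i) (idle k) setT 1.
Proof.
have [Hm mt mm] := cycle_regular k.
by apply: wait_memoryless (cycle_fresh k) => // w; exact: cycle_path.
Qed.

Lemma mark_memoryless k :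
  memoryless P (history k) (\sum_i lambda i) (idle k) (mark k)
    (\sum_i p i * lambda i / \sum_i lambda i).
Proof.
have [Hm mt mm] := cycle_regular k.
by apply: next_mark_memoryless (cycle_fresh k) => // w; exact: cycle_path.
Qed.

End Departures.

(** * From tail formulas to independence of the cycles *)

Section Independence.
Context {d} {Omega : measurableType d} {R : realType} (P : probability Omega R).
Implicit Types (A B C D : set Omega) (G : set_system Omega) (X : Omega -> R).

Definition tails X : set_system Omega := [set A | exists x, A = [set w | x < X w]].

Definition preimages X : set_system Omega :=
  [set A | exists2 B, measurable B & A = X @^-1` B].

Lemma measurable_for_tails X : measurable_for (tails X) X.
Proof.
apply/measurable_forP; apply: (measurability _ (RGenOInfty.measurableE R)).
move=> _ [_ [x ->] <-]; rewrite setTI; apply: sub_sigma_algebra; exists x.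
by rewrite tail_preimage.
Qed.

Lemma setI_closed_tails X : setI_closed (tails X).
Proof.
move=> _ _ [x ->] [y ->]; exists (Num.max x y).
by apply/seteqP; split => w /=; rewrite gt_max; [case=> -> ->|move/andP].
Qed.

Lemma tailsm X : measurable_fun setT X -> tails X `<=` measurable.
Proof.
by move=> mX _ [x ->]; apply: measurable_lt_fun => //; exact: measurable_cst.
Qed.

Lemma preimagesm X : measurable_fun setT X -> preimages X `<=` measurable.
Proof. by move=> mX _ [B mB ->]; exact: preimage_measurable. Qed.

Lemma setI_closed_preimages X : setI_closed (preimages X).
Proof. by move=> _ _ [A mA ->] [B mB ->]; exists (A `&` B) => //; exact: measurableI. Qed.

(** The tails of [X] are stable under intersection and generate its sigma-algebra. The hypothesis
    covers nonnegative thresholds; below 0 the tail is the whole space because [X] is positive. *)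
Lemma memoryless_indep G lambda X K kappa H (B : set R) : G `<=` measurable ->
  measurable_fun setT X -> (forall w, 0 < X w) -> measurable K ->
  memoryless P G lambda X setT 1 -> memoryless P G lambda X K kappa ->
  <<s G >> H -> measurable B ->
  P (H `&` X @^-1` B `&` K) = (P H * kappa%:E * P (X @^-1` B))%E.
Proof.
move=> Gm mX X0 mK ml1 ml GH mB.
have mH : measurable H by exact: (sigma_measurable _ Gm).
have HX0 A : A `&` [set w | 0 < X w] = A.
  by apply/seteqP; split => w; [case|move=> Aw; split => //; exact: X0].
have PHK : P (H `&` K) = (pr P H * kappa)%:E.
  have := ml H 0 (lexx 0) GH; rewrite HX0 => ->.
  by rewrite mulr0 expR0 mulr1 prE.
rewrite setIAC setIC (prE P H)// -EFinM [RHS]muleC.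
apply: (indep_sigma P (tails X) _ _ (tailsm _ mX) (setI_closed_tails X)) => //.
- exact: measurableI.
- move=> _ [x ->]; rewrite setIC setIAC; have [x0|x0] := leP 0 x.
    rewrite ml// prE// -EFinM.
    have := ml1 setT x x0 (sigma_setT _); rewrite setTI setIT probability_setT mul1e mul1r => ->.
    by rewrite -EFinM; congr EFin; ring.
  have -> : [set w | x < X w] = setT.
    by apply/seteqP; split => w //= _; exact: lt_trans (X0 w).
  by rewrite setIT PHK probability_setT mul1e.
- exact: measurable_for_tails.
Qed.

Lemma indep_join G (G' : set_system Omega) D (r : R) :
  G `<=` measurable -> G' `<=` measurable -> setI_closed G' -> G' setT ->
  measurable D -> P D = r%:E ->
  (forall A B, <<s G >> A -> G' B -> P (A `&` B `&` D) = (P (A `&` B) * r%:E)%E) ->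
  forall C, <<s G `|` G' >> C -> P (C `&` D) = (P C * r%:E)%E.
Proof.
move=> Gm G'm G'I G'T mD PD GG' C GC.
pose S : set_system Omega := [set C | exists A B, [/\ <<s G >> A, G' B & C = A `&` B]].
apply: (indep_sigma P S) => //.
- move=> _ [A [B [GA G'B ->]]]; apply: measurableI; last exact: G'm.
  exact: (sigma_measurable _ Gm).
- move=> _ _ [A [B [GA G'B ->]]] [A' [B' [GA' G'B' ->]]]; exists (A `&` A'), (B `&` B').
  by split; [exact: sigma_setI|exact: G'I|rewrite setIACA].
- by move=> _ [A [B [GA G'B ->]]]; exact: GG'.
- apply: sigma_sub GC => A [GA|G'A]; apply: sub_sigma_algebra.
    by exists A, setT; split => //; [exact: sub_sigma_algebra|rewrite setIT].
  by exists setT, A; split => //; [exact: sigma_setT|rewrite setTI].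
Qed.

End Independence.

Section CycleIndependence.
Context {d} {Omega : measurableType d} {R : realType} (P : probability Omega R).
Context {N : nat} (i0 : 'I_N).
Variables (lambda p : 'I_N -> R).
Hypotheses (lambda_gt0 : forall i, 0 < lambda i) (p_ge0 : forall i, 0 <= p i).
Variables (g : 'I_N -> nat -> Omega -> R) (c : 'I_N -> nat -> set Omega)
  (s : nat -> Omega -> R).
Hypotheses (pg : forall w, arrival_path (fun i n => g i n w))
  (mg : forall i n, measurable_fun setT (g i n)) (mc : forall i n, measurable (c i n))
  (ms : forall k, measurable_fun setT (s k)) (s_ge0 : forall k w, 0 <= s k w).
Hypothesis fresh0 : fresh_sources P lambda p (services s) g c.

Definition past_services k : set_system Omega :=
  [set A | exists2 l, (l < k)%N & preimages (s l) A].

Hypothesis services_indep : forall k A (B : set R), <<s past_services k >> A ->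
  measurable B -> P (A `&` s k @^-1` B) = (P A * P (s k @^-1` B))%E.

Local Notation idle := (idle i0 g s).
Local Notation mark := (mark i0 g c s).
Local Notation history := (history i0 g c s).
Local Notation kappa := (\sum_i p i * lambda i / \sum_i lambda i).

Let historym k : history k `<=` measurable.
Proof. by have [] := cycle_regular i0 g c s pg mg mc ms s_ge0 k. Qed.

Let midle k : measurable_fun setT (idle k). Proof. by apply: idle_measurable => //; exact: mc. Qed.
Let mmark k : measurable (mark k). Proof. by apply: mark_measurable. Qed.
Let idle0 k w : 0 < idle k w. Proof. by apply: idle_gt0. Qed.

Let idle_mark k H (B : set R) : <<s history k >> H -> measurable B ->
  P (H `&` idle k @^-1` B `&` mark k) = (P H * kappa%:E * P (idle k @^-1` B))%E.
Proof.
move=> GH mB; apply: (memoryless_indep P _ _ _ _ _ _ _ (historym k)) => //.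
- exact: idle_memoryless.
- exact: mark_memoryless.
Qed.

Lemma idle_indep k H (B : set R) : <<s history k >> H -> measurable B ->
  P (H `&` idle k @^-1` B) = (P H * P (idle k @^-1` B))%E.
Proof.
move=> GH mB; have ml := idle_memoryless P i0 lambda p lambda_gt0 p_ge0 g c s pg mg mc ms s_ge0 fresh0 k.
have := memoryless_indep P _ _ _ setT 1 H B (historym k) (midle k) (idle0 k) measurableT ml ml GH mB.
by rewrite setIT mule1.
Qed.

Lemma mark_prob k : P (mark k) = kappa%:E.
Proof.
have := idle_mark k setT setT (sigma_setT _) measurableT.
by rewrite preimage_setT !setTI probability_setT mul1e mule1.
Qed.

Lemma mark_indep k A : <<s history k `|` preimages (idle k) >> A ->
  P (A `&` mark k) = (P A * kappa%:E)%E.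
Proof.
apply: indep_join => //.
- exact: preimagesm.
- exact: setI_closed_preimages.
- by exists setT; rewrite ?preimage_setT.
- exact: mark_prob.
- move=> H _ GH [B mB ->]; rewrite idle_mark// idle_indep//.
  by rewrite -!muleA; congr (_ * _)%E; rewrite muleC.
Qed.

Definition past_cycles k : set_system Omega :=
  [set A | exists2 l, (l < k)%N & preimages (idle l) A \/ A = mark l].

Lemma past_cycles_history k : past_cycles k `<=` <<s history k >>.
Proof.
elim: k => [|k IH] A; first by case.
move=> [l]; rewrite ltnS leq_eqVlt => /predU1P[->|lk] HA.
  by apply: sub_sigma_algebra; right.
have : <<s history k >> A by apply: IH; exists l.
by apply: sigma_sub => B HB; apply: sub_sigma_algebra; left.
Qed.

Lemma past_cyclesm k : past_cycles k `<=` measurable.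
Proof. by move=> A /past_cycles_history; exact: (sigma_measurable _ (historym k)). Qed.

(** Induction on [k]: the idle period and mark of cycle [k] are independent of [history k], which
    contains both the earlier cycles and all services. Hence they factor out in the same way with
    and without [S]. *)
Lemma past_cycles_services k A S : <<s past_cycles k >> A -> <<s services s >> S ->
  P (A `&` S) = (P A * P S)%E.
Proof.
move=> GA GS; have mS : measurable S.
  by apply: (sigma_measurable _ _ _ GS); exact: servicesm.
rewrite (prE P S)//; elim: k A GA => [|k IH] A GA.
  apply: (indep_sigma P (past_cycles 0)) => //.
  - exact: past_cyclesm.
  - by move=> ? ? [].
  - exact: prE.
  - by move=> ? [].
pose G' : set_system Omega := [set A | exists B K, [/\ measurable B, K = setT \/ K = mark k &
  A = idle k @^-1` B `&` K]].
have mipre B : measurable B -> measurable (idle k @^-1` B).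
  by move=> mB; exact: preimage_measurable.
apply: (indep_join P (past_cycles k) G') => //.
- exact: past_cyclesm.
- by move=> _ [B [K [mB [->|->] ->]]]; apply: measurableI => //; exact: mipre.
- move=> _ _ [B [K [mB HK ->]]] [B' [K' [mB' HK' ->]]].
  exists (B `&` B'), (K `&` K'); split; [exact: measurableI| |by rewrite setIACA].
  by case: HK => ->; case: HK' => ->; rewrite ?setIT ?setTI ?setIid; [left|right|right|right].
- by exists setT, setT; split => //; [left|rewrite preimage_setT setIT].
- exact: prE.
- move=> A' _ GA' [B [K [mB HK ->]]].
  have GAS : <<s history k >> (A' `&` S).
    apply: sigma_setI; first exact: (sigma_sub _ _ (@past_cycles_history k)).
    by apply: sigma_sub GS; exact: services_history.
  have GA'h : <<s history k >> A' by exact: (sigma_sub _ _ (@past_cycles_history k)).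
  have -> : A' `&` (idle k @^-1` B `&` K) `&` S = A' `&` S `&` idle k @^-1` B `&` K.
    by rewrite setIAC setIA.
  rewrite setIA; case: HK => ->.
    rewrite !setIT !idle_indep// IH//.
    by rewrite -!muleA; congr (_ * _)%E; rewrite muleC.
  rewrite !idle_mark// IH//; rewrite -!muleA; congr (_ * _)%E.
  by rewrite muleC -muleA.
- apply: sigma_sub GA => B [l]; rewrite ltnS leq_eqVlt => /predU1P[->|lk] HB.
    apply: sub_sigma_algebra; right; case: HB => [[B' mB' ->]|->].
      by exists B', setT; split => //; [left|rewrite setIT].
    by exists setT, (mark k); split => //; [right|rewrite preimage_setT setTI].
  by apply: sub_sigma_algebra; left; exists l.
Qed.

Lemma past_servicesm k : past_services k `<=` measurable.
Proof. by move=> A [l _]; exact: preimagesm. Qed.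

(** This is the filtration for service times, in place of [history]. The past cycles are independent
    of all services, so [past_cycles_services] is applied to [S] and to its intersection with the
    event of [s k], which reduces the claim to independence among services. *)
Lemma service_indep k A (B : set R) : <<s past_cycles k `|` past_services k >> A ->
  measurable B -> P (A `&` s k @^-1` B) = (P A * P (s k @^-1` B))%E.
Proof.
move=> GA mB.
have mD : measurable (s k @^-1` B) by exact: preimage_measurable.
have sub : past_services k `<=` services s by move=> D [l _ HD]; exists l.
rewrite (prE P (s k @^-1` B))//.
apply: (indep_join P (past_cycles k) <<s past_services k >>) => //.
- exact: past_cyclesm.
- exact: (sigma_measurable _ (@past_servicesm k)).
- by move=> ? ?; exact: sigma_setI.
- exact: sigma_setT.
- exact: prE.
- move=> A' S GA' GS; rewrite -prE// -setIA.
  have GS' : <<s services s >> S by exact: sub_sigma_algebra2 GS.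
  rewrite (past_cycles_services k A' S)// (past_cycles_services k A' (S `&` _))//.
    by rewrite services_indep// muleA.
  by apply: sigma_setI => //; apply: sub_sigma_algebra; exists k, B.
- apply: sigma_sub GA => D [HD|HD]; apply: sub_sigma_algebra; [by left|right].
  exact: sub_sigma_algebra.
Qed.

End CycleIndependence.

(** * Reduction to regular sample paths *)

Section MutualIndependence.
Context {d} {Omega : measurableType d} {R : realType} (P : probability Omega R).

Lemma fin_num_prode (I : Type) (s : seq I) (f : I -> \bar R) :
  (forall i, f i \is a fin_num) -> (\prod_(i <- s) f i)%E \is a fin_num.
Proof.
move=> ff; elim: s => [|a s IH]; first by rewrite big_nil.
by rewrite big_cons fin_numM.
Qed.

Section Grouping.
Context {Z : eqType}.
Variable F : Z -> set_system Omega.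
Hypotheses (Fm : forall z, F z `<=` measurable) (FI : forall z, setI_closed (F z))
  (FT : forall z, F z setT).
Hypothesis indF : mutually_independent P F.

(** Finite intersections of events taken from [D] form a pi-system generating the group. On it the
    claim is the independence of [F] over the concatenation of the two index lists. *)
Lemma independent_group (D : set Z) (r : seq Z) (A : Z -> set Omega) H :
  uniq r -> (forall z, z \in r -> ~ D z) -> (forall z, z \in r -> F z (A z)) ->
  <<s \bigcup_(z in D) F z >> H ->
  P (H `&` \bigcap_(z in [set` r]) A z) = (P H * \prod_(z <- r) P (A z))%E.
Proof.
move=> ur rD FA GH.
(* Outside [r] the events are unconstrained; replacing them by [setT] gives a family that lies in
   [F] at every index. *)
pose A' z := if z \in r then A z else setT.
have FA' z : F z (A' z) by rewrite /A'; case: ifP => [/FA|_].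
have -> : \bigcap_(z in [set` r]) A z = \bigcap_(z in [set` r]) A' z.
  by apply: eq_bigcapr => z /= zr; rewrite /A' zr.
have -> : (\prod_(z <- r) P (A z) = \prod_(z <- r) P (A' z))%E.
  by apply: eq_big_seq => z zr; rewrite /A' zr.
have mcap (q : seq Z) (B : Z -> set Omega) : (forall z, F z (B z)) ->
    measurable (\bigcap_(z in [set` q]) B z).
  move=> FB; elim: q => [|a q IH]; first by rewrite set_nil bigcap_set0.
  by rewrite bigcap_seq_cons; apply: measurableI => //; exact: Fm (FB a).
pose S : set_system Omega := [set C | exists q B, [/\ uniq q, (forall z, z \in q -> D z),
  (forall z, F z (B z)) & C = \bigcap_(z in [set` q]) B z]].
have Pr : P (\bigcap_(z in [set` r]) A' z) = (\prod_(z <- r) P (A' z))%E by exact: indF.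
have fr : (\prod_(z <- r) P (A' z))%E \is a fin_num.
  by apply: fin_num_prode => z; apply: prob_fin_num; exact: Fm (FA' z).
rewrite -(fineK fr).
apply: (indep_sigma P S) => //.
- by move=> _ [q [B [_ _ FB ->]]]; exact: mcap.
- move=> _ _ [q [B [uq qD FB ->]]] [q' [B' [uq' qD' FB' ->]]].
  exists (undup (q ++ q')), (fun z => (if z \in q then B z else setT) `&`
                                   (if z \in q' then B' z else setT)); split.
  + exact: undup_uniq.
  + by move=> z; rewrite mem_undup mem_cat => /orP[/qD|/qD'].
  + by move=> z; apply: FI; case: ifP.
  + apply/seteqP; split => w.
      move=> [Hq Hq'] z /= _; split; case: ifP => // zq; [exact: Hq|exact: Hq'].
    move=> HH; split => z /= zq; have := HH z; rewrite /= mem_undup mem_cat zq ?orbT => /(_ isT)[];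
      rewrite ?zq//.
- exact: mcap.
- by rewrite Pr fineK.
- move=> _ [q [B [uq qD FB ->]]]; rewrite fineK//.
  rewrite (indF q B uq)//.
  pose C z := if z \in q then B z else A' z.
  have qr z : z \in r -> z \notin q by move=> zr; apply/negP => /qD; exact: rD.
  have -> : \bigcap_(z in [set` q]) B z `&` \bigcap_(z in [set` r]) A' z =
      \bigcap_(z in [set` q ++ r]) C z.
    apply/seteqP; split => w.
      move=> [Hq Hr] z /=; rewrite mem_cat /C; case: ifP => [zq _|_ /= zr]; [exact: Hq|exact: Hr].
    move=> HH; split => z /= zq; have := HH z; rewrite /= mem_cat /C zq ?orbT//.
      exact.
    by rewrite (negbTE (qr _ zq)); exact.
  rewrite (indF (q ++ r) C); last 2 first.
  + rewrite cat_uniq uq ur andbT; apply/hasPn => z; exact: qr.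
  + by move=> z _; rewrite /C; case: ifP.
  rewrite big_cat/=; congr (_ * _)%E.
    by apply: eq_big_seq => z zq; rewrite /C zq.
  by apply: eq_big_seq => z zr; rewrite /C (negbTE (qr _ zr)).
- apply: sigma_sub GH => B [z Dz FB]; apply: sub_sigma_algebra.
  exists [:: z], (fun z' => if z' == z then B else setT); split => //.
  + by move=> z'; rewrite inE => /eqP ->.
  + by move=> z'; case: eqVneq => [->|].
  + by rewrite set_cons1 bigcap_set1 eqxx.
Qed.

End Grouping.

(** The indices of a finite intersection are grouped by [src]. The intersection over a block is an
    event of the corresponding [S x], so independence of [S] separates the blocks, and the last
    hypothesis factors each block. *)
Lemma independent_blocks (Z X : eqType) (src : Z -> X) (F : Z -> set_system Omega)
    (S : X -> set_system Omega) :
  (forall x, S x setT) -> (forall x, setI_closed (S x)) ->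
  (forall z, F z `<=` S (src z)) ->
  mutually_independent P S ->
  (forall x (r : seq Z) A, uniq r -> (forall z, z \in r -> src z = x) ->
    (forall z, z \in r -> F z (A z)) ->
    P (\bigcap_(z in [set` r]) A z) = (\prod_(z <- r) P (A z))%E) ->
  mutually_independent P F.
Proof.
move=> ST SI FS indS indB r A ur FA.
pose B x := \bigcap_(z in [set` [seq z <- r | src z == x]]) A z.
have -> : \bigcap_(z in [set` r]) A z = \bigcap_(x in [set` undup (map src r)]) B x.
  apply/seteqP; split => w HH.
    by move=> x /= _ z; rewrite /= mem_filter => /andP[_]; exact: HH.
  move=> z /= zr; apply: (HH (src z)); first by rewrite /= mem_undup map_f.
  by rewrite /= mem_filter eqxx.
rewrite indS ?undup_uniq//; last first.
  move=> x _; rewrite /B.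
  have : forall z, z \in [seq z <- r | src z == x] -> S x (A z).
    by move=> z; rewrite mem_filter => /andP[/eqP <- /FA]; exact: FS.
  elim: [seq z <- r | src z == x] => [|a q IH] Hq; first by rewrite set_nil bigcap_set0.
  rewrite bigcap_seq_cons; apply: SI; first by apply: Hq; rewrite mem_head.
  by apply: IH => z zq; apply: Hq; rewrite in_cons zq orbT.
transitivity (\prod_(x <- undup (map src r)) \prod_(z <- r | src z == x) P (A z))%E; last first.
  rewrite (exchange_big_dep predT)//=; apply: eq_big_seq => z zr.
  rewrite -big_filter (eq_filter (a2 := pred1 (src z))); last by move=> x /=; rewrite eq_sym.
  by rewrite filter_pred1_uniq ?undup_uniq ?mem_undup ?map_f// big_seq1.
apply: eq_bigr => x _.
rewrite /B (indB x) ?filter_uniq//.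
- by rewrite big_filter.
- by move=> z; rewrite mem_filter => /andP[/eqP].
- by move=> z; rewrite mem_filter => /andP[_ /FA].
Qed.

Lemma prob_ae (O A : set Omega) : measurable O -> P O = 1%E -> measurable A ->
  P A = P (A `&` O).
Proof.
move=> mO PO mA; have PO' : P (~` O) = 0%E by rewrite probability_setC// PO subee.
have -> : P A = (P (A `\` O) + P (A `&` O))%E by exact: measureDI.
rewrite (_ : P (A `\` O) = 0%E) ?add0e//.
apply: subset_measure0 (_ : A `\` O `<=` ~` O) _ => //.
- exact: measurableD.
- exact: measurableC.
Qed.

(** Probabilities only see the trace on a set of full measure, so each event of [F'] may be replaced
    by one of [F] with the same trace. This transfers independence to the modified system. *)
Lemma independent_ae (Z : eqType) (F F' : Z -> set_system Omega) O :
  measurable O -> P O = 1%E -> (forall z, F z `<=` measurable) ->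
  (forall z, F' z `<=` measurable) ->
  (forall z A', F' z A' -> exists2 A, F z A & A' `&` O = A `&` O) ->
  mutually_independent P F -> mutually_independent P F'.
Proof.
move=> mO PO Fm F'm FF' indF r A ur FA.
have mcap (G : Z -> set_system Omega) (B : Z -> set Omega) (q : seq Z) :
    (forall z, G z `<=` measurable) -> (forall z, z \in q -> G z (B z)) ->
    measurable (\bigcap_(z in [set` q]) B z).
  move=> Gm; elim: q => [|a q IH] GB; first by rewrite set_nil bigcap_set0.
  rewrite bigcap_seq_cons; apply: measurableI; first by apply: (Gm a); apply: GB; rewrite mem_head.
  by apply: IH => z zq; apply: GB; rewrite in_cons zq orbT.
have HB z : exists B, z \in r -> F z B /\ A z `&` O = B `&` O.
  have [zr|zr] := boolP (z \in r); last by exists setT.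
  by have [B FB E] := FF' z (A z) (FA z zr); exists B.
move: HB => /(_ _)/cid-/all_sig[B HB].
transitivity (P (\bigcap_(z in [set` r]) B z)).
  rewrite (prob_ae O)//; last exact: (mcap F').
  rewrite [RHS](prob_ae O)//; last by apply: (mcap F) => // z /HB[].
  congr (P _); apply/seteqP; split => w [Hw Ow]; split => // z /= zr.
    by have [_ E] := HB z zr; have [] : (B z `&` O) w by rewrite -E; split => //; exact: Hw.
  by have [_ E] := HB z zr; have [] : (A z `&` O) w by rewrite E; split => //; exact: Hw.
rewrite indF//; last by move=> z /HB[].
apply: eq_big_seq => z zr; have [FB E] := HB z zr.
rewrite (prob_ae O _ mO PO (Fm _ _ FB)) -E -prob_ae//.
exact: F'm (FA z zr).
Qed.

End MutualIndependence.

Section ExponentialTail.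
Context {R : realType}.

Lemma exponential_prob_gt (rate x : R) : 0 < rate -> 0 <= x ->
  exponential_prob rate `]x, +oo[ = (expR (- rate * x))%:E.
Proof.
move=> r0 x0.
transitivity (\int[lebesgue_measure]_(y in `[x, +oo[) (exponential_pdf rate y)%:E)%E.
  rewrite /exponential_prob; apply: integral_itv_obnd_cbnd.
  apply/measurable_EFinP; apply: measurable_funTS; exact: measurable_exponential_pdf.
have cont : continuous (fun z : R => expR (- rate * z)).
  move=> z; apply: continuous_comp; last exact: continuous_expR.
  by apply: continuousM => //; apply: (@continuousN _ R^o); exact: cst_continuous.
rewrite (@ge0_continuous_FTC2y _ _ (fun y => - (expR (- rate * y))) _ 0)//.
- by rewrite EFinN oppeK add0e.
- by move=> y _; apply: exponential_pdf_ge0; exact: ltW.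
- apply: (@continuous_subspaceW R^o _ _ [set` `[0, +oo[%R]).
    by move=> y /=; rewrite !in_itv/= !andbT; exact: le_trans.
  exact: within_continuous_exponential_pdf.
- rewrite -oppr0; apply: cvgN.
  rewrite (_ : (fun x => expR (- rate * x)) =
               (fun z => expR (- z)) \o (fun z => rate * z)); last first.
    by apply: eq_fun => y; rewrite mulNr.
  apply: (@cvg_comp _ _ _ _ _ _ (pinfty_nbhs R)); last exact: cvgr_expR.
  exact: gt0_cvgMry.
- by apply: cvgN; apply/cvg_at_right_filter; exact: cont.
- move=> z; rewrite in_itv/= andbT => xz; apply: derive1_exponential_pdf.
  by rewrite in_itv/= andbT (le_lt_trans x0).
Qed.

End ExponentialTail.

Section AlmostEverywhere.
Context {d} {Omega : measurableType d} {R : realType} (P : probability Omega R).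

Lemma ae_forall_count (I : countType) (Q : I -> Omega -> Prop) :
  (forall i, {ae P, forall w, Q i w}) -> {ae P, forall w, forall i, Q i w}.
Proof.
move=> HQ.
have : {ae P, forall w, forall n : nat, if @unpickle I n is Some i then Q i w else True}.
  apply/ae_foralln => n; case: unpickle => [i|]; first exact: HQ.
  by apply: aeW.
by apply: filterS => w Hw i; have := Hw (pickle i); rewrite pickleK.
Qed.

Lemma ae_prob1 (A : set Omega) : measurable A -> P A = 1%E -> {ae P, forall w, A w}.
Proof.
move=> mA PA; exists (~` A); split => //; first exact: measurableC.
by rewrite probability_setC// PA subee.
Qed.

Lemma ae_prob0 (A : set Omega) : measurable A -> P A = 0%E -> {ae P, forall w, ~ A w}.
Proof. by move=> mA PA; exists A; split => // w /= /contrapT. Qed.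

Lemma ae_full_set (Q : Omega -> Prop) : {ae P, forall w, Q w} ->
  exists O, [/\ measurable O, P O = 1%E & forall w, O w -> Q w].
Proof.
move=> [A [mA PA QA]]; exists (~` A); split; first exact: measurableC.
  by rewrite probability_setC// PA sube0.
by move=> w nAw; apply: contrapT => nQ; apply: nAw; exact: QA.
Qed.

Definition patch_on (O : set Omega) (X Y : Omega -> R) w := if w \in O then X w else Y w.

Lemma patch_onE O X Y w : O w -> patch_on O X Y w = X w.
Proof. by move=> Ow; rewrite /patch_on mem_set. Qed.

Lemma measurable_patch_on O X Y : measurable O -> measurable_fun setT X ->
  measurable_fun setT Y -> measurable_fun setT (patch_on O X Y).
Proof.
move=> mO mX mY; apply: measurable_fun_ifT => //.
rewrite (_ : (fun w => w \in O) = (fun w => (\1_O w : R) == 1)); last first.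
  by apply/funext => w; rewrite indicE; case: (w \in O) => /=; rewrite ?eqxx// eq_sym oner_eq0.
by apply: measurable_fun_eqr => //; exact: measurable_indic.
Qed.

End AlmostEverywhere.

Section IndependentSources.
Context {d} {Omega : measurableType d} {R : realType} (P : probability Omega R).
Context {N : nat}.
Variables (lambda p : 'I_N -> R).
Hypotheses (lambda_gt0 : forall i, 0 < lambda i) (p_ge0 : forall i, 0 <= p i).
Variables (g : 'I_N -> nat -> Omega -> R) (c : 'I_N -> nat -> set Omega)
  (s : nat -> Omega -> R).

Local Notation index := ('I_N * nat + 'I_N * nat + nat)%type.

(** Gaps rather than generation times, since the gaps of a source are the independent variables.
    Each system is a pi-system containing [setT], as grouping requires; for a mark, the event itself
    and [setT] are enough to generate. *)
Definition elementary_source (z : index) : set_system Omega :=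
  match z with
  | inl (inl (i, n)) => preimages (gap (g i) n)
  | inl (inr (i, n)) => [set A | A = c i n \/ A = setT]
  | inr k => preimages (s k)
  end.

Hypotheses (mg : forall i n, measurable_fun setT (g i n))
  (mc : forall i n, measurable (c i n)) (ms : forall k, measurable_fun setT (s k)).

Lemma elementary_sourcem z : elementary_source z `<=` measurable.
Proof.
case: z => [[[i n]|[i n]]|k] /=; [|by move=> _ [->|->]|exact: preimagesm].
by apply: preimagesm; exact: measurable_gap.
Qed.

Lemma elementary_sourceI z : setI_closed (elementary_source z).
Proof.
case: z => [[[i n]|[i n]]|k] /=; try exact: setI_closed_preimages.
by move=> A B [->|->] [->|->]; rewrite ?setIid ?setIT ?setTI; [left|left|left|right].
Qed.

Lemma elementary_sourceT z : elementary_source z setT.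
Proof.
by case: z => [[[i n]|[i n]]|k] /=; [exists setT; rewrite ?preimage_setT|right|
  exists setT; rewrite ?preimage_setT].
Qed.

Hypothesis indep : mutually_independent P elementary_source.
Hypothesis gap_tail : forall i n x, 0 <= x ->
  P [set w | x < gap (g i) n w] = (expR (- lambda i * x))%:E.
Hypothesis mark_prob : forall i n, P (c i n) = (p i)%:E.

Let generated (D : set index) : set_system Omega :=
  \bigcup_(z in D) elementary_source z.

Let gen_time D j n : (forall l, (l <= n)%N -> D (inl (inl (j, l)))) ->
  measurable_for (generated D) (g j n).
Proof.
have mgap l : D (inl (inl (j, l))) -> measurable_for (generated D) (gap (g j) l).
  by move=> Dl B mB; apply: sub_sigma_algebra; exists (inl (inl (j, l))) => //; exists B.
elim: n => [|n IH] Dn; first exact: (mgap 0%N (Dn _ _)).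
rewrite (_ : g j n.+1 = fun w => g j n w + gap (g j) n.+1 w); last first.
  by apply/funext => w /=; rewrite addrC subrK.
apply: measurable_forD; first by apply: IH => l ln; apply: Dn; exact: leqW.
by apply: mgap; exact: Dn.
Qed.

Lemma gap_memoryless i m :
  memoryless P (generated [set z | z != inl (inl (i, m))]) (lambda i) (gap (g i) m) setT 1.
Proof.
move=> H x x0 GH; rewrite setIT mul1r -(gap_tail i m x x0).
have := independent_group P elementary_source elementary_sourcem elementary_sourceI
  elementary_sourceT indep [set z | z != inl (inl (i, m))] [:: inl (inl (i, m))]
  (fun=> [set w | x < gap (g i) m w]) H.
rewrite set_cons1 bigcap_set1 big_seq1; apply => //.
  by move=> z; rewrite inE => /eqP -> /=; rewrite eqxx.
move=> z; rewrite inE => /eqP -> /=; exists `]x, +oo[%classic; first exact: measurable_itv.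
exact: tail_preimage.
Qed.

(** A tie means that the gap [X] equals [tau], which is measurable with respect to all other
    elementary sources. By the memoryless property [X] falls into []tau - e, tau]] with probability
    at most [lambda i * e], and [e] tends to 0. *)
Lemma no_tie i j m n : i != j -> {ae P, forall w, g i m w != g j n w}.
Proof.
move=> ij; pose X := gap (g i) m.
pose D : set index := [set z | z != inl (inl (i, m))].
pose tau w := g j n w - (if m is m'.+1 then g i m' w else 0).
have XE w : (g i m w == g j n w) = (X w == tau w).
  rewrite /X /tau; case: m {X D tau} => [|m] /=; first by rewrite subr0.
  by rewrite (inj_eq (addIr _)).
have mtau : measurable_for (generated D) tau.
  apply: measurable_forB.
    by apply: gen_time => l _ /=; apply: contra_neq ij => -[->].
  rewrite /D; case: m {X D tau XE} => [|m]; first exact: measurable_for_cst.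
  apply: gen_time => l lm /=; apply/eqP => -[ml]; move: lm; rewrite ml ltnn//.
have mX : measurable_fun setT X by exact: measurable_gap.
have Dm : generated D `<=` measurable by move=> A [z _]; exact: elementary_sourcem.
have mtau' := measurable_for_measurable _ _ Dm mtau.
have X0 : {ae P, forall w, 0 < X w}.
  apply: ae_prob1; first by apply: measurable_lt_fun => //; exact: measurable_cst.
  by rewrite gap_tail// mulr0 expR0.
(* Bounding [tau] away from 0 keeps [tau - e] nonnegative for small [e], as [memoryless_shift]
   requires. Since [X] is positive almost surely, countably many [q] cover all ties up to a null
   set. *)
have Hq (q : nat) : {ae P, forall w, ~ (q.+1%:R^-1 <= tau w /\ X w = tau w)}.
  pose H := [set w | q.+1%:R^-1 <= tau w].
  have GH : <<s generated D >> H by apply: measurable_for_le => //; exact: measurable_for_cst.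
  have mH : measurable H by exact: (sigma_measurable _ Dm).
  have mE : measurable [set w | X w = tau w].
    rewrite (_ : [set w | _] = (fun w => X w - tau w) @^-1` [set 0]).
      by rewrite -[_ @^-1` _]setTI; apply: measurable_funB => //; exact: measurable_set1.
    by apply/seteqP; split => w /=; [move=> ->; rewrite subrr|exact: subr0_eq].
  apply: (ae_prob0 P (H `&` [set w | X w = tau w])); first exact: measurableI.
  suff : pr P (H `&` [set w | X w = tau w]) <= 0.
    by rewrite prE//; [move=> le0; congr EFin; apply/eqP; rewrite eq_le le0 pr_ge0|exact: measurableI].
  have bound r : (q <= r)%N -> pr P (H `&` [set w | X w = tau w]) <= lambda i * r.+1%:R^-1.
    move=> qr; pose e : R := r.+1%:R^-1; have e0 : 0 <= e by rewrite invr_ge0.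
    pose tau' w := tau w - e.
    have mt' : measurable_for (generated D) tau'.
      by apply: measurable_forB => //; exact: measurable_for_cst.
    have ml := gap_memoryless i m.
    have := memoryless_shift P _ Dm _ _ setT 1 (ltW (lambda_gt0 i)) ler01 mX measurableT ml ml
      H tau' e GH mt' _ e0.
    rewrite setIT mul1r => HH.
    have {}HH : P (H `&` [set w | tau w < X w]) = (P (H `&` [set w | (tau' w < X w)%R]) * (expR (- lambda i * e))%:E)%E.
      rewrite -HH; last first.
        move=> w /= Hw; rewrite subr_ge0; apply: le_trans Hw.
        by rewrite /e lef_pV2 ?posrE// ler_nat.
      by congr (P (_ `&` _)); apply/seteqP; split => w /=; rewrite /tau' subrK.
    have mlt (Y : Omega -> R) : measurable_fun setT Y -> measurable (H `&` [set w | Y w < X w]).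
      by move=> mY; apply: measurableI => //; exact: measurable_lt_fun.
    have mt'' := measurable_for_measurable _ _ Dm mt'.
    have prHH : pr P (H `&` [set w | tau w < X w]) = pr P (H `&` [set w | tau' w < X w]) * expR (- lambda i * e).
      by apply: EFin_inj; rewrite EFinM -!prE//; exact: mlt.
    apply: (@le_trans _ _ (pr P ((H `&` [set w | tau' w < X w]) `\` (H `&` [set w | tau w < X w])))).
      apply: le_pr; [exact: measurableI|by apply: measurableD; exact: mlt|].
      move=> w [Hw /= XE']; split.
        split => //=; rewrite XE' /tau' ltrBlDr ltrDl /e invr_gt0//.
      by move=> [_ /=]; rewrite XE' ltxx.
    rewrite pr_setD; [|exact: mlt|exact: mlt|]; last first.
      by move=> w [Hw /= lt]; split => //=; apply: le_lt_trans lt; rewrite /tau' gerBl.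
    rewrite prHH -[leRHS]mul1r -[X in X - _]mulr1 -mulrBr; apply: ler_pM => //.
    - exact: pr_ge0.
    - by rewrite subr_ge0 -[leRHS]expR0 ler_expR mulNr oppr_le0 mulr_ge0// ltW.
    - by rewrite -lee_fin -prE ?probability_le1//; exact: mlt.
    - have /andP[_] := expR_diff_bounds (lambda i * e) (mulr_ge0 (ltW (lambda_gt0 i)) e0).
      by rewrite mulNr.
  have cv : lambda i * r.+1%:R^-1 @[r --> \oo] --> lambda i * 0.
    by apply: cvgMr; exact: cvg_harmonic.
  rewrite mulr0 in cv; rewrite -(cvg_lim _ cv)//.
  apply: limr_ge; first by apply/cvg_ex; exists 0.
  by exists q => // r /= qr; exact: bound.
have Hq' : {ae P, forall w, forall q : nat, ~ (q.+1%:R^-1 <= tau w /\ X w = tau w)}.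
  exact: ae_forall_count.
move: X0 Hq'; apply: filterS2 => w X0w Hw.
rewrite XE; apply/eqP => Xt; have t0 : 0 < tau w by rewrite -Xt.
have [q _ /(_ q (leqnn q)) /= ltq] := near_infty_natSinv_lt (PosNum t0).
by apply: (Hw q); split => //; exact: ltW.
Qed.

(** The past of source [k] before point [m], together with the other sources and the services, is
    generated by elementary sources different from the gap and the mark at [(k, m)]. Grouping then
    makes the past, the gap and the mark independent. *)
Lemma sources_fresh : fresh_sources P lambda p (services s) g c.
Proof.
move=> k m.
pose gz : index := inl (inl (k, m)).
pose cz : index := inl (inr (k, m)).
pose D := [set z | z != gz /\ z != cz].
have sub : others (services s) g c k `|` past_sets (g k) (c k) m `<=` <<s generated D >>.
  move=> A [[[l HA]|[j jk [n HA]]]|[n nm HA]].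
  - by apply: sub_sigma_algebra; exists (inr l).
  - case: HA => [[B mB ->]|->].
      by apply: gen_time mB => l ln; split; apply: contra_neq jk => -[].
    apply: sub_sigma_algebra; exists (inl (inr (j, n))); last by left.
    by split => //; apply: contra_neq jk => -[].
  - case: HA => [[B mB ->]|->].
      apply: gen_time mB => l ln; split => //; apply/eqP => -[lm].
      by move: (leq_ltn_trans ln nm); rewrite lm ltnn.
    apply: sub_sigma_algebra; exists (inl (inr (k, n))); last by left.
    by split => //; apply/eqP => -[E]; rewrite E ltnn in nm.
have gzP x : elementary_source gz [set w | x < gap (g k) m w].
  exists `]x, +oo[%classic; first exact: measurable_itv.
  exact: tail_preimage.
have group := independent_group P elementary_source elementary_sourcem elementary_sourceI
  elementary_sourceT indep D.
split=> H x x0 /(sigma_sub _ _ sub) GH.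
  rewrite setIT mul1r -(gap_tail k m x x0).
  have := group [:: gz] (fun=> [set w | x < gap (g k) m w]) H.
  rewrite set_cons1 bigcap_set1 big_seq1; apply => //.
    by move=> z; rewrite inE => /eqP -> [] /=; rewrite eqxx.
  by move=> z; rewrite inE => /eqP ->.
have := group [:: gz; cz] (fun z => if z == gz then [set w | x < gap (g k) m w] else c k m) H.
rewrite bigcap_seq_cons set_cons1 bigcap_set1 big_cons big_seq1 eqxx (_ : cz == gz = false)//.
rewrite setIA gap_tail// mark_prob -EFinM mulrC; apply => //.
  by move=> z; rewrite !inE => /orP[]/eqP -> []; rewrite eqxx.
by move=> z; rewrite !inE => /orP[]/eqP ->; [rewrite eqxx|left].
Qed.

Lemma past_services_indep k A (B : set R) : <<s past_services s k >> A ->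
  measurable B -> P (A `&` s k @^-1` B) = (P A * P (s k @^-1` B))%E.
Proof.
move=> GA mB.
have := independent_group P elementary_source elementary_sourcem elementary_sourceI
  elementary_sourceT indep [set z | z != inr k] [:: inr k] (fun=> s k @^-1` B) A.
rewrite set_cons1 bigcap_set1 big_seq1; apply => //.
- by move=> z; rewrite inE => /eqP -> /=; rewrite eqxx.
- by move=> z; rewrite inE => /eqP ->; exists B.
- apply: sigma_sub GA => C [l lk HC]; apply: sub_sigma_algebra; exists (inr l) => //=.
  by apply/eqP => -[E]; rewrite E ltnn in lk.
Qed.

End IndependentSources.

Section RegularVersion.
Context {d} {Omega : measurableType d} {R : realType} (P : probability Omega R).
Context {N M : nat}.
Variables (lambda : 'I_N -> R) (p : 'I_N -> 'I_M -> R) (mu : R).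
Hypotheses (lambda_gt0 : forall i, 0 < lambda i) (mu_gt0 : 0 < mu).
Variables (gen : 'I_N -> nat -> Omega -> R) (info : 'I_N -> nat -> 'I_M -> set Omega)
  (serv : nat -> Omega -> R).
Hypotheses (mgen : forall i n, measurable_fun setT (gen i n))
  (mserv : forall k, measurable_fun setT (serv k)).
Hypothesis sys : status_update_system P gen info serv lambda p mu.
Variable j : 'I_M.

Local Notation mark := (fun i n => info i n j).

Lemma exponential_tail (rate : R) (X : Omega -> R) x : 0 < rate -> 0 <= x ->
  exponentially_distributed P rate X -> P [set w | x < X w] = (expR (- rate * x))%:E.
Proof.
move=> r0 x0 HX; rewrite -exponential_prob_gt// -HX; last exact: measurable_itv.
by congr (P _); rewrite tail_preimage.
Qed.

Let gap_tail i n x : 0 <= x -> P [set w | x < gap (gen i) n w] = (expR (- lambda i * x))%:E.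
Proof. by move=> x0; apply: exponential_tail => //; have [+ _] := generation_poisson sys i; apply. Qed.

Let elementary := elementary_source gen mark serv.

Local Notation index := ('I_N * nat + 'I_N * nat + nat)%type.

Lemma elementary_independent : mutually_independent P elementary.
Proof.
pose src (z : index) : 'I_N + ('I_N * nat) + nat :=
  match z with
  | inl (inl (i, n)) => inl (inl i)
  | inl (inr x) => inl (inr x)
  | inr k => inr k
  end.
(* Only the block of a Poisson process contains several indices. In any other block a duplicate-free
   list has at most one entry, and there is nothing to prove. *)
have single (z : index) (r : seq index)
    (A : index -> set Omega) :
    uniq r -> (forall y, y \in r -> y = z) ->
    P (\bigcap_(z in [set` r]) A z) = (\prod_(z <- r) P (A z))%E.
  case: r => [|a [|b r]] ur Hr.
  - by rewrite set_nil bigcap_set0 big_nil probability_setT.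
  - by rewrite set_cons1 bigcap_set1 big_seq1.
  - move: ur => /=; rewrite (Hr a) ?mem_head// (Hr b) ?in_cons ?eqxx ?orbT//.
apply: (independent_blocks P _ _ src elementary (source_events gen info serv)).
- case=> [[i|[i n]]|k] /=; [exact: sigma_setT|exact: sigma_setT|].
  by exists setT => //; rewrite preimage_setT setTI.
- case=> [[i|[i n]]|k] /=; try by move=> A B; exact: sigma_setI.
  move=> _ _ [A mA <-] [B mB <-]; exists (A `&` B); first exact: measurableI.
  by rewrite !setTI.
- case=> [[[i n]|[i n]]|k] /=.
  + pose G := \bigcup_n preimage_set_system [set: Omega] (gen i n) measurable.
    have mG m : measurable_for G (gen i m).
      move=> B mB; apply: sub_sigma_algebra; exists m => //; exists B => //.
      by rewrite setTI.
    have mgap : measurable_for G (gap (gen i) n).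
      by case: n => [|n]; [exact: mG|exact: measurable_forB].
    by move=> _ [B mB ->]; exact: mgap.
  + move=> _ [->|->]; last exact: sigma_setT.
    by apply: sub_sigma_algebra; exists j.
  + by move=> _ [B mB ->]; exists B => //; rewrite setTI.
- exact: sources_independent sys.
- move=> x r A ur Hr FA; case: x Hr => [[i|x]|k] Hr.
  + pose f n : index := inl (inl (i, n)).
    pose idx (z : index) := if z is inl (inl (_, n)) then n else 0%N.
    have rE : r = map f (map idx r).
      rewrite -map_comp -[LHS]map_id; apply/eq_in_map => z /Hr.
      by case: z => [[[i' n]|y]|k] //= [->].
    have uidx : uniq (map idx r) by rewrite rE in ur; exact: map_uniq ur.
    rewrite rE; have [_ /(_ (map idx r) (A \o f) uidx)] := generation_poisson sys i.
    rewrite [X in _ -> _ = X](_ : _ = (\prod_(n <- map idx r) P ((A \o f) n))%E); last by rewrite big_map.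
    move=> <-.
      congr (P _); apply/seteqP; split => w HH n.
        by move=> /= nr; apply: (HH (f n)); exact: map_f.
      by move=> /= /mapP[m mr ->]; exact: HH.
    move=> n nr; have : f n \in r by rewrite rE; exact: map_f.
    by move=> /FA [B mB E]; exists B => //; rewrite setTI /= E.
  + apply: (single (inl (inr x))) => // y /Hr.
    by case: y => [[[i' n]|y]|k] //= [->].
  + apply: (single (inr k)) => // y /Hr.
    by case: y => [[[i' n]|y]|l] //= [->].
Qed.

(** A point is at least as late as the length of the gap before it, so unbounded gaps force the
    points to infinity. The first [m] gaps are all at most [q] with probability [r ^+ m], which
    tends to 0. *)
Lemma gap_unbounded i q : {ae P, forall w, exists n, q%:R < gap (gen i) n w}.
Proof.
pose A (n : nat) := [set w | gap (gen i) n w <= q%:R].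
have AE n : A n = ~` [set w | q%:R < gap (gen i) n w].
  by apply/seteqP; split => w /=; rewrite /A/= leNgt => /negP.
have mlt n : measurable [set w | q%:R < gap (gen i) n w].
  by apply: measurable_tail; exact: measurable_gap.
have mA n : measurable (A n) by rewrite AE; exact: measurableC.
pose r : R := 1 - expR (- lambda i * q%:R).
have r1 : `|r| < 1.
  have e0 := expR_gt0 (- lambda i * q%:R).
  have e1 : expR (- lambda i * q%:R) <= 1.
    by rewrite -[leRHS]expR0 ler_expR mulNr oppr_le0 mulr_ge0// ltW.
  by rewrite /r ger0_norm ?subr_ge0// ltrBlDr ltrDl.
have PA n : P (A n) = r%:E.
  by rewrite AE probability_setC// gap_tail.
have mB : measurable (\bigcap_n A n) by exact: bigcapT_measurable.
suff : {ae P, forall w, ~ (\bigcap_n A n) w}.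
  apply: filterS => w nA; apply: contrapT => H; apply: nA => n _ /=.
  by rewrite /A/= leNgt; apply/negP => lt; apply: H; exists n.
apply: ae_prob0 => //.
have bound m : pr P (\bigcap_n A n) <= r ^+ m.
  have [_ /(_ (iota 0 m) A (iota_uniq _ _))] := generation_poisson sys i.
  have HA : forall n, n \in iota 0 m ->
      preimage_set_system [set: Omega] (gap (gen i) n) measurable (A n).
    move=> n _; exists `]-oo, q%:R]%classic; first exact: measurable_itv.
    by rewrite setTI; apply/seteqP; split => w /=; rewrite in_itv.
  move=> /(_ HA); under eq_bigr do rewrite PA; move=> E.
  have mC : measurable (\bigcap_(n in [set` iota 0 m]) A n).
    by apply: fin_bigcap_measurable.
  apply: (@le_trans _ _ (pr P (\bigcap_(n in [set` iota 0 m]) A n))).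
    by apply: le_pr => //; move=> w Hw n _; exact: Hw.
  rewrite -lee_fin -prE// E prodEFin lee_fin big_const_seq count_predT size_iota iter_mulr_1//.
rewrite prE//; congr EFin; apply/eqP; rewrite eq_le pr_ge0 andbT.
have cv : r ^+ m @[m --> \oo] --> 0 by exact: cvg_expr.
rewrite -(cvg_lim _ cv)//; apply: limr_ge; first by apply/cvg_ex; exists 0.
by apply: nearW => m; exact: bound.
Qed.

Lemma sources_regular : {ae P, forall w,
  arrival_path (fun i n => gen i n w) /\ forall k, 0 < serv k w}.
Proof.
have H1 : {ae P, forall w, forall i n, 0 < gap (gen i) n w}.
  apply: ae_forall_count => i; apply: ae_forall_count => n; apply: ae_prob1.
    by apply: measurable_tail; exact: measurable_gap.
  by rewrite gap_tail// mulr0 expR0.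
have H2 : {ae P, forall w, forall i (q : nat), exists n, q%:R < gap (gen i) n w}.
  apply: ae_forall_count => i; apply: ae_forall_count => q; exact: gap_unbounded.
have H3 : {ae P, forall w, forall i i' m n, i != i' -> gen i m w != gen i' n w}.
  apply: ae_forall_count => i; apply: ae_forall_count => i'; apply: ae_forall_count => m; apply: ae_forall_count => n.
  have [->|ne] := eqVneq i i'; first by apply: aeW.
  have mc k l : measurable (info k l j) by exact: measurable_info sys k l j.
  have := no_tie P lambda lambda_gt0 gen mark serv mgen mc mserv elementary_independent gap_tail.
  by move=> /(_ i i' m n ne); apply: filterS => w.
have H4 : {ae P, forall w, forall k, 0 < serv k w}.
  apply: ae_forall_count => k; apply: ae_prob1.
    by exact: measurable_tail.
  by rewrite (exponential_tail mu)// ?mulr0 ?expR0//; exact: service_exponential sys k.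
have H34 : {ae P, forall w, (forall i i' m n, i != i' -> gen i m w != gen i' n w) /\
    forall k, 0 < serv k w}.
  by move: H3 H4; apply: filterS2 => w; split.
move: H1 H2 H34; apply: filterS3 => w K1 K2 [K3 K4].
split => //; split.
- move=> i; split; first exact: (K1 i 0%N).
    by move=> n; rewrite -subr_gt0; exact: (K1 i n.+1).
  move=> t; have [n Hn] := K2 i (Num.trunc t).+1; exists n.
  have tn : t < (Num.trunc t).+1%:R.
    have [t0|t0] := leP 0 t; first by have /andP[] := Num.Theory.truncn_itv t0.
    exact: lt_le_trans t0 _.
  apply: (lt_trans tn); apply: (lt_le_trans Hn).
  case: n {Hn} => [|n] //=; rewrite gerBl.
  elim: n => [|n IH]; first exact: ltW (K1 i 0%N).
  by apply: (le_trans IH); rewrite -subr_ge0; exact: ltW (K1 i n.+1).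
- move=> i i' m n E; apply/eqP/negPn/negP => /K3 => /(_ m n).
  by rewrite E eqxx.
Qed.

(* Modifying the system on a null set makes every sample path regular. *)
Lemma regular_version : exists (O : set Omega) (g : 'I_N -> nat -> Omega -> R)
    (s : nat -> Omega -> R),
  [/\ measurable O, P O = 1%E,
      (forall w, O w -> (forall i n, g i n w = gen i n w) /\ (forall k, s k w = serv k w)),
      (forall w, arrival_path (fun i n => g i n w)) /\ (forall k w, 0 <= s k w) &
      [/\ (forall i n, measurable_fun setT (g i n)) /\ (forall k, measurable_fun setT (s k)),
          fresh_sources P lambda (p ^~ j) (services s) g mark,
          (forall k A (B : set R), <<s past_services s k >> A -> measurable B ->
             P (A `&` s k @^-1` B) = (P A * P (s k @^-1` B))%E) &
          forall k x, 0 <= x -> P [set w | x < s k w] = (expR (- mu * x))%:E]].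
Proof.
case: (ae_full_set P _ sources_regular) => O [mO PO HO].
(* On the null set a deterministic regular path is used: [n * N + i] increases in [n] without bound,
   and its residue modulo [N] determines the source, which excludes ties. *)
pose g i n := patch_on O (gen i n) (fun=> (n * N + i).+1%:R).
pose s k := patch_on O (serv k) (fun=> 0).
have mg i n : measurable_fun setT (g i n) by exact: measurable_patch_on.
have ms k : measurable_fun setT (s k) by exact: measurable_patch_on.
have mc i n : measurable (info i n j) by exact: measurable_info sys _ _ _.
have gE i n w : O w -> g i n w = gen i n w by exact: patch_onE.
have sE k w : O w -> s k w = serv k w by exact: patch_onE.
have gapE i n w : O w -> gap (g i) n w = gap (gen i) n w.
  by case: n => [|n] Ow /=; rewrite !gE.
have same (X Y : Omega -> R) (B : set R) : (forall w, O w -> X w = Y w) ->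
    X @^-1` B `&` O = Y @^-1` B `&` O.
  by move=> XY; apply/seteqP; split => w /= [Bw Ow]; split => //; move: Bw; rewrite XY.
have tail (X Y : Omega -> R) (x : R) : measurable_fun setT X -> measurable_fun setT Y ->
    (forall w, O w -> X w = Y w) -> P [set w | x < X w] = P [set w | x < Y w].
  move=> mX mY XY; rewrite (prob_ae P O _ mO PO); last first.
    by apply: measurable_lt_fun => //; exact: measurable_cst.
  rewrite [RHS](prob_ae P O _ mO PO); last first.
    by apply: measurable_lt_fun => //; exact: measurable_cst.
  by congr (P _); exact: (same _ _ [set y | x < y]).
have indep : mutually_independent P (elementary_source g mark s).
  apply: (independent_ae P _ elementary _ O) => //.
  - by move=> z; exact: elementary_sourcem.
  - by move=> z; exact: elementary_sourcem.
  - case=> [[[i n]|[i n]]|k] A /=.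
    + move=> [B mB ->]; exists (gap (gen i) n @^-1` B); first by exists B.
      by apply: same => w; exact: gapE.
    + by move=> HA; exists A.
    + move=> [B mB ->]; exists (serv k @^-1` B); first by exists B.
      by apply: same => w; exact: sE.
  - exact: elementary_independent.
have gtail i n x : 0 <= x -> P [set w | x < gap (g i) n w] = (expR (- lambda i * x))%:E.
  move=> x0; rewrite -(gap_tail i n x x0); apply: tail.
  - exact: measurable_gap.
  - exact: measurable_gap.
  - exact: gapE.
exists O, g, s; split => //.
- by move=> w Ow; split => [i n|k]; [exact: gE|exact: sE].
- split.
    move=> w; have [Ow|nOw] := pselect (O w).
      have [ag _] := HO w Ow.
      by rewrite (_ : (fun i n => g i n w) = (fun i n => gen i n w))//;
        apply/funext => i; apply/funext => n; exact: gE.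
    have gD i n : g i n w = (n * N + i).+1%:R by rewrite /g /patch_on memNset.
    rewrite (_ : (fun i n => g i n w) = (fun i n => (n * N + i).+1%:R)); last first.
      by apply/funext => i; apply/funext => n; exact: gD.
    split => [i|i i' m n].
      have N0 : (0 < N)%N by case: (N) i => [[]|].
      split; [by rewrite ltr0n| |].
        by move=> n; rewrite ltr_nat ltnS ltn_add2r mulSn -[X in (X < _)%N]add0n ltn_add2r.
      move=> t; exists (Num.trunc t).+1.
      have tn : t < (Num.trunc t).+1%:R.
        have [t0|t0] := leP 0 t; first by have /andP[] := Num.Theory.truncn_itv t0.
        exact: lt_le_trans t0 _.
      apply: (lt_le_trans tn); rewrite ler_nat; apply: leqW; apply: leq_trans (leq_addr _ _).
      exact: leq_pmulr.
    move=> /eqP; rewrite eqr_nat eqSS => /eqP /(congr1 (modn^~ N)).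
    by rewrite !modnMDl !modn_small// => /val_inj.
  move=> k w; have [Ow|nOw] := pselect (O w).
    by rewrite sE//; have [_ /(_ k)/ltW] := HO w Ow.
  by rewrite /s /patch_on memNset.
- split => //.
  + apply: (sources_fresh P lambda (p ^~ j) g mark s) => //.
    by move=> i n; exact: info_prob sys _ _ _.
  + by move=> k A B; apply: (past_services_indep P g mark s).
  + move=> k x x0; rewrite -(exponential_tail mu (serv k))//; last exact: service_exponential sys k.
    by apply: tail => //; exact: sE.
Qed.

End RegularVersion.

(** * Laws of large numbers *)

Section IndependentProduct.
Context {d} {Omega : measurableType d} {R : realType} (P : probability Omega R).
Implicit Types (X Y Z : Omega -> R).

Definition integrable_var X := P.-integrable setT (EFin \o X).
Definition Ex X : R := fine (\int[P]_w (X w)%:E)%E.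

Lemma ExE X : integrable_var X -> (\int[P]_w (X w)%:E)%E = (Ex X)%:E.
Proof. by move=> iX; rewrite fineK//; exact: integrable_fin_num. Qed.

Lemma integrable_var_measurable X : integrable_var X -> measurable_fun setT X.
Proof. by move=> /measurable_int /measurable_EFinP. Qed.

Lemma integrable_var_cst (r : R) : integrable_var (fun=> r).
Proof. exact: finite_measure_integrable_cst. Qed.

Lemma integrable_varD X Y : integrable_var X -> integrable_var Y ->
  integrable_var (fun w => X w + Y w).
Proof. by move=> iX iY; have := integrableD measurableT iX iY. Qed.

Lemma integrable_varZ (r : R) X : integrable_var X -> integrable_var (fun w => r * X w).
Proof. by move=> iX; have := integrableZl measurableT r iX. Qed.

Lemma ExD X Y : integrable_var X -> integrable_var Y ->
  Ex (fun w => X w + Y w) = Ex X + Ex Y.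
Proof.
move=> iX iY; apply: EFin_inj; rewrite EFinD -!ExE//; last exact: integrable_varD.
by rewrite -integralD.
Qed.

Lemma ExZ (r : R) X : integrable_var X -> Ex (fun w => r * X w) = r * Ex X.
Proof.
move=> iX; apply: EFin_inj; rewrite EFinM -!ExE//; last exact: integrable_varZ.
by rewrite -integralZl.
Qed.

Lemma Ex_cst (r : R) : Ex (fun=> r) = r.
Proof. by rewrite /Ex; have := expectation_cst P r; rewrite unlock => ->. Qed.

Lemma Ex_ge0 X : (forall w, 0 <= X w) -> 0 <= Ex X.
Proof. by move=> X0; rewrite fine_ge0// integral_ge0// => w _; rewrite lee_fin. Qed.

Lemma integrable_var_le X Y : measurable_fun setT X -> (forall w, `|X w| <= Y w) ->
  integrable_var Y -> integrable_var X.
Proof.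
move=> mX XY; apply: le_integrable => //; first exact/measurable_EFinP.
by move=> w _ /=; rewrite lee_fin (le_trans (XY w))// ler_norm.
Qed.

Lemma Ex_le X Y : integrable_var X -> integrable_var Y -> (forall w, X w <= Y w) ->
  Ex X <= Ex Y.
Proof.
move=> iX iY XY; rewrite -lee_fin -!ExE//; apply: le_integral => //.
by move=> w _; rewrite /= lee_fin.
Qed.

Lemma integrable_var_sq X : measurable_fun setT X ->
  integrable_var (fun w => X w ^+ 2) -> integrable_var X.
Proof.
move=> mX iX; apply: (integrable_var_le _ (fun w => 1 + X w ^+ 2)) => //.
  by move=> w; rewrite -real_normK ?num_real//; have := sqr_ge0 (`|X w| - 1); nra.
by apply: integrable_varD => //; exact: integrable_var_cst.
Qed.

Lemma integrable_var_mul X Y : measurable_fun setT X -> measurable_fun setT Y ->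
  integrable_var (fun w => X w ^+ 2) -> integrable_var (fun w => Y w ^+ 2) ->
  integrable_var (fun w => X w * Y w).
Proof.
move=> mX mY iX iY; apply: (integrable_var_le _ (fun w => X w ^+ 2 + Y w ^+ 2)).
- exact: measurable_funM.
- move=> w; rewrite normrM -[X w ^+ 2]real_normK ?num_real// -[Y w ^+ 2]real_normK ?num_real//.
  have := sqr_ge0 (`|X w| - `|Y w|); have := sqr_ge0 (`|X w|); have := sqr_ge0 (`|Y w|); nra.
- exact: integrable_varD.
Qed.

Definition independent_vars X Z := forall A B : set R, measurable A -> measurable B ->
  P (X @^-1` A `&` Z @^-1` B) = (P (X @^-1` A) * P (Z @^-1` B))%E.

Lemma independent_vars_comp X Z (f h : R -> R) : measurable_fun setT f ->
  measurable_fun setT h -> independent_vars X Z -> independent_vars (f \o X) (h \o Z).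
Proof.
move=> mf mh ind A B mA mB; apply: (ind (f @^-1` A) (h @^-1` B)).
  by exact: preimage_measurable.
by exact: preimage_measurable.
Qed.

(** Independence says that the law of the pair is the product of the two laws. Fubini's theorem on
    the product then gives first integrability, from the absolute values, and next the product of
    the means. *)
Lemma independent_prod X Z : independent_vars X Z -> integrable_var X -> integrable_var Z ->
  integrable_var (fun w => X w * Z w) /\ Ex (fun w => X w * Z w) = Ex X * Ex Z.
Proof.
move=> ind iX iZ.
have mX := integrable_var_measurable _ iX; have mZ := integrable_var_measurable _ iZ.
pose X' : {mfun Omega >-> R} := HB.pack X (isMeasurableFun.Build _ _ _ _ X mX).
pose Z' : {mfun Omega >-> R} := HB.pack Z (isMeasurableFun.Build _ _ _ _ Z mZ).
pose J w := (X w, Z w).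
have mJ : measurable_fun setT J by exact: measurable_fun_pair.
pose J' : {mfun Omega >-> (R * R)%type} := HB.pack J (isMeasurableFun.Build _ _ _ _ J mJ).
pose f (xz : R * R) := (xz.1 * xz.2)%:E.
have mf : measurable_fun setT f.
  by apply/measurable_EFinP; apply: measurable_funM; [exact: measurable_fst|exact: measurable_snd].
have E (h : R * R -> \bar R) :
    (\int[distribution P X' \x distribution P Z']_xz h xz = \int[distribution P J']_xz h xz)%E.
  apply: eq_measure_integral => A mA _.
  apply: product_measure_unique mA => B C mB mC.
  exact: (ind B C mB mC).
have iabs (W : Omega -> R) : integrable_var W -> (\int[P]_w `|W w|%:E < +oo)%E.
  by move=> /integrableP[_].
have prodlty : (\int[distribution P X']_x \int[distribution P Z']_z `|f (x, z)| < +oo)%E.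
  under eq_integral => x _.
    under eq_integral => z _ do rewrite /f /= normrM EFinM.
    rewrite ge0_integralZl//; last by apply/measurable_EFinP; exact: normr_measurable.
    over.
  rewrite /= ge0_integralZr//=; last 2 first.
  - by apply/measurable_EFinP; exact: normr_measurable.
  - exact: integral_ge0.
  rewrite ge0_integral_distribution//; last by apply/measurable_EFinP; exact: normr_measurable.
  rewrite ge0_integral_distribution//; last by apply/measurable_EFinP; exact: normr_measurable.
  have abs0 (W : Omega -> R) : (0 <= \int[P]_w `|W w|%:E)%E.
    by apply: integral_ge0 => w _; rewrite lee_fin.
  apply: lte_mul_pinfty; [exact: abs0| |exact: (iabs Z iZ)].
  by rewrite ge0_fin_numE; [exact: (iabs X iX)|exact: abs0].
have intf : (distribution P X' \x distribution P Z')%E.-integrable setT f.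
  exact/integrable12ltyP.
have iXZ : integrable_var (fun w => X w * Z w).
  apply/integrableP; split; first by apply/measurable_EFinP; exact: measurable_funM.
  move/integrableP : intf => [_]; rewrite E ge0_integral_distribution//.
  exact: measurableT_comp.
split => //; apply: EFin_inj; rewrite EFinM -!ExE//.
transitivity (\int[distribution P J']_xz f xz)%E.
  by rewrite integral_distribution.
rewrite -E -integral12_prod_meas1// /fubini_F.
under eq_integral => x _.
  under eq_integral => z _ do rewrite /f /= EFinM.
  rewrite integralZl//; last by apply: integrable_pushforward => //; exact/measurable_EFinP.
  rewrite integral_distribution//.
  rewrite [X in (_ * X)%E](ExE Z)//.
  over.
rewrite /= integralZr//; last by apply: integrable_pushforward => //; exact/measurable_EFinP.
rewrite integral_distribution//.
by rewrite (ExE Z).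
Qed.

End IndependentProduct.

Section Cesaro.
Context {R : realType}.
Implicit Types (x : nat -> R).

Definition average x n : R := (\sum_(k < n) x k) / n%:R.

Definition square_subsequence (u : nat -> R) n : R := u (n.+1 ^ 2)%N.

Lemma cvg_square_subsequence (u : nat -> R) (l : R) :
  u @ \oo --> l -> square_subsequence u @ \oo --> l.
Proof.
move=> ul; apply: (@cvg_comp _ _ _ (fun n => (n.+1 ^ 2)%N) u _ \oo) => //.
move=> A [K _ HK]; exists K => // n /= Kn; apply: HK => /=.
by apply: (leq_trans Kn); rewrite expnS expn1; apply: (leq_trans (leqnSn n)); exact: leq_pmulr.
Qed.

Let isqrt (n : nat) : nat := (Num.trunc (Num.sqrt (n%:R : R))).

Let isqrtP n : ((isqrt n) ^ 2 <= n)%N /\ (n < (isqrt n).+1 ^ 2)%N.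
Proof.
have s0 : 0 <= Num.sqrt (n%:R : R) by exact: sqrtr_ge0.
have /andP[le lt] := Num.Theory.truncn_itv s0.
have sq : Num.sqrt (n%:R : R) ^+ 2 = n%:R by rewrite sqr_sqrtr.
split.
  by rewrite -(ler_nat R) natrX -sq ler_pXn2r ?nnegrE.
by rewrite -(ltr_nat R) natrX -sq ltr_pXn2r ?nnegrE.
Qed.

(* Partial sums of nonnegative terms are monotone, and consecutive squares have
   ratio tending to 1. *)
Lemma cesaro_interpolation x (l : R) : (forall k, 0 <= x k) ->
  square_subsequence (average x) @ \oo --> l -> average x @ \oo --> l.
Proof.
move=> x0; set u := square_subsequence _ => ul.
pose A n := \sum_(k < n) x k.
have A0 n : 0 <= A n by apply: sumr_ge0.
have Amono m n : (m <= n)%N -> A m <= A n.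
  by move=> mn; rewrite /A (big_ord_widen n x mn) big_mkcond; apply: ler_sum => i _; case: ifP.
(* [square_subsequence] is indexed from [1 ^ 2], hence the predecessor: for positive [n] this [k n]
   satisfies [(k n + 1)^2 <= n <= (k n + 2)^2]. *)
pose k n := (isqrt n).-1.
have kP n : (0 < n)%N -> ((k n).+1 ^ 2 <= n)%N /\ (n <= (k n).+2 ^ 2)%N.
  move=> n0; have [le lt] := isqrtP n.
  have s0 : (0 < isqrt n)%N by case: (isqrt n) lt n0 => // lt; case: n lt {le} => // -[].
  by rewrite /k prednK//; split => //; exact: ltnW.
have koo : k n @[n --> \oo] --> \oo.
  move=> B [K _ HK]; exists (K.+1 ^ 2)%N => // n /= Kn; apply: HK => /=.
  have [le lt] := isqrtP n.
  have : (K.+1 ^ 2 < (isqrt n).+1 ^ 2)%N by exact: leq_ltn_trans lt.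
  rewrite ltn_sqr ltnS /k => Ks; by rewrite -ltnS prednK//; apply: leq_trans Ks.
pose q (n : nat) : R := n.+1%:R / n.+2%:R.
have q1 : q n @[n --> \oo] --> (1 : R).
  have -> : q = fun n => 1 - n.+2%:R^-1.
    apply/funext => n; rewrite /q -[n.+1%:R](addrK 1) natr1 mulrBl divff ?pnatr_eq0// mul1r//.
  rewrite -[X in _ --> X]subr0; apply: cvgB; first exact: cvg_cst.
  apply: (@cvg_comp _ _ _ S harmonic _ \oo); last exact: cvg_harmonic.
  by move=> B [K _ HK]; exists K => // n /= Kn; apply: HK => /=; exact: leqW.
have lowl : u (k n) * q (k n) ^+ 2 @[n --> \oo] --> l.
  apply: (@cvg_comp _ _ _ k (fun m => u m * q m ^+ 2) _ \oo) => //.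
  have H : u m * q m ^+ 2 @[m --> \oo] --> l * (1 * 1) by apply: cvgM => //; exact: cvgM.
  by rewrite !mulr1 in H.
have upl : u (k n).+1 * (q (k n))^-1 ^+ 2 @[n --> \oo] --> l.
  apply: (@cvg_comp _ _ _ k (fun m => u m.+1 * (q m)^-1 ^+ 2) _ \oo) => //.
  have qV : (q n)^-1 @[n --> \oo] --> (1 : R)^-1.
    by apply: cvgV => //; exact: oner_neq0.
  have uS : u m.+1 @[m --> \oo] --> l.
    apply: (@cvg_comp _ _ _ S u _ \oo) => // B [K _ HK].
    by exists K => // n /= Kn; apply: HK => /=; exact: leqW.
  have H : u m.+1 * (q m)^-1 ^+ 2 @[m --> \oo] --> l * (1^-1 * 1^-1).
    by apply: cvgM => //; exact: cvgM.
  by rewrite invr1 !mulr1 in H.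
apply: (squeeze_cvgr _ lowl upl); exists 1%N => // n /= n0.
have [le1 le2] := kP n n0.
have gen1 (x1 a b : R) : a != 0 -> b != 0 -> x1 / a ^+ 2 * (a / b) ^+ 2 = x1 / b ^+ 2.
  by move=> a0 b0; field; rewrite ?a0 ?b0.
have gen2 (x1 a b : R) : a != 0 -> b != 0 -> x1 / b ^+ 2 * (a / b)^-1 ^+ 2 = x1 / a ^+ 2.
  by move=> a0 b0; field; rewrite ?a0 ?b0.
have e1 : u (k n) * q (k n) ^+ 2 = A ((k n).+1 ^ 2)%N / ((k n).+2 ^ 2)%N%:R.
  by rewrite /u /square_subsequence /average -/(A _) /q !natrX gen1 ?pnatr_eq0.
have e2 : u (k n).+1 * (q (k n))^-1 ^+ 2 = A ((k n).+2 ^ 2)%N / ((k n).+1 ^ 2)%N%:R.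
  by rewrite /u /square_subsequence /average -/(A _) /q !natrX gen2 ?pnatr_eq0.
rewrite e1 e2 /average -/(A n); apply/andP; split; apply: ler_pM => //.
- exact: Amono.
- by rewrite lef_pV2 ?posrE ?ltr0n// ?ler_nat// expn_gt0.
- exact: Amono.
- by rewrite lef_pV2 ?posrE ?ltr0n// ?ler_nat// expn_gt0.
Qed.

End Cesaro.

Section LawOfLargeNumbers.
Context {d} {Omega : measurableType d} {R : realType} (P : probability Omega R).

Let inverse_square_sum n : \sum_(k < n) ((k.+1 ^ 2)%N%:R : R)^-1 <= 2.
Proof.
(* The subtracted [m.+1%:R^-1] makes the induction work: it shrinks by more than the added inverse
   square. *)
suff H m : \sum_(k < m.+1) ((k.+1 ^ 2)%N%:R : R)^-1 <= 2 - m.+1%:R^-1.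
  case: n => [|n]; first by rewrite big_ord0.
  by apply: (le_trans (H n)); rewrite gerBl.
elim: m => [|m IH]; first by rewrite big_ord_recr big_ord0 /= add0r exp1n invr1; lra.
rewrite big_ord_recr /=; apply: (le_trans (lerD IH (lexx _))).
set a : R := m.+1%:R; have a0 : 0 < a by rewrite ltr0n.
have -> : ((m.+2 ^ 2)%N%:R : R) = (a + 1) ^+ 2 by rewrite natrX natr1.
have -> : m.+2%:R = a + 1 by rewrite natr1.
rewrite -subr_ge0.
have -> : 2 - (a + 1)^-1 - (2 - a^-1 + (a + 1) ^- 2) = (a * (a + 1) ^+ 2)^-1.
  by field; rewrite !gt_eqF// addr_gt0.
by rewrite invr_ge0 mulr_ge0 ?sqr_ge0// ltW.
Qed.

(* Along squares the second moments of [Z n / n] are summable. *)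
Lemma ae_square_subsequence (Z : nat -> Omega -> R) (C : R) :
  (forall n, measurable_fun setT (Z n)) ->
  (forall n, integrable_var P (fun w => Z n w ^+ 2)) ->
  (forall n, Ex P (fun w => Z n w ^+ 2) <= C * n%:R) ->
  {ae P, forall w, Z (n.+1 ^ 2)%N w / (n.+1 ^ 2)%N%:R @[n --> \oo] --> (0 : R)}.
Proof.
move=> mZ iZ ZC.
have C0 : 0 <= C.
  have := ZC 1%N; rewrite mulr1; apply: le_trans; apply: Ex_ge0 => w; exact: sqr_ge0.
pose a n : R := (n.+1 ^ 2)%N%:R; have a0 n : 0 < a n by rewrite ltr0n expn_gt0.
(* [X n] is the square of [Z / n] at the [n]-th square. Its mean is at most [C / (n + 1)^2], so the
   series of the [X n] has finite mean. It is therefore finite almost surely, and its terms tend to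
   0. *)
pose X n w : R := (a n ^+ 2)^-1 * Z (n.+1 ^ 2)%N w ^+ 2.
have X0 n w : 0 <= X n w by rewrite mulr_ge0 ?invr_ge0 ?sqr_ge0.
have iX n : integrable_var P (X n) by exact: integrable_varZ.
have mX n : measurable_fun setT (X n) by exact: integrable_var_measurable (iX n).
have ExX n : Ex P (X n) <= C * (a n)^-1.
  rewrite ExZ//; apply: (@le_trans _ _ ((a n ^+ 2)^-1 * (C * a n))).
    by apply: ler_wpM2l; [rewrite invr_ge0 sqr_ge0|exact: ZC].
  by rewrite le_eqVlt; apply/orP; left; apply/eqP; field; rewrite gt_eqF.
have intS : (\int[P]_w (\sum_(n <oo) (X n w)%:E) <= (C * 2)%:E)%E.
  rewrite integral_nneseries//; last 2 first.
    by move=> n; exact/measurable_EFinP.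
    by move=> n w _; rewrite lee_fin.
  apply: lime_le; first by apply: is_cvg_nneseries => n _ _; apply: integral_ge0 => w _; rewrite lee_fin.
  apply: nearW => n; under eq_bigr do rewrite ExE//.
  rewrite sumEFin lee_fin big_mkord; apply: (@le_trans _ _ (\sum_(k < n) C * (a k)^-1)).
    by apply: ler_sum => k _; exact: ExX.
  by rewrite -mulr_sumr; apply: ler_wpM2l => //; exact: inverse_square_sum.
have iS : P.-integrable setT (fun w => (\sum_(n <oo) (X n w)%:E)%E).
  apply/integrableP; split.
    apply: ge0_emeasurable_sum => [n w _ _|n _]; first by rewrite lee_fin.
    exact/measurable_EFinP.
  apply: (@le_lt_trans _ _ (C * 2)%:E); last exact: ltry.
  apply: le_trans intS; rewrite le_eqVlt; apply/orP; left; apply/eqP.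
  apply: eq_integral => w _; rewrite gee0_abs//.
  by apply: nneseries_ge0 => n _ _; rewrite lee_fin.
have := integrable_ae measurableT iS; apply: filterS => w /(_ I) finS.
have Sfin : (\sum_(n <oo) (X n w)%:E < +oo)%E.
  by move: finS; rewrite fin_numElt => /andP[].
have X_cvg : X n w @[n --> \oo] --> (0 : R).
  have tail := nneseries_tail_cvg Sfin (fun n _ => X0 n w).
  suff : (X n w)%:E @[n --> \oo] --> 0%:E by move=> /fine_cvgP[_].
  apply: (squeeze_cvge _ (cvg_cst 0%E) tail); apply: nearW => n; apply/andP; split.
    by rewrite lee_fin.
  have := @nneseries_lim_ge R (fun k => (X k w)%:E) xpredT n n.+1.
  by rewrite big_nat1; apply=> k _ _; rewrite lee_fin.
have ->  : (fun n => Z (n.+1 ^ 2)%N w / (n.+1 ^ 2)%N%:R) = (fun n => Z (n.+1 ^ 2)%N w / a n) by [].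
apply/cvgr0Pnorm_lt => e e0.
have e20 : 0 < e ^+ 2 by rewrite exprn_gt0.
move/cvgr0Pnorm_lt : X_cvg => /(_ _ e20); apply: filterS => n.
rewrite ger0_norm// /X => lt.
have : `|Z (n.+1 ^ 2)%N w / a n| ^+ 2 < e ^+ 2.
  by apply: le_lt_trans lt; rewrite real_normK ?num_real// expr_div_n mulrC.
by rewrite ltr_pXn2r ?nnegrE// ltW.
Qed.

Section Martingale.
Variables (U V : nat -> Omega -> R) (G : nat -> set_system Omega) (C1 C2 : R).
Hypotheses (Gm : forall k, G k `<=` measurable) (GS : forall k, G k `<=` <<s G k.+1 >>)
  (mU : forall k, measurable_for (G k) (U k)) (mV : forall k, measurable_for (G k.+1) (V k))
  (indep : forall k A (B : set R), <<s G k >> A -> measurable B ->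
    P (A `&` V k @^-1` B) = (P A * P (V k @^-1` B))%E)
  (iU : forall k, integrable_var P (fun w => U k w ^+ 2))
  (EU : forall k, Ex P (fun w => U k w ^+ 2) <= C1)
  (iV : forall k, integrable_var P (fun w => V k w ^+ 2))
  (EV : forall k, Ex P (fun w => V k w ^+ 2) <= C2)
  (EV0 : forall k, Ex P (V k) = 0).

Let Mn n w := \sum_(k < n) U k w * V k w.

Let GSle m n : (m <= n)%N -> <<s G m >> `<=` <<s G n >>.
Proof.
elim: n => [|n IH]; first by rewrite leqn0 => /eqP ->.
rewrite leq_eqVlt => /predU1P[->//|/IH H] A /H; exact: (sigma_sub _ _ (GS n)).
Qed.

Let mM n : measurable_for (G n) (Mn n).
Proof.
elim: n => [|n IH].
  rewrite (_ : Mn 0 = fun=> 0); first exact: measurable_for_cst.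
  by apply/funext => w; rewrite /Mn big_ord0.
rewrite (_ : Mn n.+1 = fun w => Mn n w + U n w * V n w).
  apply: measurable_forD; first by move=> B mB; apply: (GSle n); [|exact: IH].
  by apply: measurable_forM => //; move=> B mB; apply: (GSle n); [|exact: mU].
by apply/funext => w; rewrite /Mn big_ord_recr.
Qed.

Let meas k (X : Omega -> R) : measurable_for (G k) X -> measurable_fun setT X.
Proof. by apply: measurable_for_measurable. Qed.

(* Martingale increments are orthogonal. *)
Lemma martingale_sq n : integrable_var P (fun w => Mn n w ^+ 2) /\
  Ex P (fun w => Mn n w ^+ 2) <= C1 * C2 * n%:R.
Proof.
have C10 : 0 <= C1 by apply: le_trans (EU 0); apply: Ex_ge0 => w; exact: sqr_ge0.
elim: n => [|n [IH1 IH2]].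
  have -> : (fun w => Mn 0 w ^+ 2) = fun=> 0.
    by apply/funext => w; rewrite /Mn big_ord0 expr0n.
  by rewrite Ex_cst mulr0; split => //; exact: integrable_var_cst.
have mMn := meas n _ (mM n); have mUn := meas n _ (mU n); have mVn := meas n.+1 _ (mV n).
have indV (X : Omega -> R) : measurable_for (G n) X -> independent_vars P X (V n).
  by move=> mX A B mA mB; apply: indep => //; exact: mX.
have iVn : integrable_var P (V n) by exact: integrable_var_sq.
have iMU : integrable_var P (fun w => Mn n w * U n w) by exact: integrable_var_mul.
have [iMUV EMUV] : integrable_var P (fun w => Mn n w * U n w * V n w) /\
    Ex P (fun w => Mn n w * U n w * V n w) = 0.
  have [? ->] := independent_prod P _ _ (indV _ (measurable_forM _ _ _ (mM n) (mU n))) iMU iVn.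
  by rewrite EV0 mulr0.
have msq : measurable_fun setT (fun x : R => x ^+ 2) by exact: exprn_measurable.
have [iUV EUV] := independent_prod P _ _
  (independent_vars_comp P _ _ _ _ msq msq (indV _ (mU n))) (iU n) (iV n).
have E : (fun w => Mn n.+1 w ^+ 2) =
    fun w => (Mn n w ^+ 2 + 2 * (Mn n w * U n w * V n w)) + U n w ^+ 2 * V n w ^+ 2.
  by apply/funext => w; rewrite /Mn big_ord_recr /= -/(Mn n w); ring.
have i2 : integrable_var P (fun w => 2 * (Mn n w * U n w * V n w)) by exact: integrable_varZ.
have i3 : integrable_var P (fun w => Mn n w ^+ 2 + 2 * (Mn n w * U n w * V n w)).
  exact: integrable_varD.
rewrite E; split; first exact: integrable_varD.
rewrite (ExD _ _ _ i3 iUV) (ExD _ _ _ IH1 i2) (ExZ _ _ _ iMUV) EMUV mulr0 addr0.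
rewrite -natr1 mulrDr mulr1; apply: lerD => //.
rewrite [leLHS]EUV; apply: ler_pM; [| |exact: EU|exact: EV];
  by apply: Ex_ge0 => w; exact: sqr_ge0.
Qed.

Lemma martingale_lln : {ae P, forall w,
  square_subsequence (average (fun k => U k w * V k w)) @ \oo --> (0 : R)}.
Proof.
apply: (ae_square_subsequence Mn (C1 * C2)).
- by move=> n; exact: meas (mM n).
- by move=> n; have [] := martingale_sq n.
- by move=> n; have [] := martingale_sq n.
Qed.

End Martingale.

End LawOfLargeNumbers.

(** * Averages over the cycles *)

Section SameLaw.
Context {d} {Omega : measurableType d} {d'} {Omega' : measurableType d'} {R : realType}
  (P : probability Omega R) (Q : probability Omega' R).

Lemma same_law_integral (X : Omega -> R) (Y : Omega' -> R) (f : R -> R) :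
  measurable_fun setT X -> measurable_fun setT Y -> measurable_fun setT f ->
  (forall x, 0 <= f x) ->
  (forall A, measurable A -> P (X @^-1` A) = Q (Y @^-1` A)) ->
  (\int[P]_w (f (X w))%:E = \int[Q]_w (f (Y w))%:E)%E.
Proof.
move=> mX mY mf f0 XY.
pose X' : {mfun Omega >-> R} := HB.pack X (isMeasurableFun.Build _ _ _ _ X mX).
pose Y' : {mfun Omega' >-> R} := HB.pack Y (isMeasurableFun.Build _ _ _ _ Y mY).
transitivity (\int[distribution P X']_x (f x)%:E)%E.
  by rewrite ge0_integral_distribution//; exact/measurable_EFinP.
transitivity (\int[distribution Q Y']_x (f x)%:E)%E.
  by apply: eq_measure_integral => A mA _; exact: XY.
by rewrite ge0_integral_distribution//; exact/measurable_EFinP.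
Qed.

Lemma same_tails_law (X : Omega -> R) (Y : Omega' -> R) :
  measurable_fun setT X -> measurable_fun setT Y ->
  (forall x, P [set w | x < X w] = Q [set w | x < Y w]) ->
  forall A, measurable A -> P (X @^-1` A) = Q (Y @^-1` A).
Proof.
move=> mX mY XY A mA.
pose X' : {mfun Omega >-> R} := HB.pack X (isMeasurableFun.Build _ _ _ _ X mX).
pose Y' : {mfun Omega' >-> R} := HB.pack Y (isMeasurableFun.Build _ _ _ _ Y mY).
pose G : set_system R := [set A | exists x, A = `]x, +oo[%classic].
have : distribution P X' A = distribution Q Y' A; last exact.
apply: (measure_unique G (fun k : nat => `]- k%:R, +oo[%classic)) => //.
- exact: RGenOInfty.measurableE.
- move=> _ _ [x ->] [y ->]; exists (Num.max x y).
  by apply/seteqP; split => z /=; rewrite !in_itv/= !andbT gt_max; [case=> -> ->|move/andP].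
- by move=> k; exists (- k%:R).
- apply/seteqP; split => // x _.
  exists (Num.trunc `|x|).+1 => //=; rewrite in_itv/= andbT ltrNl.
  apply: (le_lt_trans (ler_norm _)); rewrite normrN.
  by have /andP[] := Num.Theory.truncn_itv (normr_ge0 x).
- move=> _ [x ->].
  have E1 : P (X @^-1` `]x, +oo[) = Q (Y @^-1` `]x, +oo[) by rewrite -!tail_preimage XY.
  exact: E1.
- by move=> k; apply: (le_lt_trans (probability_le1 _ _)); [exact: measurable_itv|rewrite ltry].
Qed.

End SameLaw.

(** * Moments of exponential variables *)

Section ExponentialMoments.
Context {d} {Omega : measurableType d} {R : realType} (P : probability Omega R).
Variables (rate : R) (X : Omega -> R).
Hypotheses (rate_gt0 : 0 < rate) (mX : measurable_fun setT X) (X0 : forall w, 0 <= X w)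
  (tailX : forall x, 0 <= x -> P [set w | x < X w] = (expR (- rate * x))%:E).

(** The mean of a nonnegative variable is the integral of its tail, and here the tail is the density
    divided by [rate]. *)
Lemma exponential_integral : (\int[P]_w (X w)%:E = (rate^-1)%:E)%E.
Proof.
pose X' : {mfun Omega >-> R} := HB.pack X (isMeasurableFun.Build _ _ _ _ X mX).
have := @ge0_expectation_ccdf _ _ _ P X' X0; rewrite expectation_def => ->.
have mpdf D : measurable_fun D (EFin \o exponential_pdf rate).
  by apply/measurable_EFinP; apply: measurable_funTS; exact: measurable_exponential_pdf.
transitivity (\int[lebesgue_measure]_(x in `[0%R, +oo[)
    ((rate^-1)%:E * (exponential_pdf rate x)%:E))%E.
  apply: eq_integral => x; rewrite inE /= in_itv/= andbT => x0.
  rewrite exponential_pdfE// -EFinM mulKf ?gt_eqF// -tailX//.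
  by congr (P _); rewrite tail_preimage.
rewrite ge0_integralZl; [|exact: measurable_itv|exact: mpdf|
  by move=> x _; rewrite lee_fin exponential_pdf_ge0// ltW|by rewrite lee_fin invr_ge0 ltW].
rewrite -integral_itv_obnd_cbnd; last exact: mpdf.
by have := exponential_prob_gt rate 0 rate_gt0 (lexx _); rewrite /exponential_prob mulr0 expR0 => ->; rewrite mule1.
Qed.

Lemma exponential_integrable : integrable_var P X.
Proof.
apply/integrableP; split; first exact/measurable_EFinP.
under eq_integral do rewrite /= ger0_norm//.
by rewrite exponential_integral ltry.
Qed.

Lemma exponential_mean : Ex P X = rate^-1.
Proof. by rewrite /Ex exponential_integral. Qed.

Let pow4_le_expR (y : R) : 0 <= y -> y ^+ 4 <= 4 ^+ 4 * expR y.
Proof.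
move=> y0; have y4 : 0 <= y / 4 by rewrite divr_ge0.
have -> : expR y = expR (y / 4) ^+ 4.
  by rewrite -expRM_natl; congr expR; rewrite -mulr_natl; field.
rewrite -exprMn lerXn2r ?nnegrE ?mulr_ge0 ?expR_ge0//.
by have := expR_ge1Dx (y / 4); lra.
Qed.

(** [X ^+ 4] is dominated by 1 plus the series of [(n + 2)^4] times the indicator of [n < X]: when
    [X > 1], the term with [n] one less than the integer part of [X] already suffices. The means of
    the terms are bounded by a geometric series. *)
Lemma exponential_fourth_moment : integrable_var P (fun w => X w ^+ 4).
Proof.
pose q : R := expR (- (rate / 2)).
have q0 : 0 < q by exact: expR_gt0.
have q1 : q < 1 by rewrite -expR0 ltr_expR oppr_lt0 divr_gt0.
(* From [y ^+ 4 <= 4 ^+ 4 * expR y] at [y = rate * (n + 2) / 2] one gets [(n + 2)^4 <= c * expR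
   (rate * (n + 2) / 2)]. Half of the decay of the tail absorbs this exponential; the other half
   leaves the ratio [q], and the 2 in [n + 2] the factor [expR rate]. *)
pose c : R := (8 / rate) ^+ 4.
have c0 : 0 <= c by rewrite exprn_ge0// divr_ge0// ltW.
pose K : R := c * expR rate.
have K0 : 0 <= K by rewrite mulr_ge0// expR_ge0.
have bound n : (n.+2%:R : R) ^+ 4 * expR (- rate * n%:R) <= K * q ^+ n.
  have y0 : 0 <= rate * n.+2%:R / 2 by rewrite divr_ge0// mulr_ge0// ltW.
  have := pow4_le_expR _ y0.
  have -> : (rate * n.+2%:R / 2) ^+ 4 = (rate / 8 * 4) ^+ 4 * n.+2%:R ^+ 4.
    by rewrite -exprMn; congr (_ ^+ 4); field.
  rewrite exprMn mulrAC (mulrC _ (4 ^+ 4)) -mulrA ler_pM2l ?exprn_gt0// => le.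
  rewrite /K /q -expRM_natl.
  have -> : (n.+2%:R : R) ^+ 4 = c * ((rate / 8) ^+ 4 * n.+2%:R ^+ 4).
    rewrite mulrA -exprMn; have -> : 8 / rate * (rate / 8) = 1 by field; rewrite gt_eqF.
    by rewrite expr1n mul1r.
  rewrite -(mulrA c) -(mulrA c); apply: ler_wpM2l => //.
  apply: (@le_trans _ _ (expR (rate * n.+2%:R / 2) * expR (- rate * n%:R))).
    by apply: ler_wpM2r; [exact: expR_ge0|rewrite -(mulrA rate)].
  rewrite -!expRD ler_expR.
  have -> : n.+2%:R = n%:R + 2 :> R by rewrite -addn2 natrD.
  by rewrite [leLHS](_ : _ = rate + n%:R * - (rate / 2))//; field.
pose f n w : R := n.+2%:R ^+ 4 * \1_[set w | n%:R < X w] w.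
have mset n : measurable [set w | n%:R < X w].
  by exact: measurable_tail.
have f0 n w : 0 <= f n w by rewrite mulr_ge0 ?exprn_ge0.
have mf n : measurable_fun setT (f n).
  by apply: measurable_funM; [exact: measurable_cst|exact: measurable_indic].
have geom n : \sum_(k < n) q ^+ k <= (1 - q)^-1.
  have q10 : 0 < 1 - q by rewrite subr_gt0.
  rewrite -[leRHS]mul1r ler_pdivlMr// -[leLHS]opprK -mulrN opprB.
  have := subrX1 q n; rewrite mulrC => <-.
  by rewrite opprB gerBl exprn_ge0// ltW.
have intf : (\int[P]_w (\sum_(n <oo) (f n w)%:E) <= (K * (1 - q)^-1)%:E)%E.
  rewrite integral_nneseries//; last 2 first.
    by move=> n; exact/measurable_EFinP.
    by move=> n w _; rewrite lee_fin.
  apply: lime_le; first by apply: is_cvg_nneseries => n _ _; apply: integral_ge0 => w _; rewrite lee_fin.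
  apply: nearW => n.
  have E k : (\int[P]_w (f k w)%:E = (k.+2%:R ^+ 4 * expR (- rate * k%:R))%:E)%E.
    rewrite /f; under eq_integral do rewrite EFinM.
    rewrite ge0_integralZl; [|exact: measurableT|
      by apply/measurable_EFinP; exact: measurable_indic|by move=> w _; rewrite lee_fin|
      by rewrite lee_fin exprn_ge0].
    by rewrite integral_indic// setIT [RHS]EFinM; congr (_ * _)%E; exact: tailX.
  under eq_bigr do rewrite E.
  rewrite sumEFin lee_fin big_mkord; apply: (@le_trans _ _ (\sum_(k < n) K * q ^+ k)).
    by apply: ler_sum => k _; exact: bound.
  by rewrite -mulr_sumr; apply: ler_wpM2l.
apply/integrableP; split.
  by apply/measurable_EFinP; exact: measurable_funX.
apply: (@le_lt_trans _ _ (\int[P]_w (1 + \sum_(n <oo) (f n w)%:E))%E).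
  apply: ge0_le_integral => //.
  - by apply/measurable_EFinP; apply: measurableT_comp => //; exact: measurable_funX.
  - apply: emeasurable_funD => //; apply: ge0_emeasurable_sum => [n w _ _|n _]; first by rewrite lee_fin.
    exact/measurable_EFinP.
  - move=> w _ /=; rewrite ger0_norm ?exprn_ge0//.
    have S0 : (0 <= \sum_(n <oo) (f n w)%:E)%E.
      by apply: nneseries_ge0 => n _ _; rewrite lee_fin.
    have [X1|X1] := leP (X w) 1.
      by apply: (@le_trans _ _ 1%:E); [rewrite lee_fin exprn_ile1|rewrite leeDl].
    have := @nneseries_lim_ge R (fun k => (f k w)%:E) xpredT 0 (Num.trunc (X w)).
    pose m := (Num.trunc (X w)).-1.
    have tX : (0 < Num.trunc (X w))%N by rewrite Num.Theory.truncn_gt0 ltW.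
    have /andP[t1 t2] := Num.Theory.truncn_itv (X0 w).
    move=> H; apply: (@le_trans _ _ (\sum_(n <oo) (f n w)%:E)%E); last by rewrite leeDr.
    apply: le_trans (H _); last by move=> k _ _; rewrite lee_fin.
    rewrite sumEFin lee_fin -[in leRHS](prednK tX) big_nat_recr//= -/m.
    apply: (@le_trans _ _ (f m w)).
      rewrite /f indicE mem_set/=; last first.
        by apply: lt_le_trans t1; rewrite ltr_nat /m prednK.
      rewrite mulr1 lerXn2r ?nnegrE// ltW//.
      by rewrite /m prednK.
    by rewrite lerDr sumr_ge0.
rewrite ge0_integralD//; last 2 first.
- by move=> w _; apply: nneseries_ge0 => n _ _; rewrite lee_fin.
- apply: ge0_emeasurable_sum => [n w _ _|n _]; first by rewrite lee_fin.
  exact/measurable_EFinP.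
rewrite lte_add_pinfty//; last by apply: le_lt_trans intf _; rewrite ltry.
by rewrite integral_cst//= probability_setT mule1 ltry.
Qed.

Lemma exponential_second_moment : integrable_var P (fun w => X w ^+ 2).
Proof.
apply: integrable_var_sq; first exact: measurable_funX.
have -> : (fun w => (X w ^+ 2) ^+ 2) = fun w => X w ^+ 4.
  by apply/funext => w; rewrite -exprM.
exact: exponential_fourth_moment.
Qed.

End ExponentialMoments.

Section CenteredLLN.
Context {d} {Omega : measurableType d} {R : realType} (P : probability Omega R).

Lemma centered_lln (U X : nat -> Omega -> R) (G : nat -> set_system Omega) (C1 C2 m : R) :
  (forall k, G k `<=` measurable) -> (forall k, G k `<=` <<s G k.+1 >>) ->
  (forall k, measurable_for (G k) (U k)) -> (forall k, measurable_for (G k.+1) (X k)) ->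
  (forall k A (B : set R), <<s G k >> A -> measurable B ->
    P (A `&` X k @^-1` B) = (P A * P (X k @^-1` B))%E) ->
  (forall k, integrable_var P (fun w => U k w ^+ 2)) ->
  (forall k, Ex P (fun w => U k w ^+ 2) <= C1) ->
  (forall k, integrable_var P (fun w => X k w ^+ 2)) ->
  (forall k, Ex P (fun w => X k w ^+ 2) <= C2) ->
  (forall k, Ex P (X k) = m) ->
  {ae P, forall w,
    square_subsequence (average (fun k => U k w * (X k w - m))) @ \oo --> (0 : R)}.
Proof.
move=> Gm GS mU mX indep iU EU iX2 EX2 EX.
have mX' k : measurable_fun setT (X k) by apply: measurable_for_measurable (mX k).
have iX k : integrable_var P (X k) by exact: integrable_var_sq.
have iXm k : integrable_var P (fun w => 2 * X k w ^+ 2 + 2 * m ^+ 2).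
  by apply: integrable_varD; [exact: integrable_varZ|exact: integrable_var_cst].
have le_sq k w : (X k w - m) ^+ 2 <= 2 * X k w ^+ 2 + 2 * m ^+ 2.
  by have := sqr_ge0 (X k w + m); lra.
have mV k : measurable_fun setT (fun w => X k w - m).
  by apply: measurable_funB => //; exact: measurable_cst.
have iV k : integrable_var P (fun w => (X k w - m) ^+ 2).
  apply: integrable_var_le (iXm k); first exact: measurable_funX.
  by move=> w; rewrite ger0_norm ?sqr_ge0.
apply: (martingale_lln P U (fun k w => X k w - m) G C1 (2 * C2 + 2 * m ^+ 2)) => //.
- by move=> k; apply: measurable_forB => //; exact: measurable_for_cst.
- move=> k A B GA mB.
  rewrite (_ : _ @^-1` B = X k @^-1` ((fun x => x - m) @^-1` B))//; apply: indep => //.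
  by rewrite -[_ @^-1` _]setTI; apply: measurable_funB => //; exact: measurable_cst.
- move=> k; apply: (le_trans (Ex_le P _ _ (iV k) (iXm k) (le_sq k))).
  have i1 : integrable_var P (fun w => 2 * X k w ^+ 2) by exact: integrable_varZ.
  rewrite (ExD P _ _ i1 (integrable_var_cst P _)) ExZ// Ex_cst.
  by rewrite lerD2r ler_pM2l.
- by move=> k; rewrite (ExD P _ _ (iX k) (integrable_var_cst P _)) Ex_cst EX subrr.
Qed.

End CenteredLLN.

Section AverageAlgebra.
Context {R : realType}.
Implicit Types (x y z : nat -> R) (a b l : R).

Lemma averageD x y n : average (fun k => x k + y k) n = average x n + average y n.
Proof. by rewrite /average big_split mulrDl. Qed.

Lemma averageZ a x n : average (fun k => a * x k) n = a * average x n.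
Proof. by rewrite /average -mulr_sumr mulrA. Qed.

Lemma cvg_averageD x y a b : average x @ \oo --> a -> average y @ \oo --> b ->
  average (fun k => x k + y k) @ \oo --> a + b.
Proof.
move=> xa yb; rewrite (_ : average _ = fun n => average x n + average y n).
  exact: cvgD.
by apply/funext => n; exact: averageD.
Qed.

Lemma cvg_averageZ c x a : average x @ \oo --> a ->
  average (fun k => c * x k) @ \oo --> c * a.
Proof.
move=> xa; rewrite (_ : average _ = fun n => c * average x n).
  by apply: cvgMr.
by apply/funext => n; exact: averageZ.
Qed.

Lemma cvg_average_cst a : average (fun=> a) @ \oo --> a.
Proof.
apply: (@cvg_trans _ ((fun=> a) @ \oo)); last exact: cvg_cst.
apply: near_eq_cvg; exists 1%N => // n /= n0.
by rewrite /average sumr_const card_ord -[a *+ n]mulr_natr mulfK// pnatr_eq0 -lt0n.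
Qed.

(** The difference [x - z] has no sign, so its average is controlled only along the squares. The
    limit is carried over to [x], which is nonnegative, and interpolated there. *)
Lemma cvg_average_compensated x z l : (forall k, 0 <= x k) ->
  average z @ \oo --> l ->
  square_subsequence (average (fun k => x k - z k)) @ \oo --> (0 : R) ->
  average x @ \oo --> l.
Proof.
move=> x0 zl xz; apply: cesaro_interpolation => //.
rewrite (_ : square_subsequence _ = fun n =>
  square_subsequence (average (fun k => x k - z k)) n + square_subsequence (average z) n).
  by rewrite -(add0r l); apply: cvgD => //; exact: cvg_square_subsequence.
apply/funext => n; rewrite /square_subsequence -averageD; congr (average _ _).
by apply/funext => k; rewrite subrK.
Qed.

End AverageAlgebra.

(* Each average is determined by a compensated (martingale) average; summing the
   recursion of [b] gives [kappa * average b] up to a boundary term. *)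
Lemma cycle_averages (R : realType) (E s B b : nat -> R) (e v kappa mE ms : R) :
  0 < kappa -> (forall k, 0 <= E k) -> (forall k, 0 <= s k) -> (forall k, 0 <= B k) ->
  (forall k, 0 <= b k) -> b 0%N = 0 ->
  (forall k, b k.+1 = s k + (1 - B k) * (b k + E k)) ->
  square_subsequence (average (fun k => 1 * (E k - e))) @ \oo --> (0 : R) ->
  square_subsequence (average (fun k => s k * (E k - e))) @ \oo --> (0 : R) ->
  square_subsequence (average (fun k => b k * (E k - e))) @ \oo --> (0 : R) ->
  square_subsequence (average (fun k => 1 * (s k - v))) @ \oo --> (0 : R) ->
  square_subsequence (average (fun k => b k * (s k - v))) @ \oo --> (0 : R) ->
  square_subsequence (average (fun k => 1 * (E k ^+ 2 - mE))) @ \oo --> (0 : R) ->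
  square_subsequence (average (fun k => 1 * (s k ^+ 2 - ms))) @ \oo --> (0 : R) ->
  square_subsequence (average (fun k => 1 * (B k - kappa))) @ \oo --> (0 : R) ->
  square_subsequence (average (fun k => (b k + E k) * (B k - kappa))) @ \oo --> (0 : R) ->
  b (n.+1 ^ 2)%N / (n.+1 ^ 2)%N%:R @[n --> \oo] --> (0 : R) ->
  [/\ average B @ \oo --> kappa,
      average (fun k => E k + s k) @ \oo --> e + v &
      average (fun k => b k * (E k + s k) + (E k + s k) ^+ 2 / 2) @ \oo -->
        (v + (1 - kappa) * e) / kappa * (e + v) + (mE + 2 * (e * v) + ms) / 2].
Proof.
move=> kappa0 E0 s0 B0 b0 b00 bS LE LsE LbE Ls Lbs LE2 Ls2 LB LbB Lb.
have comp (x z : nat -> R) (l : R) (w : nat -> R) : (forall k, 0 <= x k) -> average z @ \oo --> l ->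
    square_subsequence (average w) @ \oo --> (0 : R) -> (forall k, x k - z k = w k) ->
    average x @ \oo --> l.
  move=> x0 zl wl E'; apply: (cvg_average_compensated x z l x0 zl).
  by rewrite (_ : (fun k => x k - z k) = w)//; apply/funext.
have cB : average B @ \oo --> kappa.
  by apply: (comp _ _ _ _ B0 (cvg_average_cst kappa) LB) => k; rewrite mul1r.
have cE : average E @ \oo --> e.
  by apply: (comp _ _ _ _ E0 (cvg_average_cst e) LE) => k; rewrite mul1r.
have cs : average s @ \oo --> v.
  by apply: (comp _ _ _ _ s0 (cvg_average_cst v) Ls) => k; rewrite mul1r.
have cE2 : average (fun k => E k ^+ 2) @ \oo --> mE.
  by apply: (comp _ _ _ _ (fun k => sqr_ge0 (E k)) (cvg_average_cst mE) LE2) => k; rewrite mul1r.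
have cs2 : average (fun k => s k ^+ 2) @ \oo --> ms.
  by apply: (comp _ _ _ _ (fun k => sqr_ge0 (s k)) (cvg_average_cst ms) Ls2) => k; rewrite mul1r.
have csE : average (fun k => s k * E k) @ \oo --> e * v.
  by apply: (comp _ _ _ _ (fun k => mulr_ge0 (s0 k) (E0 k)) (cvg_averageZ e _ _ cs) LsE) => k; ring.
pose beta := (v + (1 - kappa) * e) / kappa.
have cb : average b @ \oo --> beta.
  apply: cesaro_interpolation => //.
  pose q n : R := b n / n%:R.
  have rec n : kappa * average b n = average s n + (1 - kappa) * average E n
      - average (fun k => (b k + E k) * (B k - kappa)) n - q n.
    have tele : \sum_(k < n) b k.+1 = \sum_(k < n) b k + b n.
      elim: n => [|n IH]; first by rewrite !big_ord0 b00 addr0.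
      by rewrite !big_ord_recr /= IH.
    have : \sum_(k < n) b k.+1 = \sum_(k < n) s k + (1 - kappa) * \sum_(k < n) b k
        + (1 - kappa) * \sum_(k < n) E k - \sum_(k < n) (b k + E k) * (B k - kappa).
      rewrite !mulr_sumr -!big_split -sumrB /=; apply: eq_bigr => k _.
      by rewrite bS; ring.
    rewrite tele => eqn; rewrite /average /q.
    have -> : b n = \sum_(k < n) s k + (1 - kappa) * \sum_(k < n) b k
        + (1 - kappa) * \sum_(k < n) E k - \sum_(k < n) (b k + E k) * (B k - kappa) - \sum_(k < n) b k.
      by rewrite -eqn addrAC subrr add0r.
    ring.
  have -> : square_subsequence (average b) = fun n => kappa^-1 *
      (square_subsequence (average s) n + (1 - kappa) * square_subsequence (average E) n
      - square_subsequence (average (fun k => (b k + E k) * (B k - kappa))) n - square_subsequence q n).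
    by apply/funext => n; rewrite /square_subsequence -rec mulKf// gt_eqF.
  have -> : beta = kappa^-1 * (v + (1 - kappa) * e - 0 - 0).
    by rewrite /beta !subr0 mulrC.
  apply: cvgMr; apply: cvgB; last exact: Lb.
  apply: cvgB => //; apply: cvgD; first exact: cvg_square_subsequence.
  by apply: cvgMr; exact: cvg_square_subsequence.
have cbE : average (fun k => b k * E k) @ \oo --> e * beta.
  by apply: (comp _ _ _ _ (fun k => mulr_ge0 (b0 k) (E0 k)) (cvg_averageZ e _ _ cb) LbE) => k; ring.
have cbs : average (fun k => b k * s k) @ \oo --> v * beta.
  by apply: (comp _ _ _ _ (fun k => mulr_ge0 (b0 k) (s0 k)) (cvg_averageZ v _ _ cb) Lbs) => k; ring.
split => //; first exact: cvg_averageD.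
rewrite (_ : (fun k => _) = fun k => (b k * E k + b k * s k) +
  (2^-1 * E k ^+ 2 + (s k * E k + 2^-1 * s k ^+ 2))); last first.
  by apply/funext => k; field.
rewrite -/beta (_ : _ + _ = (e * beta + v * beta) + (2^-1 * mE + (e * v + 2^-1 * ms))); last first.
  by field.
by do !apply: cvg_averageD => //; exact: cvg_averageZ.
Qed.

Lemma exponential_sequence_law d (Omega : measurableType d) (R : realType)
    (P : probability Omega R) (rate : R) (X : nat -> Omega -> R) (f : R -> R) k :
  (forall k, measurable_fun setT (X k)) -> (forall k w, 0 <= X k w) ->
  (forall k x, 0 <= x -> P [set w | x < X k w] = (expR (- rate * x))%:E) ->
  measurable_fun setT f -> (forall x, 0 <= f x) ->
  Ex P (fun w => f (X k w)) = Ex P (fun w => f (X 0%N w)).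
Proof.
move=> mX X0 tX mf f0; congr fine; apply: same_law_integral => //.
apply: same_tails_law => // x; have [x0|x0] := leP 0 x; first by rewrite !tX.
have tail1 l : [set w | x < X l w] = setT.
  by apply/seteqP; split => // w _; exact: lt_le_trans (X0 l w).
by rewrite !tail1.
Qed.

Section CycleLimits.
Context {d} {Omega : measurableType d} {R : realType} (P : probability Omega R).
Variables (E s : nat -> Omega -> R) (B : nat -> set Omega)
  (H F : nat -> set_system Omega) (Lambda mu kappa : R).
Hypotheses (Lambda_gt0 : 0 < Lambda) (mu_gt0 : 0 < mu) (kappa_gt0 : 0 < kappa).
Hypotheses (Hm : forall k, H k `<=` measurable) (HS : forall k, H k `<=` <<s H k.+1 >>)
  (FS : forall k, F k `<=` <<s F k.+1 >>) (FH : forall k, F k `<=` <<s H k >>).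
Hypotheses (sH : forall k l, measurable_for (H k) (s l))
  (EH : forall k, measurable_for (H k.+1) (E k)) (BH : forall k, <<s H k.+1 >> (B k))
  (sF : forall k, measurable_for (F k.+1) (s k))
  (EF : forall k, measurable_for (F k.+1) (E k)) (BF : forall k, <<s F k.+1 >> (B k)).
Hypotheses
  (E_indep : forall k A (D : set R), <<s H k >> A -> measurable D ->
     P (A `&` E k @^-1` D) = (P A * P (E k @^-1` D))%E)
  (B_indep : forall k A, <<s H k `|` preimages (E k) >> A ->
     P (A `&` B k) = (P A * kappa%:E)%E)
  (s_indep : forall k A (D : set R), <<s F k >> A -> measurable D ->
     P (A `&` s k @^-1` D) = (P A * P (s k @^-1` D))%E).
Hypotheses (E_ge0 : forall k w, 0 <= E k w) (s_ge0 : forall k w, 0 <= s k w)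
  (E_tail : forall k x, 0 <= x -> P [set w | x < E k w] = (expR (- Lambda * x))%:E)
  (s_tail : forall k x, 0 <= x -> P [set w | x < s k w] = (expR (- mu * x))%:E).

Let Fm k : F k `<=` measurable.
Proof. by move=> A /FH; exact: (sigma_measurable _ (Hm k)). Qed.

Let mE k : measurable_fun setT (E k). Proof. by apply: measurable_for_measurable (EH k). Qed.
Let ms k : measurable_fun setT (s k). Proof. by apply: measurable_for_measurable (sH k k). Qed.
Let mB k : measurable (B k). Proof. by apply: (sigma_measurable _ _ _ (BH k)). Qed.

Let iE2 k : integrable_var P (fun w => E k w ^+ 2).
Proof. exact: exponential_second_moment Lambda_gt0 (mE k) (E_ge0 k) (E_tail k). Qed.
Let iss2 k : integrable_var P (fun w => s k w ^+ 2).
Proof. exact: exponential_second_moment mu_gt0 (ms k) (s_ge0 k) (s_tail k). Qed.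
Let iE k : integrable_var P (E k).
Proof. exact: exponential_integrable Lambda_gt0 (mE k) (E_ge0 k) (E_tail k). Qed.
Let iss k : integrable_var P (s k).
Proof. exact: exponential_integrable mu_gt0 (ms k) (s_ge0 k) (s_tail k). Qed.
Let ExE k : Ex P (E k) = Lambda^-1.
Proof. exact: exponential_mean Lambda_gt0 (mE k) (E_ge0 k) (E_tail k). Qed.
Let Exs k : Ex P (s k) = mu^-1.
Proof. exact: exponential_mean mu_gt0 (ms k) (s_ge0 k) (s_tail k). Qed.

Let mpow n : measurable_fun setT (fun x : R => x ^+ n). Proof. exact: exprn_measurable. Qed.

Let mpow22 : measurable_fun setT (fun x : R => (x ^+ 2) ^+ 2).
Proof. by apply: measurable_funX. Qed.

Let ExE2 k : Ex P (fun w => E k w ^+ 2) = Ex P (fun w => E 0 w ^+ 2).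
Proof. exact: (exponential_sequence_law _ _ _ P Lambda E _ k mE E_ge0 E_tail (mpow 2) (@sqr_ge0 R)). Qed.
Let Exs2 k : Ex P (fun w => s k w ^+ 2) = Ex P (fun w => s 0 w ^+ 2).
Proof. exact: (exponential_sequence_law _ _ _ P mu s _ k ms s_ge0 s_tail (mpow 2) (@sqr_ge0 R)). Qed.

Let pow22 (x : R) : (x ^+ 2) ^+ 2 = x ^+ 4. Proof. by rewrite -exprM. Qed.

Let iE4 k : integrable_var P (fun w => (E k w ^+ 2) ^+ 2).
Proof.
rewrite (_ : (fun w => _) = fun w => E k w ^+ 4); last by apply/funext => w; exact: pow22.
exact: exponential_fourth_moment Lambda_gt0 (mE k) (E_ge0 k) (E_tail k).
Qed.
Let is4 k : integrable_var P (fun w => (s k w ^+ 2) ^+ 2).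
Proof.
rewrite (_ : (fun w => _) = fun w => s k w ^+ 4); last by apply/funext => w; exact: pow22.
exact: exponential_fourth_moment mu_gt0 (ms k) (s_ge0 k) (s_tail k).
Qed.
Let ExE4 k : Ex P (fun w => (E k w ^+ 2) ^+ 2) = Ex P (fun w => (E 0 w ^+ 2) ^+ 2).
Proof.
exact: (exponential_sequence_law _ _ _ P Lambda E _ k mE E_ge0 E_tail mpow22 (fun x => sqr_ge0 (x ^+ 2))).
Qed.
Let Exs4 k : Ex P (fun w => (s k w ^+ 2) ^+ 2) = Ex P (fun w => (s 0 w ^+ 2) ^+ 2).
Proof.
exact: (exponential_sequence_law _ _ _ P mu s _ k ms s_ge0 s_tail mpow22 (fun x => sqr_ge0 (x ^+ 2))).
Qed.

Let indE k (X : Omega -> R) : measurable_for (H k) X -> independent_vars P X (E k).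
Proof. by move=> mX A D mA mD; apply: E_indep => //; exact: mX. Qed.

Let y k w := E k w + s k w.

Lemma cycle_mean k : integrable_var P (y k) /\ Ex P (y k) = Lambda^-1 + mu^-1.
Proof.
split; first exact: (integrable_varD P _ _ (iE k) (iss k)).
by rewrite [LHS](ExD P _ _ (iE k) (iss k)) ExE Exs.
Qed.

Let m2 := Ex P (fun w => E 0 w ^+ 2) + 2 * (Lambda^-1 * mu^-1) + Ex P (fun w => s 0 w ^+ 2).

Lemma cycle_second_moment k : integrable_var P (fun w => y k w ^+ 2) /\
  Ex P (fun w => y k w ^+ 2) = m2.
Proof.
have [isE EsE] := independent_prod P _ _ (indE k _ (sH k k)) (iss k) (iE k).
have yE : (fun w => y k w ^+ 2) =
    fun w => (E k w ^+ 2 + 2 * (s k w * E k w)) + s k w ^+ 2.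
  by apply/funext => w; rewrite /y; ring.
have i1 : integrable_var P (fun w => 2 * (s k w * E k w)) by exact: integrable_varZ.
have i2 : integrable_var P (fun w => E k w ^+ 2 + 2 * (s k w * E k w)) by exact: integrable_varD.
rewrite yE; split; first exact: integrable_varD.
rewrite (ExD _ _ _ i2 (iss2 k)) (ExD _ _ _ (iE2 k) i1) ExZ// EsE ExE2 Exs2 ExE Exs.
by rewrite /m2 (mulrC (mu^-1)).
Qed.

(* The age of process [j] just after a departure, starting from [0]. *)
Fixpoint residual_age k w : R :=
  if k is k'.+1 then s k' w + (1 - \1_(B k') w) * (residual_age k' w + E k' w) else 0.

Local Notation b := residual_age.

Let indic_sq k w : (\1_(B k) w : R) ^+ 2 = \1_(B k) w.
Proof. by rewrite indicE; case: (_ \in _); rewrite ?expr1n ?expr0n. Qed.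

Let indic01 k w : 0 <= (\1_(B k) w : R) <= 1.
Proof. by rewrite indicE; case: (_ \in _); rewrite ?lexx ?ler01. Qed.

Lemma residual_age_ge0 k w : 0 <= b k w.
Proof.
elim: k => //= k IH; apply: addr_ge0 => //; apply: mulr_ge0; last exact: addr_ge0.
by have /andP[_] := indic01 k w; rewrite subr_ge0.
Qed.

Lemma residual_age_past k : measurable_for (F k) (b k).
Proof.
elim: k => [|k IH]; first exact: measurable_for_cst.
apply: measurable_forD => //; apply: measurable_forM.
  by apply: measurable_forB; [exact: measurable_for_cst|exact: measurable_for_indic].
by apply: measurable_forD => //; exact: measurable_for_sub IH.
Qed.

Let bH k : measurable_for (H k) (b k).
Proof. exact: measurable_for_sub (residual_age_past k). Qed.

Let mb k : measurable_fun setT (b k).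
Proof. by apply: measurable_for_measurable (bH k). Qed.

Let PB k : P (B k) = kappa%:E.
Proof. by have := B_indep k setT (sigma_setT _); rewrite setTI probability_setT mul1e. Qed.

Let kappa_le1 : kappa <= 1.
Proof. by rewrite -lee_fin -(PB 0) probability_le1. Qed.

Let imark k : integrable_var P (\1_(B k) : Omega -> R).
Proof.
apply: (integrable_var_le _ _ (fun=> 1)); [exact: measurable_indic| |exact: integrable_var_cst].
by move=> w; have /andP[h0 h1] := indic01 k w; rewrite ger0_norm.
Qed.

Let Exmark k : Ex P (\1_(B k) : Omega -> R) = kappa.
Proof. by rewrite /Ex integral_indic// setIT; have := PB k => /= ->. Qed.

Let Bmeas k (D : set R) : measurable D ->
  <<s [set B k] >> ((\1_(B k) : Omega -> R) @^-1` D).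
Proof.
move=> mD; have := @measurable_for_indic _ _ R [set B k] (B k); apply => //.
exact: sub_sigma_algebra.
Qed.

Let mark_indep_var k A (D : set R) : <<s H k `|` preimages (E k) >> A -> measurable D ->
  P (A `&` (\1_(B k) : Omega -> R) @^-1` D) = (P A * P ((\1_(B k) : Omega -> R) @^-1` D))%E.
Proof.
move=> GA mD.
have mA : measurable A.
  by apply: (sigma_measurable _ _ _ GA) => C [/Hm//|]; exact: preimagesm.
rewrite setIC [RHS]muleC (prE P A)//.
apply: (indep_sigma P [set B k]) => //.
- by move=> _ ->.
- by move=> _ _ -> ->; rewrite /= setIid.
- exact: prE.
- by move=> _ ->; rewrite setIC B_indep// PB (prE P A)// muleC.
- exact: Bmeas.
Qed.

Let iy2 k : integrable_var P (fun w => y k w ^+ 2).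
Proof. by have [] := cycle_second_moment k. Qed.

Let m2_ge0 : 0 <= m2.
Proof. by have [_ <-] := cycle_second_moment 0; apply: Ex_ge0 => w; exact: sqr_ge0. Qed.

Let Cb : R := (1 + kappa^-1) * m2 / kappa ^+ 2.

(* The bound [Cb] is the fixed point of [x |-> (1 + kappa^-1) m2 + (1 - kappa^2) x],
   which dominates one step of the recursion by AM-GM. *)
Lemma residual_age_second_moment k : integrable_var P (fun w => b k w ^+ 2) /\
  Ex P (fun w => b k w ^+ 2) <= Cb.
Proof.
have K0 : 0 <= (1 + kappa^-1) by rewrite addr_ge0// invr_ge0 ltW.
elim: k => [|k [IH1 IH2]].
  rewrite (_ : (fun w => b 0 w ^+ 2) = fun=> 0); last by apply/funext => w; rewrite /= expr0n.
  split; first exact: integrable_var_cst.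
  by rewrite Ex_cst; apply: divr_ge0; [exact: mulr_ge0|exact: sqr_ge0].
pose c w : R := 1 - \1_(B k) w.
have [iBb EBb] : integrable_var P (fun w => b k w ^+ 2 * \1_(B k) w) /\
    Ex P (fun w => b k w ^+ 2 * \1_(B k) w) = Ex P (fun w => b k w ^+ 2) * kappa.
  rewrite -(Exmark k); apply: independent_prod => // A D mA mD.
  apply: mark_indep_var => //; rewrite (_ : _ @^-1` A = b k @^-1` ((fun x => x ^+ 2) @^-1` A))//.
  have : <<s H k >> (b k @^-1` ((fun x => x ^+ 2) @^-1` A)).
    by apply: bH; exact: preimage_measurable.
  by apply: sub_sigma_algebra2 => C; left.
(* If the packet is uninformative, AM-GM gives [(y + b)^2 <= (1 + kappa^-1) y^2 + (1 + kappa) b^2];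
   if it is informative, [b] drops out and [s <= y] suffices. The indicator is independent of [b],
   so in the mean the last term gets the factor [(1 + kappa)(1 - kappa)], a contraction. *)
pose g w : R := (1 + kappa^-1) * y k w ^+ 2 + ((1 + kappa) * b k w ^+ 2 + - (1 + kappa) * (b k w ^+ 2 * \1_(B k) w)).
have i1 : integrable_var P (fun w => (1 + kappa^-1) * y k w ^+ 2) by exact: integrable_varZ.
have i2 : integrable_var P (fun w => (1 + kappa) * b k w ^+ 2) by exact: integrable_varZ.
have i3 : integrable_var P (fun w => - (1 + kappa) * (b k w ^+ 2 * \1_(B k) w)) by exact: integrable_varZ.
have i4 := integrable_varD P _ _ i2 i3.
have ig : integrable_var P g by exact: integrable_varD.
have le w : b k.+1 w ^+ 2 <= g w.
  have b0 := residual_age_ge0 k w; have y0 : 0 <= y k w by rewrite addr_ge0.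
  have E0 := E_ge0 k w; have s0 := s_ge0 k w.
  have k0 := kappa_gt0; have kV : 0 < kappa^-1 by rewrite invr_gt0.
  have kkV : kappa * kappa^-1 = 1 by rewrite divff// gt_eqF.
  have key : (y k w + b k w) ^+ 2 <= (1 + kappa^-1) * y k w ^+ 2 + (1 + kappa) * b k w ^+ 2.
    have := sqr_ge0 (y k w - kappa * b k w) => sq.
    have : 0 <= kappa^-1 * (y k w - kappa * b k w) ^+ 2 by rewrite mulr_ge0// ltW.
    have -> : kappa^-1 * (y k w - kappa * b k w) ^+ 2 =
      kappa^-1 * y k w ^+ 2 - 2 * (kappa * kappa^-1) * (y k w * b k w) + (kappa * kappa^-1) * kappa * b k w ^+ 2 by ring.
    rewrite kkV; lra.
  rewrite /g /= indicE; case: (_ \in _) => /=.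
    rewrite subrr mul0r addr0 mulr1 mulNr subrr addr0.
    apply: (@le_trans _ _ (y k w ^+ 2)).
      by rewrite lerXn2r ?nnegrE// /y lerDr.
    by rewrite -[leLHS]mul1r; apply: ler_wpM2r; [exact: sqr_ge0|rewrite lerDl ltW].
  rewrite subr0 mul1r mulr0 mulr0 addr0.
  by have -> : s k w + (b k w + E k w) = y k w + b k w by rewrite /y; ring.
have mb2 : measurable_fun setT (fun w => b k.+1 w ^+ 2) by exact: measurable_funX.
have ib : integrable_var P (fun w => b k.+1 w ^+ 2).
  by apply: integrable_var_le ig => // w; rewrite ger0_norm ?sqr_ge0.
split => //; apply: (le_trans (Ex_le P _ _ ib ig le)).
rewrite (ExD P _ _ i1 i4) (ExD P _ _ i2 i3) !ExZ// EBb.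
have [_ ->] := cycle_second_moment k.
set x := Ex P _ in IH2 *.
have -> : (1 + kappa) * x + - (1 + kappa) * (x * kappa) = (1 - kappa ^+ 2) * x by ring.
apply: (@le_trans _ _ ((1 + kappa^-1) * m2 + (1 - kappa ^+ 2) * Cb)).
  rewrite lerD2l; apply: ler_wpM2l => //.
  by rewrite subr_ge0 expr_le1// ltW.
by rewrite le_eqVlt; apply/orP; left; apply/eqP; rewrite /Cb; field; rewrite gt_eqF.
Qed.

Let ib2 k : integrable_var P (fun w => b k w ^+ 2).
Proof. by have [] := residual_age_second_moment k. Qed.

(** The filtration for the marks: it also contains the current idle period, because the recursion
    multiplies the indicator of [B k] by [b k + E k]. *)
Let G k := H k `|` preimages (E k).

Let Gm k : G k `<=` measurable.
Proof. by move=> A [/Hm//|]; exact: preimagesm. Qed.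

Let EG k : measurable_for (G k) (E k).
Proof. by move=> D mD; apply: sub_sigma_algebra; right; exists D. Qed.

Let HG k : H k `<=` <<s G k >>.
Proof. by move=> A HA; apply: sub_sigma_algebra; left. Qed.

Let GS k : G k `<=` <<s G k.+1 >>.
Proof.
have H1 : <<s H k.+1 >> `<=` <<s G k.+1 >> by exact: (sigma_sub _ _ (HG k.+1)).
by move=> A [/HS/H1//|[D mD ->]]; apply: H1; exact: EH.
Qed.

Let isq1 (k : nat) : integrable_var P (fun w : Omega => (1 : R) ^+ 2).
Proof. exact: integrable_var_cst. Qed.

Let Exsq1 (k : nat) : Ex P (fun w : Omega => (1 : R) ^+ 2) <= 1.
Proof. by rewrite Ex_cst expr1n. Qed.

Let one : nat -> Omega -> R := fun _ _ => 1.

Lemma cycle_limits : {ae P, forall w,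
  [/\ average (fun k => \1_(B k) w : R) @ \oo --> kappa,
      average (fun k => y k w) @ \oo --> Lambda^-1 + mu^-1 &
      average (fun k => b k w * y k w + y k w ^+ 2 / 2) @ \oo -->
        (mu^-1 + (1 - kappa) * Lambda^-1) / kappa * (Lambda^-1 + mu^-1) + m2 / 2]}.
Proof.
have oneG (K : nat -> set_system Omega) k : measurable_for (K k) (one k) by exact: measurable_for_cst.
have lE (U : nat -> Omega -> R) C : (forall k, measurable_for (H k) (U k)) ->
    (forall k, integrable_var P (fun w => U k w ^+ 2)) ->
    (forall k, Ex P (fun w => U k w ^+ 2) <= C) ->
    {ae P, forall w, square_subsequence (average (fun k => U k w * (E k w - Lambda^-1))) @ \oo --> (0 : R)}.
  move=> mU iU EU; apply: (centered_lln P U E H C (Ex P (fun w => E 0 w ^+ 2))) => //.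
  by move=> k; rewrite ExE2.
have ls (U : nat -> Omega -> R) C : (forall k, measurable_for (F k) (U k)) ->
    (forall k, integrable_var P (fun w => U k w ^+ 2)) ->
    (forall k, Ex P (fun w => U k w ^+ 2) <= C) ->
    {ae P, forall w, square_subsequence (average (fun k => U k w * (s k w - mu^-1))) @ \oo --> (0 : R)}.
  move=> mU iU EU; apply: (centered_lln P U s F C (Ex P (fun w => s 0 w ^+ 2))) => //.
  by move=> k; rewrite Exs2.
have lB (U : nat -> Omega -> R) C : (forall k, measurable_for (G k) (U k)) ->
    (forall k, integrable_var P (fun w => U k w ^+ 2)) ->
    (forall k, Ex P (fun w => U k w ^+ 2) <= C) ->
    {ae P, forall w, square_subsequence (average (fun k => U k w * (\1_(B k) w - kappa))) @ \oo --> (0 : R)}.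
  move=> mU iU EU.
  have sqE k : (fun w => (\1_(B k) w : R) ^+ 2) = \1_(B k).
    by apply/funext => w; exact: indic_sq.
  apply: (centered_lln P U (fun k => \1_(B k) : Omega -> R) G C kappa) => //.
  - by move=> k; exact: (measurable_for_indic _ (B k) (sigma_sub _ _ (@HG k.+1) _ (BH k))).
  - by move=> k; rewrite sqE.
  - by move=> k; rewrite sqE Exmark.
have bound2 (X Y : nat -> Omega -> R) C D : (forall k, integrable_var P (fun w => X k w ^+ 2)) ->
    (forall k, integrable_var P (fun w => Y k w ^+ 2)) ->
    (forall k, measurable_fun setT (X k)) -> (forall k, measurable_fun setT (Y k)) ->
    (forall k, Ex P (fun w => X k w ^+ 2) <= C) -> (forall k, Ex P (fun w => Y k w ^+ 2) <= D) ->
    forall k, integrable_var P (fun w => (X k w + Y k w) ^+ 2) /\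
      Ex P (fun w => (X k w + Y k w) ^+ 2) <= 2 * C + 2 * D.
  move=> iX iY mX mY EX EY k.
  have le w : (X k w + Y k w) ^+ 2 <= 2 * X k w ^+ 2 + 2 * Y k w ^+ 2.
    by have := sqr_ge0 (X k w - Y k w); lra.
  have i1 : integrable_var P (fun w => 2 * X k w ^+ 2) by exact: integrable_varZ.
  have i2 : integrable_var P (fun w => 2 * Y k w ^+ 2) by exact: integrable_varZ.
  have i3 := integrable_varD P _ _ i1 i2.
  have i4 : integrable_var P (fun w => (X k w + Y k w) ^+ 2).
    apply: integrable_var_le i3; first by apply: measurable_funX; exact: measurable_funD.
    by move=> w; rewrite ger0_norm ?sqr_ge0.
  split => //; apply: (le_trans (Ex_le P _ _ i4 i3 le)).
  by rewrite (ExD P _ _ i1 i2) !ExZ// lerD// ler_pM2l.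
have leE2 k : Ex P (fun w => E k w ^+ 2) <= Ex P (fun w => E 0 w ^+ 2) by rewrite ExE2.
have les2 k : Ex P (fun w => s k w ^+ 2) <= Ex P (fun w => s 0 w ^+ 2) by rewrite Exs2.
have bE_sq := bound2 b E Cb (Ex P (fun w => E 0%N w ^+ 2)) ib2 iE2 mb mE
  (fun k => (residual_age_second_moment k).2) leE2.
have L1 := lE one 1 (oneG H) isq1 Exsq1.
have L2 := lE s _ (fun k => sH k k) iss2 les2.
have L3 := lE b _ bH ib2 (fun k => (residual_age_second_moment k).2).
have L4 := ls one 1 (oneG F) isq1 Exsq1.
have L5 := ls b _ residual_age_past ib2 (fun k => (residual_age_second_moment k).2).
have sqpre (K : nat -> set_system Omega) (X : nat -> Omega -> R) :
    (forall k A (D : set R), <<s K k >> A -> measurable D ->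
     P (A `&` X k @^-1` D) = (P A * P (X k @^-1` D))%E) ->
    (forall k A (D : set R), <<s K k >> A -> measurable D ->
     P (A `&` (fun w => X k w ^+ 2) @^-1` D) = (P A * P ((fun w => X k w ^+ 2)%R @^-1` D))%E).
  move=> ind k A D KA mD; apply: (ind k A ((fun x => x ^+ 2) @^-1` D)) => //.
  by exact: preimage_measurable.
have L6 : {ae P, forall w, square_subsequence (average
    (fun k => 1 * (E k w ^+ 2 - Ex P (fun w => E 0%N w ^+ 2)))) @ \oo --> (0 : R)}.
  apply: (centered_lln P one (fun k w => E k w ^+ 2) H 1 (Ex P (fun w => (E 0%N w ^+ 2) ^+ 2))) => //.
  - by move=> k; exact: (measurable_for_comp _ _ _ (mpow 2) (EH k)).
  - exact: sqpre.
  - by move=> k; rewrite ExE4.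
have L7 : {ae P, forall w, square_subsequence (average
    (fun k => 1 * (s k w ^+ 2 - Ex P (fun w => s 0%N w ^+ 2)))) @ \oo --> (0 : R)}.
  apply: (centered_lln P one (fun k w => s k w ^+ 2) F 1 (Ex P (fun w => (s 0%N w ^+ 2) ^+ 2))) => //.
  - by move=> k; exact: (measurable_for_comp _ _ _ (mpow 2) (sF k)).
  - exact: sqpre.
  - by move=> k; rewrite Exs4.
have L8 := lB one 1 (oneG G) isq1 Exsq1.
have bEG k : measurable_for (G k) (fun w => b k w + E k w).
  by apply: measurable_forD => //; exact: measurable_for_sub (@HG k) (bH k).
have L9 := lB (fun k w => b k w + E k w) _ bEG (fun k => (bE_sq k).1) (fun k => (bE_sq k).2).
(* The boundary term of the summed recursion. The second moments of [b] are bounded, hence of order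
   [n]; at [n = 0] the bound holds because [b] starts from 0. *)
have L10 : {ae P, forall w, b (n.+1 ^ 2)%N w / (n.+1 ^ 2)%N%:R @[n --> \oo] --> (0 : R)}.
  apply: (ae_square_subsequence P b Cb) => // -[|n].
    rewrite (_ : (fun w => b 0 w ^+ 2) = fun=> 0); last by apply/funext => w; rewrite /= expr0n.
    by rewrite Ex_cst mulr0.
  have [_ le] := residual_age_second_moment n.+1; apply: (le_trans le).
  have Cb0 : 0 <= Cb by apply: le_trans le; apply: Ex_ge0 => w; exact: sqr_ge0.
  by rewrite -[leLHS]mulr1; apply: ler_wpM2l => //; rewrite ler1n.
have conj (A1 A2 : Omega -> Prop) : {ae P, forall w, A1 w} -> {ae P, forall w, A2 w} ->
  {ae P, forall w, A1 w /\ A2 w} by apply: filterS2 => w; split.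
have := conj _ _ (conj _ _ (conj _ _ (conj _ _ L1 L2) (conj _ _ L3 L4)) (conj _ _ (conj _ _ L5 L6) (conj _ _ L7 L8)))
  (conj _ _ L9 L10).
apply: filterS => w [[[[? ?] [? ?]] [[? ?] [? ?]]] [? ?]].
apply: (@cycle_averages _ (E ^~ w) (s ^~ w) (fun k => \1_(B k) w) (b ^~ w) _ _ kappa) => // k.
exact: residual_age_ge0.
Qed.

End CycleLimits.

(** * The age along a sample path *)

Section RenewalReward.
Context {R : realType}.
Variables (y : nat -> R) (m : R).
Hypotheses (y_gt0 : forall k, 0 < y k) (m_gt0 : 0 < m)
  (cvg_y : average y @ \oo --> m).

Definition epoch n : R := \sum_(k < n) y k.

Lemma epochS n : epoch n.+1 = epoch n + y n.
Proof. exact: big_ord_recr. Qed.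

Lemma epoch_ge0 n : 0 <= epoch n.
Proof. by apply: sumr_ge0 => k _; exact: ltW. Qed.

Lemma averageE (x : nat -> R) n : \sum_(k < n) x k = average x n * n%:R.
Proof.
rewrite /average; case: n => [|n]; first by rewrite big_ord0 !mul0r.
by rewrite divfK// pnatr_eq0.
Qed.

Lemma epoch_unbounded t : exists n, t < epoch n.
Proof.
have m0 := m_gt0; have m2 : m / 2 < m by lra.
have [K _ HK] : \forall n \near \oo, m / 2 < average y n by exact: cvgr_gt cvg_y _ m2.
have m20 : 0 < m / 2 by lra.
pose n := maxn K (Num.bound (t / (m / 2))).
exists n; rewrite /epoch averageE.
have [t0|t0] := ltP t 0.
  by apply: (lt_le_trans t0); rewrite -averageE; exact: epoch_ge0.
have b0 : 0 <= t / (m / 2) by rewrite divr_ge0// ltW.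
have tb : t / (m / 2) < n%:R.
  apply: lt_le_trans (archi_boundP b0) _; rewrite ler_nat; exact: leq_maxr.
have n0 : 0 < (n%:R : R) by exact: le_lt_trans tb.
move: tb; rewrite ltr_pdivrMr// mulrC => /lt_trans; apply.
by rewrite ltr_pM2r//; apply: HK; exact: leq_maxl.
Qed.

Lemma epoch_point_process : point_process (fun n => epoch n.+1).
Proof.
split=> [|n|t]; first by rewrite epochS {1}/epoch big_ord0 add0r.
  by rewrite [ltRHS]epochS ltrDl.
have [[|n] tn] := epoch_unbounded t; last by exists n.
exists 0%N; apply: lt_trans tn _; by rewrite epochS ltrDl.
Qed.

(** The index shift drops [epoch 0 = 0] from the points, so that this is the number of cycles
    completed by time [t]. *)
Definition epoch_count t : nat := count_points (fun n => epoch n.+1) t.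

Lemma epoch_countP t : 0 <= t -> epoch (epoch_count t) <= t < epoch (epoch_count t).+1.
Proof.
move=> t0; rewrite (count_points_gt _ t epoch_point_process) andbT.
case E : (epoch_count t) => [|n]; first by rewrite /epoch big_ord0.
by apply: (count_points_le (fun n => epoch n.+1)); rewrite -/(epoch_count t) E.
Qed.

Lemma cvg_epoch_count : epoch_count t @[t --> +oo] --> \oo.
Proof.
move=> A [K _ HK]; have : \forall t \near +oo, epoch K <= t :> R.
  by apply: nbhs_pinfty_ge; exact: num_real.
apply: filterS => t Kt; apply: HK => /=.
have t0 : 0 <= t by apply: le_trans Kt; exact: epoch_ge0.
have /andP[_ lt] := epoch_countP _ t0.
rewrite leqNgt; apply/negP => nK; move: lt; rewrite ltNge => /negP; apply.
apply: le_trans Kt; rewrite /epoch -!(big_mkord xpredT) [leRHS](big_cat_nat _ nK)//=.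
by rewrite lerDl; apply: sumr_ge0 => k _; exact: ltW.
Qed.

Lemma cvg_ratio_succ : (n%:R / n.+1%:R : R) @[n --> \oo] --> (1 : R).
Proof.
have -> : (fun n => n%:R / n.+1%:R : R) = (fun n => 1 - harmonic n).
  apply/funext => n; rewrite /harmonic /= -[X in X - _](@divff _ n.+1%:R) ?pnatr_eq0//.
  by rewrite -[X in _ - X]mul1r -mulrBl -natr1 addrK.
by rewrite -[X in _ --> X]subr0; apply: cvgB; [exact: cvg_cst|exact: cvg_harmonic].
Qed.

(** During cycle [n], [(f t - c) / t] lies between the reward of [n] cycles over the length of
    [n + 1] and the reward of [n + 1] cycles over the length of [n]. Both quotients tend to [l / m].
    The constant [c] and the index [n0] allow for an irregular initial stretch. *)
Lemma renewal_reward (r : nat -> R) (l c : R) (f : R -> R) n0 :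
  (forall k, 0 <= r k) -> average r @ \oo --> l ->
  (forall n t, (n0 <= n)%N -> epoch n <= t < epoch n.+1 ->
    \sum_(k < n) r k <= f t - c <= \sum_(k < n.+1) r k) ->
  t^-1 * f t @[t --> +oo] --> l / m.
Proof.
move=> r0 rl fr.
have m0 : m != 0 by rewrite gt_eqF.
pose lo n := (\sum_(k < n) r k) / epoch n.+1.
pose hi n := (\sum_(k < n.+1) r k) / epoch n.
have shift (u : nat -> R) (a : R) : u @ \oo --> a -> u n.+1 @[n --> \oo] --> a.
  by rewrite -[X in X -> _]cvg_shiftS.
have clo : lo @ \oo --> l / m.
  have -> : lo = fun n => average r n * (n%:R / n.+1%:R) * (average y n.+1)^-1.
    apply/funext => n; rewrite /lo /epoch !averageE invfM; ring.
  rewrite -[X in X / m]mulr1; apply: cvgM; last by apply: cvgV => //; exact: shift.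
  by apply: cvgM => //; exact: cvg_ratio_succ.
have chi : hi @ \oo --> l / m.
  have -> : hi = fun n => average r n.+1 * (n%:R / n.+1%:R)^-1 * (average y n)^-1.
    apply/funext => n; rewrite /hi /epoch !averageE.
    by move: (average _ _) (average _ _) => a b; rewrite !invfM invrK; ring.
  rewrite -[X in X / m]mulr1 -[X in l * X]invr1; apply: cvgM; last by apply: cvgV.
  apply: cvgM; first exact: shift.
  by apply: cvgV; [exact: oner_neq0|exact: cvg_ratio_succ].
have cinv : t^-1 @[t --> +oo] --> (0 : R).
  apply/gtr0_cvgV0; last exact: cvg_id.
  by apply: nbhs_pinfty_gt; exact: num_real.
suff : t^-1 * (f t - c) @[t --> +oo] --> l / m.
  move=> H; rewrite (_ : (fun t => _) = fun t => t^-1 * (f t - c) + t^-1 * c).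
    by rewrite -[X in _ --> X]addr0 -(mul0r c); apply: cvgD => //; apply: cvgMl.
  by apply/funext => t; rewrite -mulrDr subrK.
apply: (squeeze_cvgr (f := lo \o epoch_count) (h := hi \o epoch_count)).
- have : \forall t \near +oo, epoch (maxn n0 1) <= t :> R.
    by apply: nbhs_pinfty_ge; exact: num_real.
  have : \forall t \near +oo, (maxn n0 1 <= epoch_count t)%N.
    by apply: (cvg_epoch_count [set n | (maxn n0 1 <= n)%N]); exists (maxn n0 1).
  apply: filterS2 => t nt te; set n := epoch_count t in nt *.
  have [n0n n1] : (n0 <= n)%N /\ (0 < n)%N by move: nt; rewrite geq_max => /andP[].
  have t0 : 0 <= t by apply: le_trans te; exact: epoch_ge0.
  have bt := epoch_countP _ t0; have /andP[fl fh] := fr _ _ n0n bt.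
  move/andP: bt => [tl th].
  have en : 0 < epoch n.
    by case: (n) n1 => // k _; rewrite epochS; apply: ltr_wpDl => //; exact: epoch_ge0.
  have tp : 0 < t by exact: lt_le_trans tl.
  rewrite /lo /hi /= -/n; apply/andP; split.
    rewrite [leRHS]mulrC; apply: ler_pM => //.
    + by apply: sumr_ge0.
    + by rewrite invr_ge0 epoch_ge0.
    + by rewrite lef_pV2 ?posrE ?ltW// (lt_trans tp).
  rewrite [leLHS]mulrC; apply: ler_pM => //.
  + by apply: le_trans fl; apply: sumr_ge0.
  + by rewrite invr_ge0 ltW.
  + by rewrite lef_pV2 ?posrE.
- exact: cvg_comp cvg_epoch_count clo.
- exact: cvg_comp cvg_epoch_count chi.
Qed.

End RenewalReward.

Section AgeIntegral.
Context {R : realType}.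
Notation leb := (@lebesgue_measure R).

Lemma integral_sub_cst (L a b : R) : a <= b ->
  (\int[leb]_(t in `[a, b[) (t - L)%:E = (((b - L) ^+ 2 - (a - L) ^+ 2) / 2)%:E)%E.
Proof.
rewrite le_eqVlt => /predU1P[->|ab].
  by rewrite set_itvco0 integral_set0 subrr mul0r.
have mf D : measurable_fun D (fun t : R => (t - L)%:E).
  by apply/measurable_EFinP; apply: measurable_funB => //; exact: measurable_cst.
rewrite integral_itv_bndo_bndc//.
pose F t : R := 2^-1 * (t - L) ^+ 2.
have dF (t : R) : is_derive t 1 F (t - L).
  rewrite /F; apply: is_derive_eq.
  by rewrite /GRing.scale/=; field.
have cF (t : R) : {for t, continuous F}.
  by apply: differentiable_continuous; apply/derivable1_diffP; have [] := dF t.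
rewrite (@continuous_FTC2 _ (fun t => t - L) F)//.
- by rewrite /F -EFinB; congr (_%:E); field.
- apply: continuous_subspaceT => t; apply: cvgB; [exact: cvg_id|exact: cvg_cst].
- split; first by move=> t _; have [] := dF t.
  + by apply: cvg_at_right_filter; exact: cF.
  + by apply: cvg_at_left_filter; exact: cF.
- by move=> t _; rewrite derive1E; have [_ ->] := dF t.
Qed.

Variables (y L : nat -> R) (Delta : R -> R).
Hypotheses (y_gt0 : forall k, 0 < y k)
  (DeltaE : forall n t, epoch y n <= t < epoch y n.+1 -> Delta t = t - L n).

Definition age_reward k : R := (epoch y k - L k) * y k + y k ^+ 2 / 2.

(** The intervals are half-open because the formula for [Delta] changes at [epoch y n.+1]; the
    closed interval of a time average differs by a null set only. *)
Lemma cycle_integral n T : epoch y n <= T <= epoch y n.+1 ->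
  measurable_fun `[epoch y n, T[ (EFin \o Delta) /\
  (\int[leb]_(t in `[epoch y n, T[) (Delta t)%:E =
   ((epoch y n - L n) * (T - epoch y n) + (T - epoch y n) ^+ 2 / 2)%R%:E)%E.
Proof.
move=> /andP[lT Tr].
have DE : {in `[epoch y n, T[%classic, (fun t => (t - L n)%:E) =1 EFin \o Delta}.
  move=> t; rewrite inE/= in_itv/= => /andP[t1 t2]; rewrite (DeltaE n)//.
  by rewrite t1/= (lt_le_trans t2).
split.
  apply: eq_measurable_fun DE _; apply/measurable_EFinP.
  by apply: measurable_funB => //; exact: measurable_cst.
have -> : (\int[leb]_(t in `[epoch y n, T[) (Delta t)%:E =
    \int[leb]_(t in `[epoch y n, T[) (t - L n)%:E)%E.
  by apply: eq_integral => t /DE ->.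
by rewrite integral_sub_cst//; congr (_%:E); field.
Qed.

Lemma age_integral n T : epoch y n <= T <= epoch y n.+1 ->
  measurable_fun `[0, T[ (EFin \o Delta) /\
  (\int[leb]_(t in `[0%R, T[) (Delta t)%:E =
   (\sum_(k < n) age_reward k +
      ((epoch y n - L n) * (T - epoch y n) + (T - epoch y n) ^+ 2 / 2))%R%:E)%E.
Proof.
elim: n T => [|n IH] T lTr; have [mD eD] := cycle_integral _ _ lTr.
  by move: mD eD; rewrite {1 2}/epoch !big_ord0 add0r.
have [|mI eI] := IH (epoch y n.+1); first by rewrite lexx epochS lerDl ltW.
have e0 : 0 <= epoch y n.+1 by exact: epoch_ge0.
have U : `[0, T[%classic = `[0, epoch y n.+1[ `|` `[epoch y n.+1, T[.
  by rewrite -itv_bndbnd_setU// bnd_simp; case/andP: lTr.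
have mU : measurable_fun `[0, T[ (EFin \o Delta) by rewrite U; apply/measurable_funU.
split=> //; rewrite U integral_setU//; first last.
- apply/disj_setPS => t [/=]; rewrite 2!in_itv/= => /andP[_ yx] /andP[].
  by rewrite leNgt yx.
- by rewrite -U.
rewrite eI eD -EFinD; congr (_%:E).
by rewrite big_ord_recr /= /age_reward [X in X - epoch y n]epochS; field.
Qed.

End AgeIntegral.

Section PathAge.
Context {R : realType} {N : nat}.
Variables (g : 'I_N -> nat -> R) (s : nat -> R) (c : 'I_N -> nat -> Prop).
Variables (E b : nat -> R) (B : nat -> bool) (init : R).
Let y k := E k + s k.
Hypotheses (E_gt0 : forall k, 0 < E k) (s_ge0 : forall k, 0 <= s k).
Hypotheses (departureE : forall k, departure g s k = epoch y k.+1)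
  (startE : forall k, service_start g s k = epoch y k + E k)
  (served : forall k, exists i n, g i n = epoch y k + E k)
  (servedE : forall k i n, g i n = epoch y k + E k -> c i n <-> B k).

Let y_gt0 k : 0 < y k. Proof. exact: ltr_wpDr. Qed.

Fixpoint latest n : R :=
  if n is k.+1 then if B k then epoch y k + E k else latest k else init.

Let epoch_le m n : (m <= n)%N -> epoch y m <= epoch y n.
Proof.
elim: n => [|n IH]; first by rewrite leqn0 => /eqP ->.
rewrite leq_eqVlt => /predU1P[->//|]; rewrite ltnS => /IH le.
by rewrite epochS; apply: (le_trans le); rewrite lerDl ltW.
Qed.

Definition informative_starts n : set R :=
  [set u | exists k, [/\ (k < n)%N, B k & u = epoch y k + E k]].

Lemma delivered_informativeE n t : epoch y n <= t < epoch y n.+1 ->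
  delivered_informative g s c t = informative_starts n.
Proof.
move=> /andP[nt tn]; apply/seteqP; split => u /=.
  move=> [i [m [k [-> gk dk cim]]]]; exists k; rewrite startE in gk.
  split=> //; last by have [/(_ cim)] := servedE _ _ _ gk.
  rewrite ltnNge; apply/negP => nk; move: dk; rewrite departureE leNgt => /negP; apply.
  by apply: (lt_le_trans tn); exact: epoch_le.
move=> [k [kn Bk ->]]; have [i [m gE]] := served k.
exists i, m, k; split; rewrite ?startE//; last exact/(servedE _ _ _ gE).
by rewrite departureE; apply: le_trans nt; exact: epoch_le.
Qed.

(** The two cases match those of [last_generation]. Starts of service increase with the cycle, so
    the most recent informative one is the maximum, and the supremum is attained. *)
Lemma latestP n : (informative_starts n = set0 /\ latest n = init) \/
  (informative_starts n (latest n) /\ ubound (informative_starts n) (latest n)).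
Proof.
elim: n => [|n IH]; first by left; split => //; apply/seteqP; split => // u [k []].
rewrite [latest _]/=; case: ifPn => [Bn|Bn].
  right; split; first by exists n.
  move=> u [k [kn Bk ->]]; move: kn; rewrite ltnS leq_eqVlt => /predU1P[->//|kn].
  have := epoch_le k.+1 n kn; rewrite epochS /y => le.
  apply: (@le_trans _ _ (epoch y n)); last by rewrite lerDl ltW.
  by apply: le_trans le; rewrite addrA lerDl.
have -> // : informative_starts n.+1 = informative_starts n.
apply/seteqP; split => u [k [kn Bk ->]]; exists k; split => //; last exact: ltnW.
by move: kn; rewrite ltnS leq_eqVlt => /predU1P[kn|//]; rewrite -kn Bk in Bn.
Qed.

Lemma ageE n t : epoch y n <= t < epoch y n.+1 -> age g s c init t = t - latest n.
Proof.
move=> nt; rewrite /age /last_generation (delivered_informativeE _ _ nt); congr (_ - _).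
have := latestP n => -[[-> ->]|[SL ub]]; case: pselect => //.
- by move=> [u].
- move=> ne; apply/eqP; rewrite eq_le; apply/andP; split; first exact: ge_sup.
  by apply: ub_le_sup => //; exists (latest n).
- by case; exists (latest n).
Qed.

Hypotheses (b0 : b 0%N = 0)
  (bS : forall k, b k.+1 = s k + (1 - (B k)%:R) * (b k + E k)).

(** [b] starts from 0 and not from the true initial age, but an informative packet resets both to
    its service time, and afterwards they obey the same recursion. *)
Lemma residual_latest n0 n : B n0 -> (n0 < n)%N -> epoch y n - latest n = b n.
Proof.
move=> Bn0; elim: n => // n IH; rewrite ltnS leq_eqVlt => /predU1P[<-|/IH e].
  by rewrite /= Bn0 epochS bS Bn0 /y subrr mul0r addr0; ring.
rewrite /= epochS bS -e /y; case: (B n); first by rewrite subrr mul0r; ring.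
by rewrite subr0; ring.
Qed.

Let b_ge0 k : 0 <= b k.
Proof.
elim: k => [|k IH]; first by rewrite b0.
rewrite bS; apply: addr_ge0 => //; apply: mulr_ge0; last by rewrite addr_ge0// ltW.
by case: (B k); rewrite ?subrr ?subr0.
Qed.

Let reward k := b k * y k + y k ^+ 2 / 2.

Let reward_ge0 k : 0 <= reward k.
Proof. by rewrite addr_ge0// ?divr_ge0 ?sqr_ge0// mulr_ge0// ltW. Qed.

Lemma path_time_average (kappa m l : R) : 0 < kappa -> 0 < m ->
  average (fun k => (B k)%:R) @ \oo --> kappa ->
  average y @ \oo --> m -> average reward @ \oo --> l ->
  ((T^-1)%:E * \int[lebesgue_measure]_(t in `[0%R, T]) (age g s c init t)%:E)%E
    @[T --> +oo] --> (l / m)%:E.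
Proof.
move=> kappa0 m0 cB cy cr.
(* If no packet were informative, the fraction of informative cycles would tend to 0 and not to
   [kappa]. *)
have [n0 Bn0] : exists n0, B n0.
  apply: contrapT => nB; move: kappa0; suff -> : kappa = 0 by rewrite ltxx.
  rewrite -(cvg_lim _ cB)//; have -> : average (fun k => (B k)%:R) = fun=> 0 :> R.
    apply/funext => n; rewrite /average big1 ?mul0r// => k _.
    by case: (boolP (B k)) => // Bk; case: nB; exists k.
  by rewrite lim_cst.
pose f T := fine (\int[lebesgue_measure]_(t in `[0%R, T]) (age g s c init t)%:E)%E.
have fE n T : epoch y n <= T < epoch y n.+1 ->
    (\int[lebesgue_measure]_(t in `[0%R, T]) (age g s c init t)%:E =
     (\sum_(k < n) age_reward y latest k +
      ((epoch y n - latest n) * (T - epoch y n) + (T - epoch y n) ^+ 2 / 2))%R%:E)%E.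
  move=> /andP[nT Tn]; have [|mI eI] := age_integral y latest _ y_gt0 ageE n T.
    by rewrite nT ltW.
  by rewrite -eI -integral_itv_bndo_bndc.
have fint T : 0 <= T ->
    (\int[lebesgue_measure]_(t in `[0%R, T]) (age g s c init t)%:E = (f T)%:E)%E.
  by move=> /(epoch_countP y m y_gt0 m0 cy)/fE; rewrite /f => ->.
(* Up to cycle [n0] the age may depend on [init]. [C] is the total discrepancy accumulated by then;
   it stays constant and vanishes after division by the time. *)
pose C := \sum_(k < n0.+1) (age_reward y latest k - reward k).
have sumE n : (n0 < n)%N -> \sum_(k < n) age_reward y latest k = \sum_(k < n) reward k + C.
  elim: n => // n IH; rewrite ltnS leq_eqVlt => /predU1P[<-|n0n].
    by rewrite /C sumrB addrC subrK.
  rewrite !big_ord_recr /= IH// /age_reward (residual_latest _ _ Bn0 n0n) -/(reward n).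
  by rewrite addrAC.
have lim : t^-1 * f t @[t --> +oo] --> l / m.
  apply: (renewal_reward y m y_gt0 m0 cy reward l C f n0.+1) => // n t n0n nt.
  rewrite /f (fE _ _ nt) /= sumE// (residual_latest _ _ Bn0 n0n).
  rewrite addrAC addrK big_ord_recr /=.
  have /andP[nt1 nt2] := nt; rewrite epochS in nt2.
  have t0 : 0 <= t - epoch y n by rewrite subr_ge0.
  have ty : t - epoch y n <= y n by rewrite lerBlDl ltW.
  rewrite lerDl lerD2l; apply/andP; split.
    by rewrite addr_ge0// ?mulr_ge0// ?divr_ge0 ?sqr_ge0.
  by apply: lerD; [exact: ler_wpM2l|rewrite ler_pM2r// ?invr_gt0// lerXn2r// nnegrE ltW].
apply: (@cvg_trans _ ((fun t => (t^-1 * f t)%:E) @ +oo)).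
  apply: near_eq_cvg; have : \forall t \near +oo, 0 <= t :> R.
    by apply: nbhs_pinfty_ge; exact: num_real.
  by apply: filterS => t t0; rewrite fint// EFinM.
by apply: cvg_EFin; [exact: nearW|exact: lim].
Qed.

End PathAge.

(** * The average age *)

Section DepartureMeasurable.
Context {d} {Omega : measurableType d} {R : realType} {N : nat}.
Variables (g : 'I_N -> nat -> Omega -> R) (s : nat -> Omega -> R).
Hypotheses (mg : forall i n, measurable_fun setT (g i n))
  (ms : forall k, measurable_fun setT (s k)).

(* [inf set0 = 0], hence the case distinction. *)
Lemma next_generation_measurable (t : Omega -> R) : measurable_fun setT t ->
  measurable_fun setT (fun w => next_generation (fun i n => g i n w) (t w)).
Proof.
move=> mt; apply: (measurability _ (RGenInftyO.measurableE R)).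
move=> _ [_ [x ->] <-]; rewrite setTI.
pose A i n := [set w | t w < g i n w].
have mA i n : measurable (A i n) by exact: measurable_lt_fun.
have mC i n : measurable (A i n `&` [set w | g i n w < x]).
  by apply: measurableI => //; apply: measurable_lt_fun => //; exact: measurable_cst.
rewrite (_ : _ @^-1` _ = (\bigcup_i \bigcup_n (A i n `&` [set w | g i n w < x])) `|`
   ((\bigcap_i \bigcap_n (~` A i n)) `&` [set _ | 0 < x])).
  apply: measurableU.
    apply: fin_bigcup_measurable => // i _; exact: bigcupT_measurable.
  apply: measurableI.
    apply: fin_bigcap_measurable => // i _; apply: bigcapT_measurable => n.
    exact: measurableC.
  by case: (0 < x); rewrite ?set_true ?set_false.
apply/seteqP; split => w; rewrite /next_generation /= in_itv/=.
  set S := [set u | _]; have [[u Su]|S0] := pselect (S !=set0).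
    move=> /inf_lt => /(_ (ex_intro _ u Su)) [v [tv [i [n vE]]] vx]; left.
    by exists i => //; exists n => //; rewrite /A/= -vE.
  have -> : S = set0 by apply/seteqP; split => // u Su; case: S0; exists u.
  rewrite inf0 => x0; right; split => // i _ n _ /= lt.
  by apply: S0; exists (g i n w); split => //; exists i, n.
case=> [[i _ [n _ [/= lt gx]]]|[H x0]].
  apply: le_lt_trans gx; apply: ge_inf; first by exists (t w) => u [/ltW].
  by split => //; exists i, n.
rewrite (_ : [set u | _] = set0) ?inf0//; apply/seteqP; split => // u [tu [i [n uE]]].
by apply: (H i I n I); rewrite /A/= -uE.
Qed.

Lemma departure_measurable k :
  measurable_fun setT (fun w => departure (fun i n => g i n w) (fun k => s k w) k).
Proof.
elim: k => [|k IH] /=; apply: measurable_funD => //; apply: next_generation_measurable => //.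
Qed.

Lemma inter_departure_measurable k :
  measurable_fun setT (fun w => inter_departure (fun i n => g i n w) (fun k => s k w) k).
Proof. by apply: measurable_funB; exact: departure_measurable. Qed.

End DepartureMeasurable.

Section RegularSystem.
Context {d} {Omega : measurableType d} {R : realType} (P : probability Omega R).
Context {N : nat} (i0 : 'I_N).
Variables (lambda p : 'I_N -> R) (mu : R).
Hypotheses (lambda_gt0 : forall i, 0 < lambda i) (p_ge0 : forall i, 0 <= p i) (mu_gt0 : 0 < mu).
Variables (g : 'I_N -> nat -> Omega -> R) (c : 'I_N -> nat -> set Omega)
  (s : nat -> Omega -> R).
Hypotheses (pg : forall w, arrival_path (fun i n => g i n w))
  (mg : forall i n, measurable_fun setT (g i n)) (mc : forall i n, measurable (c i n))
  (ms : forall k, measurable_fun setT (s k)) (s_ge0 : forall k w, 0 <= s k w).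

Local Notation idle := (idle i0 g s).
Local Notation mark := (mark i0 g c s).
Local Notation history := (history i0 g c s).
Local Notation cycle := (fun k w => idle k w + s k w).

Lemma last_departureE k w : last_departure g s k w = epoch (fun k => cycle k w) k.
Proof.
elim: k => [|k IH]; first by rewrite /epoch big_ord0.
by rewrite (last_departureS i0 g s pg) IH epochS.
Qed.

Lemma service_startE k w :
  service_start (fun i n => g i n w) (fun k => s k w) k = last_departure g s k w + idle k w.
Proof. by case: k => [|k]; exact: (next_generationE i0 _ _ (pg w)). Qed.

(** [delivered_informative] recognises the served packet by its generation time only. As there are
    no ties, this time determines the packet, and hence whether the cycle is informative. *)
Lemma served_packet k w i n : g i n w = last_departure g s k w + idle k w <->
  i = first_source i0 (fun i n => cycle_times g s k i n w) /\
  n = count_points (g i ^~ w) (last_departure g s k w).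
Proof.
set t := last_departure g s k w; set i1 := first_source _ _.
have E : g i1 (count_points (g i1 ^~ w) t) w = t + idle k w.
  by rewrite /idle /wait /waiting_time -/i1 /cycle_times /shift_times /shift_points addn0 addrC subrK.
split=> [gE|[-> ->]]; last exact: E.
have ii1 : i = i1.
  have [_ inj] := pg w; apply: (inj i i1 n (count_points (g i1 ^~ w) t)).
  by rewrite gE E.
split => //; rewrite {}ii1 in gE *.
have pi1 : point_process (g i1 ^~ w) by have [+ _] := pg w; apply.
case: (ltngtP n (count_points (g i1 ^~ w) t)) => // lt.
  by have := point_process_lt _ _ _ pi1 lt; rewrite /= gE E ltxx.
by have := point_process_lt _ _ _ pi1 lt; rewrite /= gE E ltxx.
Qed.

Hypotheses (fresh0 : fresh_sources P lambda p (services s) g c)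
  (services_indep : forall k A (B : set R), <<s past_services s k >> A ->
     measurable B -> P (A `&` s k @^-1` B) = (P A * P (s k @^-1` B))%E)
  (s_tail : forall k x, 0 <= x -> P [set w | x < s k w] = (expR (- mu * x))%:E).

Let Lambda := \sum_i lambda i.
Let kappa := \sum_i p i * lambda i / \sum_i lambda i.

Let Lambda_gt0 : 0 < Lambda.
Proof.
rewrite /Lambda (bigD1 i0)//=; apply: ltr_wpDr => //.
by apply: sumr_ge0 => i _; exact: ltW.
Qed.

Let idle0 k w : 0 < idle k w. Proof. exact: idle_gt0. Qed.

Lemma idle_tail k x : 0 <= x -> P [set w | x < idle k w] = (expR (- Lambda * x))%:E.
Proof.
move=> x0; have ml := idle_memoryless P i0 lambda p lambda_gt0 p_ge0 g c s pg mg mc ms s_ge0 fresh0 k.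
have := ml setT x x0 (sigma_setT _).
rewrite setTI setIT => ->.
by rewrite probability_setT mul1e mul1r.
Qed.

Hypothesis kappa_gt0 : 0 < kappa.

Let m2 := Ex P (fun w => idle 0 w ^+ 2) + 2 * (Lambda^-1 * mu^-1) + Ex P (fun w => s 0 w ^+ 2).

Lemma regular_system_average init :
  [/\ forall k, integrable_var P (cycle k) /\ Ex P (cycle k) = Lambda^-1 + mu^-1,
      forall k, integrable_var P (fun w => cycle k w ^+ 2) /\ Ex P (fun w => cycle k w ^+ 2) = m2 &
      has_time_average P (fun w => age (fun i n => g i n w) (fun k => s k w)
                                       (fun i n => c i n w) init)
        (((mu^-1 + (1 - kappa) * Lambda^-1) / kappa * (Lambda^-1 + mu^-1) + m2 / 2)
          / (Lambda^-1 + mu^-1))%:E].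
Proof.
(* Unlike [history k], this past contains only the services before [k], so [s k] is independent of
   it. It serves the averages with [s k - mu^-1], while [history] serves those of idle periods and
   marks. *)
pose F k := past_cycles i0 g c s k `|` past_services s k.
have sub_past (G1 G2 : nat -> set_system Omega) k : (forall A, G1 k A -> G2 k.+1 A) ->
  forall A, G1 k A -> <<s G2 k.+1 >> A by move=> sub A /sub; exact: sub_sigma_algebra.
have Hm k : history k `<=` measurable by have [] := cycle_regular i0 g c s pg mg mc ms s_ge0 k.
have HS k : history k `<=` <<s history k.+1 >>.
  by move=> A HA; apply: sub_sigma_algebra; left.
have FS k : F k `<=` <<s F k.+1 >>.
  move=> A HA; apply: sub_sigma_algebra; case: HA => -[l lk HA]; [left|right];
    by exists l => //; exact: leqW.
have sH k l : measurable_for (history k) (s l) by exact: service_history.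
have FH k : F k `<=` <<s history k >>.
  move=> A [HA|[l _ [D mD ->]]]; last exact: sH.
  exact: past_cycles_history HA.
have EH k : measurable_for (history k.+1) (idle k).
  by move=> D mD; apply: sub_sigma_algebra; right; left; exists D.
have BH k : <<s history k.+1 >> (mark k) by apply: sub_sigma_algebra; right; right.
have sF k : measurable_for (F k.+1) (s k).
  by move=> D mD; apply: sub_sigma_algebra; right; exists k => //; exists D.
have EF k : measurable_for (F k.+1) (idle k).
  by move=> D mD; apply: sub_sigma_algebra; left; exists k => //; left; exists D.
have BF k : <<s F k.+1 >> (mark k).
  by apply: sub_sigma_algebra; left; exists k => //; right.
have E_indep := idle_indep P i0 lambda p lambda_gt0 p_ge0 g c s pg mg mc ms s_ge0 fresh0.
have B_indep := mark_indep P i0 lambda p lambda_gt0 p_ge0 g c s pg mg mc ms s_ge0 fresh0.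
have s_indep := service_indep P i0 lambda p lambda_gt0 p_ge0 g c s pg mg mc ms s_ge0 fresh0 services_indep.
have E_ge0 k w : 0 <= idle k w by exact: ltW.
split.
- exact: (cycle_mean P idle s history Lambda mu Lambda_gt0 mu_gt0 Hm sH EH E_ge0 s_ge0 idle_tail s_tail).
- exact: (cycle_second_moment P idle s history Lambda mu Lambda_gt0 mu_gt0 Hm sH EH E_indep E_ge0 s_ge0 idle_tail s_tail).
have := cycle_limits P idle s mark history F Lambda mu kappa Lambda_gt0 mu_gt0 kappa_gt0
  Hm HS FS FH sH EH BH sF EF BF E_indep B_indep s_indep E_ge0 s_ge0 idle_tail s_tail.
apply: filterS => w [cB cy cr].
have e0 : 0 < Lambda^-1 + mu^-1 by rewrite addr_gt0 ?invr_gt0.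
have depE k : departure (fun i n => g i n w) (fun k => s k w) k =
    epoch (fun k => idle k w + s k w) k.+1 by rewrite -last_departureE.
have startE k : service_start (fun i n => g i n w) (fun k => s k w) k =
    epoch (fun k => idle k w + s k w) k + idle k w.
  by rewrite service_startE last_departureE.
have served k : exists i n, g i n w = epoch (fun k => idle k w + s k w) k + idle k w.
  by do 2 eexists; rewrite -last_departureE; apply/served_packet; split.
have servedE k i n : g i n w = epoch (fun k => idle k w + s k w) k + idle k w ->
    c i n w <-> w \in mark k.
  rewrite -last_departureE => /served_packet[-> ->]; rewrite in_setE.
  by rewrite /mark /next_mark /cycle_marks /shift_marks /= addn0.
have bS k : residual_age idle s mark k.+1 w =
  s k w + (1 - (w \in mark k)%:R) * (residual_age idle s mark k w + idle k w) by [].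
exact: (path_time_average _ _ _ _ _ _ init (fun k => idle0 k w) (fun k => s_ge0 k w)
  depE startE served servedE (erefl _) bS kappa _ _ kappa_gt0 e0 cB cy cr).
Qed.

End RegularSystem.

(** [same_law_integral] asks for a nonnegative integrand, whereas [Y] is nonnegative only almost
    surely, by its law. Both sides are therefore compared through the absolute value. *)
Lemma same_law_expectation d (Omega : measurableType d) d' (Omega' : measurableType d')
    (R : realType) (P : probability Omega R) (Q : probability Omega' R)
    (X : Omega -> R) (Y : Omega' -> R) :
  measurable_fun setT X -> measurable_fun setT Y -> (forall w, 0 <= X w) ->
  (forall A, measurable A -> P (X @^-1` A) = Q (Y @^-1` A)) ->
  (\int[P]_w (X w)%:E = \int[Q]_w (Y w)%:E)%E.
Proof.
move=> mX mY X0 law.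
have -> : (\int[Q]_w (Y w)%:E = \int[Q]_w (`|Y w|)%:E)%E.
  have mn : measurable_fun setT (fun w => `|Y w|) by exact: measurableT_comp.
  apply: ae_eq_integral => //; [exact/measurable_EFinP|exact/measurable_EFinP|].
  have mA : measurable (`[0, +oo[%classic : set R) by exact: measurable_itv.
  have mYA : measurable (Y @^-1` `[0, +oo[%classic) by exact: preimage_measurable.
  have : {ae Q, forall w, (Y @^-1` `[0, +oo[%classic) w}.
    apply: ae_prob1 => //; rewrite -law// (_ : _ @^-1` _ = setT) ?probability_setT//.
    by apply/seteqP; split => // w _; rewrite /= in_itv/= andbT.
  by apply: filterS => w /=; rewrite in_itv/= andbT => Yw _; rewrite ger0_norm.
have mnorm : measurable_fun setT (fun x : R => `|x|) by exact: normr_measurable.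
rewrite -(same_law_integral P Q X Y _ mX mY mnorm)//.
by apply: eq_integral => w _; rewrite ger0_norm.
Qed.

(** With [e = L^-1 + mu^-1], the prefactor [L / (L + mu)] equals [1 / (mu * e)], so it contains the
    division by the mean cycle length. The mean residual age [(mu^-1 + (1 - p) * L^-1) / p] is
    [mu^-1 + e * (1 - p) / p]. *)
Lemma renewal_age_formula (R : realType) (L mu p m : R) : 0 < L -> 0 < mu -> 0 < p ->
  L / (L + mu) * (mu * m * 2^-1 + mu * (L^-1 + mu^-1) ^+ 2 * ((1 - p) / p) + (L^-1 + mu^-1)) =
  ((mu^-1 + (1 - p) * L^-1) / p * (L^-1 + mu^-1) + m / 2) / (L^-1 + mu^-1).
Proof.
move=> L0 mu0 p0; have Lmu : L + mu != 0 by rewrite gt_eqF// addr_gt0.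
have -> : L^-1 + mu^-1 = (L + mu) / (L * mu) by field; rewrite !gt_eqF.
field; rewrite ?gt_eqF ?addr_gt0 //.
Qed.

Theorem theorem1 (R : realType) (d : measure_display) (Omega : measurableType d)
    (P : probability Omega R) (N M : nat) (N_gt0 : (0 < N)%N) (M_gt0 : (0 < M)%N)
    (lambda : 'I_N -> R) (p : 'I_N -> 'I_M -> R) (mu : R)
    (lambda_gt0 : forall i, 0 < lambda i)
    (p01 : forall i j, 0 <= p i j <= 1)
    (mu_gt0 : 0 < mu)
    (gen : 'I_N -> nat -> {RV P >-> R})
    (info : 'I_N -> nat -> 'I_M -> set Omega)
    (serv : nat -> {RV P >-> R})
    (sys : status_update_system P (fun i n => gen i n) info (fun k => serv k)
             lambda p mu)
    (* Y, possibly on another space, has the law of an inter-departure time *)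
    (d' : measure_display) (Omega' : measurableType d') (Q : probability Omega' R)
    (Y : {RV Q >-> R}) (k : nat)
    (Y_law : forall A : set R, measurable A ->
       Q (Y @^-1` A) =
       P ((fun w => inter_departure (fun i n => gen i n w) (fun k => serv k w) k)
            @^-1` A))
    (init : 'I_M -> R) (j : 'I_M)
    (pj_gt0 : 0 < informative_fraction lambda p j) :
  let lambdaC := total_rate lambda in
  let pj := informative_fraction lambda p j in
  has_time_average P
    (fun w => age (fun i n => gen i n w) (fun k => serv k w)
                  (fun i n => info i n j w) (init j))
    ((lambdaC / (lambdaC + mu))%:E *
     (mu%:E * 'E_Q[fun w => (Y w ^+ 2)%R] * 2^-1%:E
      + mu%:E * 'E_Q[Y] ^+ 2 * ((1 - pj) / pj)%:E
      + 'E_Q[Y]))%E.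
Proof.
move=> lambdaC pj; pose i0 := Ordinal N_gt0.
have p_ge0 i : 0 <= p i j by have /andP[] := p01 i j.
have mgen i n : measurable_fun setT (gen i n) by [].
have mserv n : measurable_fun setT (serv n) by [].
case: (regular_version P lambda p mu lambda_gt0 mu_gt0 (fun i n => gen i n) info
  (fun k => serv k) mgen mserv sys j) => O [g [s [mO PO eqO [pg s0] [[mg ms] fresh0 sind s_tail]]]].
have mc i n : measurable (info i n j) by exact: measurable_info sys i n j.
have kappaE : \sum_i p i j * lambda i / \sum_i lambda i = pj.
  by rewrite /pj /informative_fraction /informative_rate mulr_suml.
have kappa_gt0 : 0 < \sum_i p i j * lambda i / \sum_i lambda i by rewrite kappaE.
have [mean second avg] := regular_system_average P i0 lambda (p^~ j) mu lambda_gt0 p_ge0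
  mu_gt0 g _ s pg mg mc ms s0 fresh0 sind s_tail kappa_gt0 (init j).
have agree w : O w -> (fun i n => gen i n w) = (fun i n => g i n w) /\
    (fun k => serv k w) = (fun k => s k w).
  move=> /eqO[gE sE]; split; last by apply/funext.
  by apply/funext => i; apply/funext => n.
(* [inter_departure k] runs from departure [k] to departure [k.+1], which is cycle [k.+1]: cycle 0
   ends with departure 0. *)
pose y w := idle i0 g s k.+1 w + s k.+1 w.
have y0 w : 0 <= y w by apply: addr_ge0 => //; apply: ltW; apply: idle_gt0.
have my : measurable_fun setT y by exact: measurable_funD (idle_measurable i0 g _ s pg mg mc ms s0 k.+1) (ms _).
have law A : measurable A -> P (y @^-1` A) = Q (Y @^-1` A).
  move=> mA; rewrite Y_law//.
  have mi := inter_departure_measurable (fun i n => gen i n) (fun k => serv k) mgen mserv k.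
  rewrite (prob_ae P O (y @^-1` A) mO PO); last by exact: preimage_measurable.
  rewrite [RHS](prob_ae P O _ mO PO); last by exact: preimage_measurable.
  congr (P _); apply/seteqP.
  suff E w : O w -> inter_departure (fun i n => gen i n w) (fun k => serv k w) k = y w.
    by split => w /= [Aw Ow]; split => //; move: Aw; rewrite E.
  move=> /agree[-> ->]; change (last_departure g s k.+2 w - last_departure g s k.+1 w = y w).
  by rewrite (last_departureS i0 g s pg) addrAC subrr add0r.
have [iy Ey] := mean k.+1; have [iy2 Ey2] := second k.+1.
have EY : ('E_Q[Y] = ((\sum_i lambda i)^-1 + mu^-1)%R%:E)%E.
  rewrite unlock -(same_law_expectation _ _ _ _ _ P Q y Y)//.
  by rewrite -Ey -(ExE P _ iy).
have EY2 : ('E_Q[fun w => (Y w ^+ 2)%R] = (Ex P (fun w => y w ^+ 2))%:E)%E.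
  rewrite unlock -(ExE P _ iy2).
  rewrite (same_law_integral P Q y Y (fun x => x ^+ 2))//.
  by move=> x; exact: sqr_ge0.
rewrite -{}Ey2 in avg.
rewrite EY EY2 /has_time_average.
have -> : ((lambdaC / (lambdaC + mu))%:E * (mu%:E * (Ex P (fun w => y w ^+ 2)%R)%:E * 2^-1%:E +
   mu%:E * (((\sum_i lambda i)^-1 + mu^-1)%R%:E) ^+ 2 * ((1 - pj) / pj)%:E +
   ((\sum_i lambda i)^-1 + mu^-1)%R%:E))%E =
   (((mu^-1 + (1 - pj) * lambdaC^-1) / pj * (lambdaC^-1 + mu^-1) + Ex P (fun w => y w ^+ 2)%R / 2)
          / (lambdaC^-1 + mu^-1))%:E.
  set e := (\sum_i lambda i)^-1; set m2 := Ex P _.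
  transitivity (lambdaC / (lambdaC + mu) * (mu * m2 * 2^-1 +
    mu * (e + mu^-1) ^+ 2 * ((1 - pj) / pj) + (e + mu^-1)))%:E.
    by rewrite expe2 EFinM !EFinD !EFinM.
  have l0 : 0 < lambdaC.
    rewrite /lambdaC /total_rate (bigD1 i0)//=; apply: ltr_wpDr => //.
    by apply: sumr_ge0 => i _; exact: ltW.
  by congr (_%:E); exact: renewal_age_formula.
(* On [O] the given paths and the regular ones are equal, so their ages are the same functions of
   time. *)
have aeO : {ae P, forall w, O w} by exact: ae_prob1.
move: aeO avg; apply: filterS2 => w /agree[-> ->].
by rewrite kappaE.
Qed.
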